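(* Let $(\Omega,\mu)$ be a measure space with $\mu(\Omega)=1$. Let $E$ be an r.i. space, $b\in SV(0,1)$, $1<p_0<p_1<\infty$ and $\alpha,\beta>0$. Put $\rho(u)=u^{\frac1{p_0}-\frac1{p_1}}\ell^{\frac{\alpha}{p_0'}+\frac{\beta}{p_1}}(u)$, $u\in(0,1)$. (a) If $0<\theta<1$, then $\big(L^{(p_0,\alpha},L^{p_1),\beta}\big)_{\theta,b,E}=L_{p,B_\theta,E}$, where $\frac1p=\frac{1-\theta}{p_0}+\frac{\theta}{p_1}$ and $B_\theta(u)=\ell^{\frac{\alpha(1-\theta)}{p_0'}-\frac{\beta\theta}{p_1}}(u)\,b(\rho(u))$, $u\in(0,1)$. (b) If $\theta=0$, then $$\big(L^{(p_0,\alpha},L^{p_1),\beta}\big)_{0,b,E}=L^{\mathcal L}_{p_0,B_0,E,1,L_{p_0}}\cap L^{\mathcal L,\mathcal L}_{p_0,\,b\circ\rho,\,E,\,\ell^{\alpha/p_0'-1}(u),\,L_1,\,1,\,L_{p_0}},$$ where $B_0(u)=\ell^{\alpha/p_0'}(u)\,b(\rho(u))$, $u\in(0,1)$. (c) If $\theta=1$ and $\|b\|_{\widetilde E(0,1)}<\infty$, then $$\big(L^{(p_0,\alpha},L^{p_1),\beta}\big)_{1,b,E}=L^{\mathcal R}_{p_1,B_1,E,1,L_{p_1}}\cap L^{\mathcal R,\mathcal R}_{p_1,\,b\circ\rho,\,E,\,\ell^{-\beta/p_1}(u),\,L_\infty,\,1,\,L_{p_1}},$$ where $B_1(u)=\ell^{-\beta/p_1}(u)\,b(\rho(u))$,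 $u\in(0,1)$.
   Context: Notation. $\ell(t)=1+|\log t|$, $\ell^\sigma(t)=(\ell(t))^\sigma$; $\frac1p+\frac1{p'}=1$. An r.i. space $E$ is a rearrangement invariant Banach function space on $(0,\infty)$ with the Fatou property; $\widetilde E$ is the corresponding space for the measure $dt/t$, with $\|g\|_{\widetilde E}=\|g^\star\|_E$ ($g^\star$ the non-increasing rearrangement with respect to $dt/t$); for an interval $I$, $\|g\|_{\widetilde E(I)}=\|g\chi_I\|_{\widetilde E}$. So $\|g\|_{\widetilde L_q(I)}=(\int_I|g(s)|^q\,ds/s)^{1/q}$ and $\widetilde L_\infty=L_\infty$. A positive finite measurable $b$ on $(0,1)$ is in $SV(0,1)$ if for all $\varepsilon>0$, $t^\varepsilon b(t)$ is equivalent to a non-decreasing function and $t^{-\varepsilon}b(t)$ to a non-increasing one on $(0,1)$. In $b(\rho(u))$, $b$ is understood as extended to $[1,\infty)$ by $b(s)=1$ for $s\ge1$ (the choice of slowly varying extension is immaterial up to equivalence of norms). Interpolation spaces: for (quasi-)Banach spaces with $Y_1\hookrightarrow Y_0$, $(Y_0,Y_1)_{\theta,b,E}$ is the set of $f\in Y_0$ with $\|t^{-\theta}b(t)K(t,f;Y_0,Y_1)\|_{\widetilde E(0,1)}<\infty$, $0\le\theta\le1$, where $K$ is Peetre's $K$-functional. Function spaces: $f^*$ is the non-increasing rearrangement of a $\mu$-measurable function $f$ on $\Omega$. Each space is the set of measurable $f$ with finite indicated norm (innermost norm in $s$, next in $t$, outermost in $u$), $1<p<\infty$: - $L_{p,b,E}$: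 $\|t^{1/p}b(t)f^*(t)\|_{\widetilde E(0,1)}$; - $L^{\mathcal R}_{p,b,E,a,F}$: $\big\|b(t)\|s^{1/p}a(s)f^*(s)\|_{\widetilde F(t,1)}\big\|_{\widetilde E(0,1)}$; - $L^{\mathcal L}_{p,b,E,a,F}$: $\big\|b(t)\|s^{1/p}a(s)f^*(s)\|_{\widetilde F(0,t)}\big\|_{\widetilde E(0,1)}$; - $L^{\mathcal R,\mathcal R}_{p,c,E,b,F,a,G}$: $\Big\|c(u)\big\|b(t)\|s^{1/p}a(s)f^*(s)\|_{\widetilde G(t,1)}\big\|_{\widetilde F(u,1)}\Big\|_{\widetilde E(0,1)}$; - $L^{\mathcal L,\mathcal L}_{p,c,E,b,F,a,G}$: $\Big\|c(u)\big\|b(t)\|s^{1/p}a(s)f^*(s)\|_{\widetilde G(0,t)}\big\|_{\widetilde F(0,u)}\Big\|_{\widetilde E(0,1)}$; - grand Lebesgue space $L^{p),\alpha}$ ($\alpha>0$): $\Big\|\ell^{-\alpha/p}(t)\|s^{1/p}f^*(s)\|_{\widetilde L_p(t,1)}\Big\|_{L_\infty(0,1)}$; - small Lebesgue space $L^{(p,\alpha}$ ($\alpha>0$): $\Big\|\ell^{\alpha/p'-1}(t)\|s^{1/p}f^*(s)\|_{\widetilde L_p(0,t)}\Big\|_{\widetilde L_1(0,1)}$. Equality of spaces means equality as sets with equivalent norms. *)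

(* Defs.v *)
From HB Require Import structures.
From mathcomp Require Import all_boot all_order all_algebra.
From mathcomp Require Import all_classical all_reals all_analysis.
From mathcomp Require Import measurable_realfun.
Set Implicit Arguments.
Unset Strict Implicit.
Unset Printing Implicit Defensive.
Import Order.TTheory GRing.Theory Num.Theory.
Import numFieldNormedType.Exports.
Local Open Scope classical_set_scope.
Local Open Scope ring_scope.

Section rearrangement.
Context {R : realType}.
Local Open Scope ereal_scope.

Definition pos_half : set R := `]0%R, +oo[.

(* The infimum of the empty set is +oo, so functions with values in \bar R
   are allowed. *)
Definition rearr {X : Type} (m : set X -> \bar R) (g : X -> \bar R) (t : R) :
    \bar R :=
  ereal_inf [set l%:E | l in
    [set l : R | (0 <= l)%R /\ m [set x | l%:E < `|g x|] <= t%:E]].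

(* The measure dt/t on (0, +oo), as a set function on subsets of R. *)
Definition dtt (A : set R) : \bar R :=
  \int[lebesgue_measure]_(t in A `&` pos_half) (t^-1)%:E.

End rearrangement.

Section ri_spaces.
Context {R : realType}.
Local Open Scope ereal_scope.

(* A function on (0, +oo) is encoded as a function on R whose values outside
   (0, +oo) are ignored. *)
Definition mplus (f : R -> \bar R) : Prop :=
  measurable_fun pos_half f /\ forall x : R, (0 < x)%R -> 0 <= f x.

Definition ae_pos (P : R -> Prop) : Prop :=
  {ae @lebesgue_measure R, forall x : R, (0 < x)%R -> P x}.

Definition equimeasurable (f g : R -> \bar R) : Prop :=
  forall l : R, (0 <= l)%R ->
    lebesgue_measure (pos_half `&` [set x : R | l%:E < f x]) =
    lebesgue_measure (pos_half `&` [set x : R | l%:E < g x]).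

(* Rearrangement invariant Banach function norms on (0, +oo) in the sense of
   Bennett and Sharpley; a space is given by its norm on nonnegative
   measurable functions. *)
Record ri_norm (E : (R -> \bar R) -> \bar R) : Prop := RiNorm {
  ri_ge0 : forall f, mplus f -> 0 <= E f;
  ri_eq0 : forall f, mplus f -> (E f = 0 <-> ae_pos (fun x => f x = 0));
  ri_scale : forall (a : R) f, (0 <= a)%R -> mplus f ->
    E (fun x => a%:E * f x) = a%:E * E f;
  ri_triangle : forall f g, mplus f -> mplus g ->
    E (fun x => f x + g x) <= E f + E g;
  ri_mono : forall f g, mplus f -> mplus g ->
    ae_pos (fun x => f x <= g x) -> E f <= E g;
  ri_fatou : forall (f_ : nat -> R -> \bar R) f,
    (forall n, mplus (f_ n)) -> mplus f ->
    ae_pos (fun x => {homo f_ ^~ x : m n / (m <= n)%N >-> m <= n} /\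
                     f_ n x @[n --> \oo] --> f x) ->
    E (f_ n) @[n --> \oo] --> E f;
  ri_indic : forall A : set R, measurable A -> A `<=` pos_half ->
    lebesgue_measure A < +oo -> E (fun x => (\1_A x)%:E) < +oo;
  ri_integral : forall A : set R, measurable A -> A `<=` pos_half ->
    lebesgue_measure A < +oo ->
    exists2 C : R, (0 < C)%R &
      forall f, mplus f -> \int[lebesgue_measure]_(x in A) f x <= C%:E * E f;
  ri_invariant : forall f g, mplus f -> mplus g ->
    equimeasurable f g -> E f = E g }.

Definition Leb (q : \bar R) (g : R -> \bar R) : \bar R :=
  Lnorm (@lebesgue_measure R) q (g \_ pos_half).

(* The norm of g in \widetilde E(I): the E-norm of the rearrangement of g \chi_I
   with respect to dt/t. *)
Definition tnorm (E : (R -> \bar R) -> \bar R) (I : set R) (g : R -> \bar R) :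
    \bar R :=
  E (rearr dtt (g \_ I)).

End ri_spaces.

Section weights.
Context {R : realType}.

Definition ell (t : R) : R := 1 + `|ln t|.

Definition conj_exp (p : R) : R := p / (p - 1).

Definition equiv_on (D : set R) (f g : R -> R) : Prop :=
  exists c C : R, [/\ 0 < c, 0 < C &
    forall t, D t -> c * g t <= f t <= C * g t].

Definition nondecreasing_on (D : set R) (f : R -> R) : Prop :=
  forall s t, D s -> D t -> s <= t -> f s <= f t.

Definition nonincreasing_on (D : set R) (f : R -> R) : Prop :=
  forall s t, D s -> D t -> s <= t -> f t <= f s.

Record SV01 (b : R -> R) : Prop := MkSV01 {
  SV_meas : measurable_fun (`]0, 1[ : set R) b;
  SV_gt0 : forall t, 0 < t < 1 -> 0 < b t;
  SV_incr : forall e, 0 < e -> exists2 phi : R -> R,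
    nondecreasing_on `]0, 1[ phi & equiv_on `]0, 1[ (fun t => t `^ e * b t) phi;
  SV_decr : forall e, 0 < e -> exists2 psi : R -> R,
    nonincreasing_on `]0, 1[ psi &
    equiv_on `]0, 1[ (fun t => t `^ (- e) * b t) psi }.

(* Only the values of b on (0, 1) are meaningful; it is extended by 1. *)
Definition ext1 (b : R -> R) (s : R) : R := if s < 1 then b s else 1.

End weights.

(* A space of vectors of V together with its (quasi-)norm, the latter being
   given on all of V with +oo allowed. *)
Record nspace (R : realType) (V : Type) := NSpace {
  carr : set V;
  nnorm : V -> \bar R }.

Section spaces.
Context {R : realType}.
Local Open Scope ereal_scope.

Definition space_eq (V : Type) (X Y : nspace R V) : Prop :=
  carr X = carr Y /\
  exists c C : R, [/\ (0 < c)%R, (0 < C)%R & forall f, carr X f ->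
    c%:E * nnorm Y f <= nnorm X f /\ nnorm X f <= C%:E * nnorm Y f].

Definition space_cap (V : Type) (X Y : nspace R V) : nspace R V :=
  NSpace (carr X `&` carr Y) (fun f => maxe (nnorm X f) (nnorm Y f)).

Definition Kfun (V : zmodType) (Y0 Y1 : nspace R V) (t : R) (f : V) : \bar R :=
  ereal_inf [set r | exists f0 f1 : V,
    [/\ carr Y0 f0, carr Y1 f1, f = (f0 + f1)%R &
        r = nnorm Y0 f0 + t%:E * nnorm Y1 f1]].

Definition interp (V : zmodType) (Y0 Y1 : nspace R V) (theta : R)
    (b : R -> R) (E : (R -> \bar R) -> \bar R) : nspace R V :=
  let N f := tnorm E `]0%R, 1%R[
    (fun t => (t `^ (- theta) * b t)%:E * Kfun Y0 Y1 t f) in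
  NSpace [set f | carr Y0 f /\ N f < +oo] N.

End spaces.

Section function_spaces.
Context {R : realType} {d : measure_display} {T : measurableType d}.
Variable mu : set T -> \bar R.
Implicit Types (a b c : R -> R) (E F G : (R -> \bar R) -> \bar R).
Local Open Scope ereal_scope.

Definition fstar (f : T -> R) : R -> \bar R := rearr mu (EFin \o f).

Definition space_of (N : (T -> R) -> \bar R) : nspace R (T -> R) :=
  NSpace [set f | measurable_fun setT f /\ N f < +oo] N.

Definition wstar (p : R) a (f : T -> R) (s : R) : \bar R :=
  (s `^ p^-1 * a s)%:E * fstar f s.

(* In the usual notation, ultraL is L_{p,b,E}, spaceR and spaceL are
   L^R_{p,b,E,a,F} and L^L_{p,b,E,a,F}, and spaceRR and spaceLL are
   L^{R,R}_{p,c,E,b,F,a,G} and L^{L,L}_{p,c,E,b,F,a,G}. *)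
Definition ultraL (p : R) b E := space_of (fun f =>
  tnorm E `]0%R, 1%R[ (wstar p b f)).

Definition spaceR (p : R) b E a F := space_of (fun f =>
  tnorm E `]0%R, 1%R[ (fun t => (b t)%:E *
    tnorm F `]t, 1%R[ (wstar p a f))).

Definition spaceL (p : R) b E a F := space_of (fun f =>
  tnorm E `]0%R, 1%R[ (fun t => (b t)%:E *
    tnorm F `]0%R, t[ (wstar p a f))).

Definition spaceRR (p : R) c E b F a G := space_of (fun f =>
  tnorm E `]0%R, 1%R[ (fun u => (c u)%:E *
    tnorm F `]u, 1%R[ (fun t => (b t)%:E *
      tnorm G `]t, 1%R[ (wstar p a f)))).

Definition spaceLL (p : R) c E b F a G := space_of (fun f =>
  tnorm E `]0%R, 1%R[ (fun u => (c u)%:E *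
    tnorm F `]0%R, u[ (fun t => (b t)%:E *
      tnorm G `]0%R, t[ (wstar p a f)))).

(* Grand Lebesgue space L^{p),alpha}. *)
Definition grandL (p alpha : R) := space_of (fun f =>
  Leb +oo ((fun t => (ell t `^ (- (alpha / p)))%:E *
    tnorm (Leb p%:E) `]t, 1%R[ (wstar p (cst 1%R) f)) \_ `]0%R, 1%R[)).

(* Small Lebesgue space L^{(p,alpha}. *)
Definition smallL (p alpha : R) := space_of (fun f =>
  tnorm (Leb 1) `]0%R, 1%R[
    (fun t => (ell t `^ (alpha / conj_exp p - 1))%:E *
      tnorm (Leb p%:E) `]0%R, t[ (wstar p (cst 1%R) f))).

End function_spaces.

(* Main.v *)
(* Cut (0, 1) into the cells [e^{-k-1}, e^{-k}), each of dt/t-measure 1.  All the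
   weights involved are essentially constant on each cell, and f^* is
   monotone, so every norm is equivalent to a rearrangement invariant
   norm of a weighted sequence built from phi_k = f^*(e^{-k}).  Truncating f at
   the level phi_m yields Holmstedt's formula
     K(rho_m, f) ~ I_m + J_m + rho_m D_m,    rho_m = rho(e^{-m}),
   where I_m and J_m come from the small Lebesgue norm on (0, e^{-m}) and D_m is
   the grand Lebesgue norm on (e^{-m}, 1).  Since the index map between the
   scales e^{-n} and rho_m has uniformly bounded fibres, the interpolation norm
   is the norm of (rho_m^{-theta} b(rho_m) K(rho_m, f))_m.  For theta > 0 the
   weights decay geometrically along tails, so that I and J are controlled by
   omega_m = l^s(e^{-m}) e^{-m/p0} phi_m; for theta < 1 the same
   holds for rho D.  These Hardy inequalities follow from the triangle
   inequality, the Fatou property and the boundedness of shifts. *)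

Require Import Defs.
From HB Require Import structures.
From mathcomp Require Import all_boot all_order all_algebra.
From mathcomp Require Import all_classical all_reals all_analysis.
From mathcomp Require Import measurable_realfun ess_sup_inf.
From mathcomp Require Import ring lra.
Set Implicit Arguments.
Unset Strict Implicit.
Unset Printing Implicit Defensive.
Import Order.TTheory GRing.Theory Num.Theory.
Import numFieldNormedType.Exports.
Local Open Scope classical_set_scope.
Local Open Scope ring_scope.

(** * Rearrangements *)

(** The rearrangement f^* is monotone but may jump by any factor between neighbouring cells, so a
    norm and its discrete form cannot be compared cell by cell. Each comparison tolerates a bounded
    shift of the index towards 0, where f^* is larger, and rearrangement invariance removes the
    shift afterwards. The same device pays for (f0 + f1)^*(2t) <= f0^*(t) + f1^*(t), which costs one
    cell. Constants may depend neither on f nor on its decompositions. Hence the estimates concern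
    families of sequences over an index type, later taken to be the measurable functions f, the
    pairs (f, m), or the triples (f, f0, f1) with f = f0 + f1. Both J and rho D dominate omega. So
    at an endpoint the terms still covered by a Hardy inequality are absorbed by those that remain:
    rho D by J when theta = 0, I and J by rho D when theta = 1. *)

Section rearrangement_theory.
Context {R : realType}.
Local Open Scope ereal_scope.
Local Notation lam := (@lebesgue_measure R).

Lemma rearr_ge0 X (m : set X -> \bar R) g t : 0 <= rearr m g t.
Proof. by apply/ereal_infP => _ [l [l0 _] <-]; rewrite lee_fin. Qed.

Lemma le_rearr X Y (m : set X -> \bar R) (m' : set Y -> \bar R) g h (s t : R) :
  (forall l : R, (0 <= l)%R -> m' [set y | l%:E < `|h y|] <= t%:E ->
     m [set x | l%:E < `|g x|] <= s%:E) ->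
  rearr m g s <= rearr m' h t.
Proof.
move=> H; apply: ereal_inf_le_tmp => _ [l [l0 ml] <-]; exists l => //.
by split => //; exact: H.
Qed.

Lemma rearr_nonincr X (m : set X -> \bar R) g (s t : R) :
  (s <= t)%R -> rearr m g t <= rearr m g s.
Proof.
by move=> st; apply: le_rearr => l l0 /le_trans; apply; rewrite lee_fin.
Qed.

Lemma measurable_pos_half : measurable (pos_half : set R).
Proof. exact: measurable_itv. Qed.
Hint Resolve measurable_pos_half : core.

Lemma mplus_rearr X (m : set X -> \bar R) g : mplus (rearr m g).
Proof.
split; last by move=> x _; exact: rearr_ge0.
apply: (measurability _ (ErealGenOInfty.measurableE R)) => // _ [_ [r ->] <-].
apply: is_interval_measurable => x y /= [].
rewrite /pos_half /= !in_itv/= !andbT => x0 hx [y0 hy] z /andP[xz zy].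
split; first by rewrite in_itv/= andbT (lt_le_trans x0).
rewrite in_itv/= andbT.
by apply: lt_le_trans hy _; exact: rearr_nonincr.
Qed.

Lemma measurable_gt_abse d (X : measurableType d) (h : X -> \bar R) (l : \bar R) :
  measurable_fun [set: X] h -> measurable [set y | l < `|h y|].
Proof.
move=> mh; rewrite -[X in measurable X]setTI.
by apply: emeasurable_fun_o_infty => //; exact: measurableT_comp.
Qed.

(** The sets where |h| exceeds l + 1/(n+1) increase to the set where |h| exceeds l, so the
    distribution function is right-continuous. The infimum defining [rearr] is therefore attained,
    which makes this an exact equivalence. *)
Lemma rearr_gtP d (X : measurableType d) (m : {measure set X -> \bar R})
    (h : X -> \bar R) (l x : R) : measurable_fun [set: X] h -> (0 <= l)%R ->
  (l%:E < rearr m h x) = (x%:E < m [set y | l%:E < `|h y|]).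
Proof.
move=> mh l0; apply/idP/idP; rewrite ltNge => /negP lx; rewrite ltNge;
  apply/negP => xl; apply: lx.
  by apply: ereal_inf_lbound; exists l.
pose F n := [set y | (l + n.+1%:R^-1)%:E < `|h y|].
have FE : [set y | l%:E < `|h y|] = \bigcup_n F n.
  apply/seteqP; split => [y /= ly|y [n _]]; last first.
    by apply: le_lt_trans; rewrite lee_fin lerDl invr_ge0.
  suff [n ln] : exists n, (l + n.+1%:R^-1)%:E < `|h y| by exists n.
  case: (`|h y|) (abse_ge0 (h y)) ly => [r| |]// _; last first.
    by exists 0%N; rewrite ltry.
  rewrite lte_fin -subr_gt0 => lr.
  have [n _ /(_ n (leqnn n)) /= nr] := near_infty_natSinv_lt (PosNum lr).
  by exists n; rewrite lte_fin -ltrBrDl.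
have mF n : measurable (F n) by exact: measurable_gt_abse.
have mU : measurable (\bigcup_n F n) by exact: bigcup_measurable.
have hF : {homo F : n k / (n <= k)%N >-> (n <= k)%O}.
  move=> n k nk; apply/subsetPset => y; apply: le_lt_trans.
  by rewrite lee_fin lerD2l lef_pV2 ?posrE// ler_nat.
have cF := nondecreasing_cvg_mu (mu := m) mF mU hF.
rewrite FE -(cvg_lim _ cF)//; apply: lime_le; first by apply/cvg_ex; eexists; exact: cF.
apply: nearW => n /=.
have /ereal_inf_ltP [_ [l' [l'0 xl'] <-] l'l] :
    rearr m h x < (l + n.+1%:R^-1)%:E.
  by apply: le_lt_trans xl _; rewrite lte_fin ltrDl invr_gt0.
apply: le_trans xl'; apply: le_measure.
- by apply: mem_set; exact: mF.
- by apply: mem_set; exact: measurable_gt_abse.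
- by move=> y; apply: lt_trans.
Qed.

Lemma lebesgue_lt_pos (v : \bar R) : 0 <= v ->
  lam (pos_half `&` [set x : R | x%:E < v]) = v.
Proof.
case: v => [r| |]// r0.
  rewrite (_ : _ `&` _ = `]0%R, r[%classic); last first.
    by apply/seteqP; split => x /=; rewrite /pos_half /= !in_itv/= lte_fin;
      [move=> [/andP[-> _] ->]|move=> /andP[-> ->]].
  rewrite lebesgue_measure_itv/= lte_fin; case: ltP => [|r0']; first by rewrite oppr0 adde0.
  by apply/eqP; rewrite eq_le r0 lee_fin r0'.
rewrite (_ : _ `&` _ = pos_half); last first.
  by apply/seteqP; split => x /= => [[]|]// ?; split => //; rewrite ltry.
by rewrite lebesgue_measure_itv/= ltry.
Qed.

(** By [rearr_gtP] the part of a superlevel set of the rearrangement in (0, +oo) is an interval (0,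
    v), where v is the measure of the superlevel set of [h]. *)
Lemma equimeasurable_rearr (h : R -> \bar R) : mplus h ->
  equimeasurable (rearr lam (h \_ pos_half)) h.
Proof.
move=> [mh h0] l l0.
have mh' : measurable_fun [set: R] (h \_ pos_half) by apply/(measurable_restrictT _ measurable_pos_half).
have -> : [set x | l%:E < rearr lam (h \_ pos_half) x] =
    [set x | x%:E < lam [set y | l%:E < `|(h \_ pos_half) y|]].
  by apply/funext => x; apply/propext => /=; rewrite (@rearr_gtP _ _ lam _ _ _ mh' l0).
rewrite lebesgue_lt_pos//; congr (lam _); apply/seteqP; split => x /=.
  rewrite patchE; case: ifPn => [/set_mem xp|]; last by rewrite abse0 ltNge lee_fin l0.
  by rewrite gee0_abs ?h0//; move: xp; rewrite /pos_half/= in_itv/= andbT.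
move=> [xp]; rewrite patchE mem_set// gee0_abs// h0//.
by move: xp; rewrite /pos_half/= in_itv/= andbT.
Qed.

(** Tonelli on the region under the graph. It expresses the integral through superlevel sets only,
    whence the rearrangement invariance of the Lebesgue norms. *)
Lemma integral_layer_cake (f : R -> \bar R) : measurable_fun [set: R] f ->
  (forall x, 0 <= f x) ->
  \int[lam]_x f x = \int[lam]_(l in pos_half) lam [set x | l%:E < f x].
Proof.
move=> mf f0.
pose A := [set z : R * R | pos_half z.2 /\ z.2%:E < f z.1].
have mA : measurable A.
  have mf1 : measurable_fun [set: R * R] (fun z : R * R => f z.1).
    exact: measurableT_comp.
  have mf2 : measurable_fun [set: R * R] (fun z : R * R => z.2%:E).
    exact: measurableT_comp.
  have -> : A = snd @^-1` pos_half `&` [set z : R * R | z.2%:E < f z.1] by [].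
  apply: measurableI.
    by rewrite -[X in measurable X]setTI; exact: measurable_snd.
  by rewrite -[X in measurable X]setTI; exact: measurable_lte.
have xE x : xsection A x = pos_half `&` [set l | l%:E < f x].
  by apply/seteqP; split => l; [move=> /set_mem|move=> /mem_set].
have yE l : ysection A l = [set x | A (x, l)].
  by apply/seteqP; split => x; [move=> /set_mem|move=> /mem_set].
transitivity (\int[lam]_x (lam \o xsection A) x).
  by apply: eq_integral => x _ /=; rewrite xE lebesgue_lt_pos.
have := indic_fubini_tonelli lam lam mA.
rewrite indic_fubini_tonelli_FE// indic_fubini_tonelli_GE// => ->.
rewrite [RHS]integral_mkcond; apply: eq_integral => l _.
rewrite patchE [LHS]/= yE; case: ifPn => [/set_mem lp|/negP lp].
  by congr (lam _); apply/seteqP; split => y // [].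
have -> : [set x | A (x, l)] = set0; last exact: measure0.
by apply/seteqP; split => y // -[/mem_set].
Qed.

End rearrangement_theory.

(** * Counting measure on cells: Lebesgue measure of unit cells, dt/t-measure of exponential
    cells *)

Section levels.
Context {R : realType}.
Local Open Scope ereal_scope.
Local Notation lam := (@lebesgue_measure R).

Definition card_of (J : set nat) : \bar R := \esum_(k in J) 1%E.

Lemma card_ofE J : card_of J = \sum_(k <oo | k \in J) 1%E.
Proof. by rewrite nneseries_esum// set_mem_set. Qed.

Definition step (c : nat -> \bar R) (x : R) : \bar R := c (Num.truncn x).

Lemma measurable_step c (D : set R) : measurable D -> measurable_fun D (step c).
Proof.
move=> mD _ Y mY; apply: measurableI => //.
have -> : step c @^-1` Y = \bigcup_(k in c @^-1` Y) [set x : R | Num.truncn x = k].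
  apply/seteqP; split => [x /= Yx|x [k /= Yk xk]]; first by exists (Num.truncn x).
  by rewrite /step xk.
apply: bigcup_measurable => k _; apply: is_interval_measurable => x y /= xk yk z /andP[xz zy].
by apply/eqP; rewrite eqn_leq -{1}yk -{1}xk !le_truncn.
Qed.

(** The condition 0 < x cuts off the point 0 and the negative reals, all truncated to 0; the cells
    then partition [pos_half]. *)
Definition unit_cell (k : nat) : set R := [set x : R | (0 < x)%R /\ Num.truncn x = k].

Lemma lebesgue_unit_cells (J : set nat) :
  lam (\bigcup_(k in J) unit_cell k) = card_of J.
Proof.
have cellE k : unit_cell k = `[k%:R, k.+1%:R[%classic `&` pos_half.
  apply/seteqP; split => [x [x0 <-]|x []] /=; rewrite /pos_half/= !in_itv/= andbT.
    by split => //; rewrite truncn_itv// ltW.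
  by move=> /truncn_def kx x0.
have cell1 k : lam (unit_cell k) = 1.
  rewrite cellE; case: k => [|k].
    rewrite (_ : _ `&` _ = `]0%R, 1%R[%classic).
      by rewrite lebesgue_measure_itv/= lte_fin ltr01 oppr0 adde0.
    apply/seteqP; split => x /=; rewrite /pos_half/= !in_itv/= andbT.
      by move=> [/andP[_ ->] ->].
    by move=> /andP[x0 ->]; rewrite (ltW x0).
  rewrite (_ : _ `&` _ = `[k.+1%:R, k.+2%:R[%classic).
    rewrite lebesgue_measure_itv/= lte_fin ltr_nat ltnSn -EFinB -natrB//.
    by rewrite subSn// subnn.
  apply/seteqP; split => x /=; rewrite /pos_half/= !in_itv/= andbT; first by case.
  by move=> /andP[kx ->]; rewrite kx; split => //; apply: lt_le_trans kx; rewrite ltr0n.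
rewrite measure_bigcup.
- by rewrite card_ofE; apply: eq_eseriesr => k _; exact: cell1.
- by move=> k _; rewrite cellE; apply: measurableI; exact: measurable_itv.
- by apply/trivIsetP => i j _ _ /eqP ij; rewrite -subset0 => x [[_ xi] [_ xj]]; apply: ij; rewrite -xi.
Qed.

Definition exp_cell (k : nat) : set R := `[expR (- k.+1%:R), expR (- k%:R)[.

Lemma exp_cell_cover (t : R) : (0 < t < 1)%R -> exists k, exp_cell k t.
Proof.
move=> /andP[t0 t1].
have l0 : (0 <= - ln t)%R by rewrite oppr_ge0 ltW// ln_lt0// t0.
have tE : t = expR (- (- ln t)) by rewrite opprK lnK.
(* Cells are closed on the left in t, so a point with -ln t = k + 1 lies in cell k, one less than
   truncation gives. *)
have [/eqP tk|tk] := boolP (- ln t == (Num.truncn (- ln t))%:R)%R.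
  case E : (Num.truncn (- ln t)) => [|k]; rewrite E in tk.
    by move: t1; rewrite tE tk oppr0 expR0 ltxx.
  exists k; rewrite /exp_cell/= in_itv/= tE tk lexx/= ltr_expR ltrN2 ltr_nat//.
exists (Num.truncn (- ln t)); rewrite /exp_cell/= in_itv/=.
have /andP[h1 h2] := truncn_itv l0.
by rewrite {2 3}tE ler_expR lerN2 (ltW h2) ltr_expR ltrN2 lt_neqAle eq_sym tk.
Qed.

Lemma exp_cell_inj j k (t : R) : exp_cell j t -> exp_cell k t -> j = k.
Proof.
rewrite /exp_cell/= !in_itv/=.
wlog jk : j k / (j <= k)%N.
  by move=> H; case/orP: (leq_total j k) => /H // + a b => /(_ b a).
move=> /andP[a b] /andP[c d]; apply/eqP; rewrite eqn_leq jk/= leqNgt; apply/negP => kj.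
have := le_lt_trans a d; rewrite ltr_expR ltrN2 ltr_nat ltnS leqNgt => /negP; exact.
Qed.

Lemma exp_cell_pos k (t : R) : exp_cell k t -> (0 < t < 1)%R.
Proof.
rewrite /exp_cell/= in_itv/= => /andP[a b]; rewrite (lt_le_trans _ a) ?expR_gt0//=.
by apply: lt_le_trans b _; rewrite -expR0 ler_expR oppr_le0.
Qed.

Lemma measurable_invr_pos (D : set R) : D `<=` pos_half ->
  measurable D -> measurable_fun D (fun t : R => (t^-1)%:E).
Proof.
move=> Dpos mD; apply/measurable_EFinP.
apply: (eq_measurable_fun (fun t : R => (t `^ (-1))%R)) => [t /[!inE] /Dpos|].
  rewrite /pos_half/= in_itv/= andbT => /ltW t0.
  by rewrite powR_inv1.
by apply: measurable_funTS; exact: measurable_powR.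
Qed.

Lemma exp_cell_pos_half k : exp_cell k `<=` pos_half.
Proof.
by move=> t /exp_cell_pos /andP[t0 _]; rewrite /pos_half/= in_itv/= andbT.
Qed.

Lemma integral_exp_cell k :
  \int[lam]_(t in exp_cell k) (t^-1)%:E = 1 :> \bar R.
Proof.
pose a : R := expR (- k.+1%:R); pose b : R := expR (- k%:R).
have ab : (a < b)%R by rewrite ltr_expR ltrN2 ltr_nat.
have a0 : (0 < a)%R by exact: expR_gt0.
rewrite /exp_cell -/a -/b integral_itv_bndo_bndc; last first.
  by apply: measurable_invr_pos; [exact: exp_cell_pos_half|exact: measurable_itv].
rewrite (@continuous_FTC2 _ _ (@ln R))//.
- by rewrite /a /b !expRK -EFinB; congr EFin; rewrite -natr1; ring.
- apply: continuous_in_subspaceT => x; rewrite inE/= in_itv/= => /andP[ax _].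
  by apply: continuousV => //; rewrite gt_eqF// (lt_le_trans a0).
- split.
  + move=> x /=; rewrite in_itv/= => /andP[ax _].
    by have [] := is_derive1_ln (lt_trans a0 ax).
  + by apply: cvg_at_right_filter; apply: continuous_ln.
  + by apply: cvg_at_left_filter; apply: continuous_ln; exact: lt_trans ab.
- move=> x; rewrite in_itv/= => /andP[ax _].
  by rewrite derive1E; have [_ ->] := is_derive1_ln (lt_trans a0 ax).
Qed.

(** It is applied to superlevel sets of functions not known to be measurable, so it is read off the
    integral as a supremum over simple functions below the restriction. *)
Lemma le_dtt (A B : set R) : A `<=` B -> dtt A <= dtt B.
Proof.
move=> AB; have p0 (C : set R) x : (C `&` pos_half) x -> 0 <= (x^-1)%:E.
  by move=> [_]; rewrite /pos_half/= in_itv/= andbT lee_fin invr_ge0 => /ltW.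
rewrite /dtt !ge0_integralE//; [|exact: p0..].
apply: le_ereal_sup => _ [h /= hA <-]; exists h => //= x; apply: le_trans (hA x) _.
rewrite !patchE; case: ifPn => [/set_mem[Ax px]|_].
  by rewrite mem_set//; split => //; exact: AB.
by case: ifPn => // /set_mem /p0.
Qed.

Lemma dtt_exp_cells (J : set nat) :
  dtt (\bigcup_(k in J) exp_cell k) = card_of J.
Proof.
rewrite card_ofE /dtt setIidl; last first.
  by move=> t [k _]; exact: exp_cell_pos_half.
rewrite bigcup_mkcond ge0_integral_bigcup.
- rewrite [RHS]eseries_mkcond; apply: eq_eseriesr => k _.
  case: ifPn => _; first exact: integral_exp_cell.
  exact: integral_set0.
- by move=> k; case: ifPn => _ //; exact: measurable_itv.
- apply: measurable_invr_pos.
    by move=> t [k _]; case: ifPn => // _; exact: exp_cell_pos_half.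
  by apply: bigcup_measurable => k _; case: ifPn => _ //; exact: measurable_itv.
- move=> t [k _]; case: ifPn => // _ /exp_cell_pos /andP[t0 _].
  by rewrite lee_fin invr_ge0 ltW.
- apply/trivIsetP => i j _ _ /eqP ij; rewrite -subset0 => x [].
  case: ifPn => // _; case: ifPn => // _ xi xj; apply: ij.
  exact: exp_cell_inj xi xj.
Qed.

End levels.

(** * Rearrangement invariant norms of sequences *)

Section rearrangement_norms.
Context {R : realType}.
Local Open Scope ereal_scope.
Local Notation lam := (@lebesgue_measure R).
Implicit Types (F : (R -> \bar R) -> \bar R) (c : nat -> \bar R).

(* What [ri_norm] and [Leb q] have in common; [rn_unit] gives the indicator
   function of (0, 1) a positive finite norm. *)
Record rearr_norm F : Prop := RearrNorm {
  rn_mono : forall f g, mplus f -> mplus g ->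
    (forall x : R, (0 < x)%R -> f x <= g x) -> F f <= F g;
  rn_scale : forall (a : R) f, (0 <= a)%R -> mplus f ->
    F (fun x => a%:E * f x) = a%:E * F f;
  rn_triangle : forall f g, mplus f -> mplus g ->
    F (fun x => f x + g x) <= F f + F g;
  rn_invariant : forall f g, mplus f -> mplus g ->
    equimeasurable f g -> F f = F g;
  rn_unit : exists2 kappa : R, (0 < kappa)%R &
    F (step (fun k => (k == 0)%N%:R%:E)) = kappa%:E }.

(** The norm that [F] induces on sequences: [c] is spread over cells of Lebesgue measure 1, which is
    also the dt/t-measure of an exponential cell. *)
Definition disc F c : \bar R := F (step c).

Lemma mplus_step c : (forall k, 0 <= c k) -> mplus (step c).
Proof.
move=> c0; split; last by move=> x _; exact: c0.
by apply: measurable_step; exact: measurable_pos_half.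
Qed.

Lemma step_level c (l : \bar R) : pos_half `&` [set x | l < step c x] =
  \bigcup_(k in [set k | l < c k]) unit_cell k.
Proof.
apply/seteqP; split => [x [] | x [k /= lk [x0 xk]]].
  by rewrite /pos_half/= in_itv/= andbT => x0 lx; exists (Num.truncn x).
by rewrite /pos_half/= in_itv/= andbT /step xk.
Qed.

Lemma lebesgue_step_level c (l : \bar R) :
  lam (pos_half `&` [set x | l < step c x]) = card_of [set k | l < c k].
Proof. by rewrite step_level lebesgue_unit_cells. Qed.

Section disc.
Variable F : (R -> \bar R) -> \bar R.
Hypothesis hF : rearr_norm F.

Lemma disc_mono c d : (forall k, 0 <= c k) -> (forall k, c k <= d k) ->
  disc F c <= disc F d.
Proof.
move=> c0 cd; apply: rn_mono => //; try apply: mplus_step => //.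
by move=> k; apply: le_trans (c0 k) (cd k).
by move=> x _; exact: cd.
Qed.

Lemma disc_scale (a : R) c : (0 <= a)%R -> (forall k, 0 <= c k) ->
  disc F (fun k => a%:E * c k) = a%:E * disc F c.
Proof. by move=> a0 c0; rewrite -(rn_scale hF)//; exact: mplus_step. Qed.

Lemma disc_triangle c d : (forall k, 0 <= c k) -> (forall k, 0 <= d k) ->
  disc F (fun k => c k + d k) <= disc F c + disc F d.
Proof. by move=> c0 d0; apply: rn_triangle => //; exact: mplus_step. Qed.

Lemma disc0 : disc F (fun=> 0) = 0.
Proof.
by have := @disc_scale 0%R (fun=> 0) (lexx _) (fun=> lexx _); rewrite !mul0e.
Qed.

Lemma rn_ge0 f : mplus f -> 0 <= F f.
Proof.
move=> hf; rewrite -disc0 /disc; apply: rn_mono => //; first exact: mplus_step.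
by move=> x x0; case: hf => _; exact.
Qed.

Lemma tnorm_ge0 (I : set R) g : 0 <= tnorm F I g.
Proof. by apply: rn_ge0; exact: mplus_rearr. Qed.

Lemma disc_ge0 c : (forall k, 0 <= c k) -> 0 <= disc F c.
Proof. by move=> c0; rewrite -disc0; exact: disc_mono. Qed.

(** An injection preserves the cardinality of level sets, so the left side is equimeasurable with
    the restriction of [c] to the image of [S]. *)
Lemma disc_reparam (S : set nat) (s : nat -> nat) c : set_inj S s ->
  (forall k, 0 <= c k) ->
  disc F (fun k => if k \in S then c (s k) else 0) <= disc F c.
Proof.
move=> sinj c0.
have le1 k : (if k \in s @` S then c k else 0) <= c k by case: ifPn.
have ge1 k : 0 <= (if k \in s @` S then c k else 0) by case: ifPn.
apply: le_trans (disc_mono ge1 le1); rewrite le_eqVlt; apply/orP; left; apply/eqP.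
apply: rn_invariant => //.
- by apply: mplus_step => k; case: ifPn.
- exact: mplus_step.
move=> l l0; rewrite !lebesgue_step_level.
have lE (P : bool) x : (l%:E < (if P then x else 0)) = P && (l%:E < x).
  by case: P => //=; rewrite lte_fin ltNge l0.
have -> : [set k | l%:E < (if k \in S then c (s k) else 0)] =
    S `&` [set k | l%:E < c (s k)].
  apply/seteqP; split => k /=; rewrite lE; first by move=> /andP[/set_mem].
  by move=> [/mem_set ->].
have -> : [set k | l%:E < (if k \in s @` S then c k else 0)] =
    s @` (S `&` [set k | l%:E < c (s k)]).
  apply/seteqP; split => [k /=|k [j [Sj lj] <-] /=].
    by rewrite lE => /andP[/set_mem [j Sj <-] lj]; exists j.
  by rewrite lE lj andbT; apply/mem_set; exists j.
rewrite /card_of esum_image//.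
by apply: sub_in2 sinj => k /set_mem [/mem_set].
Qed.

Lemma disc_shiftl n c : (forall k, 0 <= c k) ->
  disc F (fun k => c (k + n)%N) <= disc F c.
Proof.
move=> c0; have := @disc_reparam setT (addn^~ n) c.
rewrite (_ : (fun k => if _ then _ else _) = (fun k => c (k + n)%N)); last first.
  by apply/funext => k; rewrite in_setT.
by apply => // i j _ _ /addIn.
Qed.

Lemma disc_shiftr n c : (forall k, 0 <= c k) ->
  disc F (fun k => if (n <= k)%N then c (k - n)%N else 0) <= disc F c.
Proof.
move=> c0; have := @disc_reparam [set k | n <= k]%N (subn^~ n) c.
rewrite (_ : (fun k => if _ then _ else _) =
  (fun k => if (n <= k)%N then c (k - n)%N else 0)); last first.
  apply/funext => k; case: ifPn => [/set_mem/= ->//|/negP nk].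
  by case: ifPn => // /mem_set.
apply => // i j /set_mem/= ni /set_mem/= nj ij.
by rewrite -(subnK ni) ij subnK.
Qed.

(* A map whose fibres have diameter less than N is injective on each residue
   class modulo N. *)
Lemma disc_comp (N : nat) (s : nat -> nat) c :
  (forall i j, s i = s j -> (i < j + N)%N) -> (forall k, 0 <= c k) ->
  disc F (c \o s) <= N%:R%:E * disc F c.
Proof.
move=> sN c0.
have N0 : (0 < N)%N by have := sN 0%N 0%N erefl.
pose cr M k := if (k %% N < M)%N then c (s k) else 0.
have cr0 M k : 0 <= cr M k by rewrite /cr; case: ifPn.
suff H M : (M <= N)%N -> disc F (cr M) <= M%:R%:E * disc F c.
  apply: le_trans (H _ (leqnn _)); apply: disc_mono => k; first exact: c0.
  by rewrite /cr ltn_pmod.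
elim: M => [_|M IH MN].
  by rewrite mul0e -{1}disc0; apply: disc_mono => // k; rewrite /cr ltn0.
apply: (@le_trans _ _ (disc F (cr M) + disc F
    (fun k => if k \in [set k | k %% N = M]%N then c (s k) else 0))).
  apply: le_trans (disc_triangle _ _) => //; last by move=> k; case: ifPn.
  apply: disc_mono => // k; rewrite /cr ltnS leq_eqVlt.
  case: (eqVneq (k %% N)%N M) => [kM|kM] /=.
    by rewrite kM ltnn mem_set// add0e.
  by case: ifPn => _; rewrite leeDl//; case: ifPn.
rewrite -natr1 EFinD ge0_muleDl ?lee_fin// mul1e.
apply: leeD; first by apply: IH; exact: ltnW.
apply: disc_reparam => // i j /set_mem/= iM /set_mem/= jM sij.
have h1 := sN _ _ sij; have h2 := sN _ _ (esym sij).
suff E : (i %/ N = j %/ N)%N by rewrite (divn_eq i N) iM E -jM -divn_eq.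
have le_div x y : (x %% N = M)%N -> (y %% N = M)%N -> (x < y + N)%N ->
    (x %/ N <= y %/ N)%N.
  move=> xM yM; rewrite [X in (X < _)%N](divn_eq x N) [X in (_ < X + _)%N](divn_eq y N).
  by rewrite xM yM addnAC ltn_add2r -mulSnr ltn_mul2r N0/= ltnS.
by apply/eqP; rewrite eqn_leq !le_div.
Qed.

(** Shifts to the left and to the right carry any unit sequence to the one at 0 and back, so all
    have the same norm. *)
Lemma disc_delta : exists2 kappa : R, (0 < kappa)%R &
  forall j, disc F (fun k => (k == j)%:R%:E) = kappa%:E.
Proof.
have [kappa k0 hk] := rn_unit hF; exists kappa => // j; rewrite -hk.
apply/eqP; rewrite eq_le; apply/andP; split.
  have := @disc_shiftr j (fun k => (k == 0)%N%:R%:E) (fun k => _).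
  move=> /(_ (fun k => ltac:(by rewrite lee_fin))).
  apply: le_trans; apply: disc_mono => k; first by rewrite lee_fin.
  case: ifPn => [jk|]; first by rewrite subn_eq0 lee_fin ler_nat eqn_leq jk andbT.
  by rewrite -ltnNge => kj; rewrite ltn_eqF.
have := @disc_shiftl j (fun k => (k == j)%N%:R%:E).
move=> /(_ (fun k => ltac:(by rewrite lee_fin))).
apply: le_trans; apply: disc_mono => k; first by rewrite lee_fin.
by rewrite -{2}(add0n j) eqn_add2r.
Qed.

Lemma le_disc_delta (kappa : R) c j : (0 < kappa)%R -> (forall k, 0 <= c k) ->
  (forall j, disc F (fun k => (k == j)%:R%:E) = kappa%:E) ->
  kappa%:E * c j <= disc F c.
Proof.
move=> k0 c0 hk.
have le_r (r : R) : (0 <= r)%R -> r%:E <= c j -> kappa%:E * r%:E <= disc F c.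
  move=> r0 rc; rewrite muleC -(hk j) -disc_scale//.
  apply: disc_mono => k; first by rewrite mule_ge0// lee_fin.
  by case: eqVneq => [->|_]; rewrite ?mule1// mule0.
move: (c0 j) (le_r); case: (c j) => [r| |]//; first by rewrite lee_fin => r0 /(_ r r0 (lexx _)).
move=> _ H; rewrite gt0_muley ?lte_fin// leye_eq; apply/eqP/eqyP => A A0.
have := H (A / kappa)%R (divr_ge0 (ltW A0) (ltW k0)) (leey _).
by rewrite -EFinM mulrC divfK// gt_eqF.
Qed.

(** A superlevel set of [g] on [I] is covered by the cells where [c] exceeds the same level, and
    their dt/t-measure is the Lebesgue measure of the superlevel set of [step c]. Thus the
    rearrangement of [g] lies below that of [step c], which has the norm of [step c]. *)
Lemma tnorm_le_disc (I : set R) (g : R -> \bar R) c : I `<=` `]0%R, 1%R[ ->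
  (forall k, 0 <= c k) ->
  (forall k t, exp_cell k t -> I t -> `|g t| <= c k) ->
  tnorm F I g <= disc F c.
Proof.
move=> I01 c0 gc; have mc := mplus_step c0.
rewrite /disc -(rn_invariant hF (mplus_rearr _ _) mc (equimeasurable_rearr mc)).
apply: rn_mono => // [||x x0]; try exact: mplus_rearr.
apply: le_rearr => l l0; apply: le_trans.
have -> : [set y | l%:E < `|(step c \_ pos_half) y|] = pos_half `&` [set x | l%:E < step c x].
  apply/seteqP; split => y /=; rewrite patchE.
    case: ifPn => [/set_mem yp|]; last by rewrite abse0 lte_fin ltNge l0.
    by rewrite gee0_abs// /step.
  by move=> [/mem_set -> ly]; rewrite gee0_abs// /step.
rewrite lebesgue_step_level -dtt_exp_cells; apply: le_dtt => t /=.
rewrite patchE; case: ifPn => [/set_mem It|]; last by rewrite abse0 lte_fin ltNge l0.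
move=> lt; have := I01 _ It; rewrite /= in_itv/= => /exp_cell_cover [k kt].
by exists k => //=; apply: lt_le_trans lt _; exact: gc.
Qed.

(** The reverse inclusion of level sets. The comparison is restricted to cells with c k > 0, so that
    [c] can be cut off outside the cells contained in [I]. *)
Lemma disc_le_tnorm (I : set R) (g : R -> \bar R) c :
  (forall k, 0 <= c k) ->
  (forall k t, exp_cell k t -> 0 < c k -> I t /\ c k <= `|g t|) ->
  disc F c <= tnorm F I g.
Proof.
move=> c0 gc; have mc := mplus_step c0.
rewrite /disc -(rn_invariant hF (mplus_rearr _ _) mc (equimeasurable_rearr mc)).
apply: rn_mono => // [||x x0]; try exact: mplus_rearr.
apply: le_rearr => l l0; apply: le_trans.
have -> : [set y | l%:E < `|(step c \_ pos_half) y|] = pos_half `&` [set x | l%:E < step c x].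
  apply/seteqP; split => y /=; rewrite patchE.
    case: ifPn => [/set_mem yp|]; last by rewrite abse0 lte_fin ltNge l0.
    by rewrite gee0_abs// /step.
  by move=> [/mem_set -> ly]; rewrite gee0_abs// /step.
rewrite lebesgue_step_level -dtt_exp_cells; apply: le_dtt => t [k /= lk kt].
have [It ct] := gc k t kt (le_lt_trans (l0 : 0 <= l%:E) lk).
by rewrite patchE mem_set//; exact: lt_le_trans lk ct.
Qed.

End disc.

End rearrangement_norms.

(** * Lebesgue norms as rearrangement invariant norms *)

Section rearrangement_norm_instances.
Context {R : realType}.
Local Open Scope ereal_scope.
Local Notation lam := (@lebesgue_measure R).

Lemma le_poweR (r : R) (x y : \bar R) : (0 <= r)%R -> 0 <= x -> x <= y ->
  x `^ r <= y `^ r.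
Proof.
move=> r0 x0 xy; apply: gt0_ler_poweR => //; rewrite in_itv/= leey andbT//.
exact: le_trans xy.
Qed.

Lemma poweR_invK (p : R) (x : \bar R) : (0 < p)%R -> 0 <= x -> (x `^ p^-1) `^ p = x.
Proof. by move=> p0 x0; rewrite -poweRrM mulVf ?poweRe1// gt_eqF. Qed.

Lemma poweR_Kinv (p : R) (x : \bar R) : (0 < p)%R -> 0 <= x -> (x `^ p) `^ p^-1 = x.
Proof. by move=> p0 x0; rewrite -poweRrM mulfV ?poweRe1// gt_eqF. Qed.

Lemma lt_poweR (p : R) (l x : \bar R) : (0 < p)%R -> 0 <= l -> 0 <= x ->
  (l < x `^ p) = (l `^ p^-1 < x).
Proof.
move=> p0 l0 x0; apply/idP/idP; rewrite ltNge => /negP H; rewrite ltNge; apply/negP => xl;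
  apply: H.
  by rewrite -(poweR_invK p0 l0); apply: le_poweR => //; exact: ltW.
by rewrite -(poweR_Kinv p0 x0); apply: le_poweR => //; rewrite ?invr_ge0 ?poweR_ge0 ?ltW.
Qed.

Lemma mplus_restrict (f : R -> \bar R) : mplus f ->
  measurable_fun [set: R] (f \_ pos_half) /\ forall x, 0 <= (f \_ pos_half) x.
Proof.
move=> [mf f0]; split; first by apply/(measurable_restrictT _ measurable_pos_half).
move=> x; rewrite patchE; case: ifPn => // /set_mem.
by rewrite /pos_half/= in_itv/= andbT => /f0.
Qed.

Lemma integral_step (c : nat -> \bar R) : (forall k, 0 <= c k) ->
  \int[lam]_(x in pos_half) step c x = \sum_(k <oo) c k.
Proof.
move=> c0.
have mc k : measurable (@unit_cell R k).
  have -> : @unit_cell R k = pos_half `&` [set x | Num.truncn x = k].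
    apply/seteqP; split => x [];
      by rewrite /pos_half/= in_itv/= andbT.
  apply: measurableI; first exact: measurable_pos_half.
  apply: is_interval_measurable => x y /= xk yk z /andP[xz zy].
  by apply/eqP; rewrite eqn_leq -{1}yk -{1}xk !le_truncn.
have -> : pos_half = \bigcup_k (@unit_cell R k).
  apply/seteqP; split => x; rewrite /pos_half/= in_itv/= andbT.
    by move=> x0; exists (Num.truncn x).
  by move=> [k _ []].
rewrite ge0_integral_bigcup.
- apply: eq_eseriesr => k _.
  transitivity (\int[lam]_(x in unit_cell k) (cst (c k)) x).
    by apply: eq_integral => x /set_mem [_ xk]; rewrite /step xk.
  rewrite integral_cst/=; last exact: mc.
  have := @lebesgue_unit_cells R [set k].
  by rewrite bigcup_set1 => ->; rewrite /card_of esum_set1// mule1.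
- exact: mc.
- by apply: measurable_step; exact: bigcupT_measurable.
- by move=> x _; exact: c0.
- by apply/trivIsetP => i j _ _ /eqP ij; rewrite -subset0 => x [[_ xi] [_ xj]]; apply: ij; rewrite -xi.
Qed.

Lemma LebE (p : R) (f : R -> \bar R) : mplus f ->
  Leb p%:E f = (\int[lam]_x ((f \_ pos_half) x) `^ p) `^ p^-1.
Proof.
move=> /mplus_restrict[_ f0]; rewrite /Leb unlock; congr (_ `^ _).
by apply: eq_integral => x _; rewrite gee0_abs.
Qed.

Lemma disc_LebE (p : R) (c : nat -> \bar R) : (0 < p)%R -> (forall k, 0 <= c k) ->
  disc (Leb p%:E) c = (\sum_(k <oo) (c k) `^ p) `^ p^-1.
Proof.
move=> p0 c0; rewrite /disc LebE; last exact: mplus_step.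
rewrite -(integral_step (c := fun k => c k `^ p)); last by move=> k; exact: poweR_ge0.
rewrite [in RHS]integral_mkcond; congr (_ `^ _); apply: eq_integral => x _.
by rewrite !patchE; case: ifPn => // _; rewrite poweR0r// gt_eqF.
Qed.

Lemma disc_Leb1 (c : nat -> \bar R) : (forall k, 0 <= c k) ->
  disc (Leb 1%:E) c = \sum_(k <oo) c k.
Proof.
move=> c0; rewrite disc_LebE// invr1 poweRe1; last first.
  by apply: nneseries_ge0 => k _ _; exact: poweR_ge0.
by apply: eq_eseriesr => k _; rewrite poweRe1.
Qed.

(** With S the sum, c_k^p <= c_k S^(p-1). Thanks to this embedding of l^1 into l^p, the later
    estimates of tails and heads can be made on plain series. *)
Lemma disc_Leb_le_sum (p : R) (c : nat -> \bar R) : (1 <= p)%R -> (forall k, 0 <= c k) ->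
  disc (Leb p%:E) c <= \sum_(k <oo) c k.
Proof.
move=> p1 c0; have p0 := lt_le_trans ltr01 p1; rewrite disc_LebE//.
have S0 : 0 <= \sum_(k <oo) c k by apply: nneseries_ge0.
have cS k : c k <= \sum_(k <oo) c k.
  by rewrite (nneseriesD1 (n := k))// leeDl//; apply: nneseries_ge0.
rewrite -[leRHS](poweR_Kinv p0 S0); apply: le_poweR.
- by rewrite invr_ge0 ltW.
- by apply: nneseries_ge0 => k _ _; exact: poweR_ge0.
case SE : (\sum_(k <oo) c k) (S0) (cS) => [s| |]// s0 cs; last first.
  by rewrite poweRyr ?gt_eqF// leey.
rewrite poweR_EFin -(mulr_powRB1 s0 p0) mulrC EFinM -SE -nneseriesZl//.
apply: lee_nneseries => k _; first by rewrite poweR_ge0.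
move: (c0 k) (cs k); case: (c k) => // r r0 rs; rewrite lee_fin in r0; rewrite lee_fin in rs.
rewrite poweR_EFin -EFinM lee_fin -(mulr_powRB1 r0 p0) mulrC ler_wpM2r//.
by apply: ge0_ler_powR; rewrite ?nnegrE// subr_ge0.
Qed.

Lemma disc_Leby_le (c : nat -> \bar R) (M : \bar R) :
  (forall k, 0 <= c k <= M) -> disc (Leb +oo) c <= M.
Proof.
move=> cM; have M0 : 0 <= M by have /andP[a b] := cM 0%N; exact: le_trans b.
rewrite /disc /Leb unlock; case: ifPn => // _.
apply/ess_supP; apply: nearW => x /=; rewrite patchE; case: ifPn => _; last by rewrite abse0.
by rewrite /step; have /andP[a b] := cM (Num.truncn x); rewrite gee0_abs.
Qed.

Lemma le_Leb (q : \bar R) (f g : R -> \bar R) : 1 <= q -> mplus f -> mplus g ->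
  (forall x : R, (0 < x)%R -> f x <= g x) -> Leb q f <= Leb q g.
Proof.
move=> q1 hf hg fg.
have [mf f0] := mplus_restrict hf; have [mg g0] := mplus_restrict hg.
have fg' x : (f \_ pos_half) x <= (g \_ pos_half) x.
  rewrite !patchE; case: ifPn => // /set_mem.
  by rewrite /pos_half/= in_itv/= andbT => /fg.
case: q q1 => [p| |]//; last first.
  move=> _; rewrite /Leb unlock; case: ifPn => // _; apply: le_ess_sup.
  by apply: nearW => x /=; rewrite !gee0_abs.
rewrite lee_fin => p1; have p0 := lt_le_trans ltr01 p1.
rewrite !LebE//; apply: le_poweR; first by rewrite invr_ge0 ltW.
  by apply: integral_ge0 => x _; exact: poweR_ge0.
have mpow (h : R -> \bar R) : measurable_fun [set: R] h ->
    measurable_fun [set: R] (fun x => h x `^ p).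
  by move=> mh; exact: measurableT_comp (measurable_poweR p) mh.
apply: ge0_le_integral => //; try (by move=> x _; exact: poweR_ge0); try exact: mpow.
by move=> x _; apply: le_poweR => //; exact: ltW.
Qed.

Lemma Leb_scale (q : \bar R) (a : R) (f : R -> \bar R) : 1 <= q -> (0 <= a)%R ->
  mplus f -> Leb q (fun x => a%:E * f x) = a%:E * Leb q f.
Proof.
move=> q1 a0 hf; have [mf f0] := mplus_restrict hf.
have haf : mplus (fun x => a%:E * f x).
  case: hf => [mf' f0']; split; first exact: measurable_funeM.
  by move=> x x0; rewrite mule_ge0// f0'.
have rE x : ((fun x => a%:E * f x) \_ pos_half) x = a%:E * (f \_ pos_half) x.
  by rewrite !patchE; case: ifPn => // _; rewrite mule0.
case: q q1 => [p| |]//; last first.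
  move=> _; rewrite /Leb unlock; case: ifPn => [m0|_]; last by rewrite mule0.
  rewrite -ess_supZl//; congr ess_sup; apply/funext => x /=.
  by rewrite rE abseM gee0_abs.
rewrite lee_fin => p1; have p0 := lt_le_trans ltr01 p1.
rewrite !LebE//.
have -> : \int[lam]_x (((fun x => a%:E * f x) \_ pos_half) x) `^ p =
    (a%:E `^ p) * \int[lam]_x ((f \_ pos_half) x) `^ p.
  rewrite poweR_EFin -ge0_integralZl//; first last.
  - by rewrite lee_fin powR_ge0.
  - by move=> x _; exact: poweR_ge0.
  - exact: measurableT_comp (measurable_poweR p) mf.
  by apply: eq_integral => x _; rewrite rE poweRM.
rewrite poweRM ?poweR_ge0//; last by apply: integral_ge0 => x _; exact: poweR_ge0.
by rewrite poweR_Kinv.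
Qed.

Lemma lebesgue_aeS (P Q : R -> Prop) : (forall x, P x -> Q x) ->
  (\forall x \ae lam, P x) -> \forall x \ae lam, Q x.
Proof. by move=> PQ; apply: filterS PQ; exact: (ae_filter_ringOfSetsType lam). Qed.

Lemma ae_eq_Lnorm (p : R) (f g : R -> \bar R) :
  measurable_fun [set: R] f -> measurable_fun [set: R] g ->
  (forall x, 0 <= f x) -> (forall x, 0 <= g x) ->
  (\forall x \ae lam, f x = g x) -> Lnorm lam p%:E f = Lnorm lam p%:E g.
Proof.
move=> mf mg f0 g0 fg; rewrite unlock; congr (_ `^ _).
have mpow (h : R -> \bar R) : measurable_fun [set: R] h ->
    measurable_fun [set: R] (fun x => `|h x| `^ p).
  move=> mh; apply: (measurableT_comp (measurable_poweR p)).
  exact: measurableT_comp.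
apply: ge0_ae_eq_integral => //; try (by move=> x _; exact: poweR_ge0); try exact: mpow.
by apply: lebesgue_aeS fg => x /= fgx _; rewrite fgx.
Qed.

Lemma Lnorm_lty_ae (p : R) (f : R -> \bar R) : (0 < p)%R ->
  measurable_fun [set: R] f -> (forall x, 0 <= f x) -> Lnorm lam p%:E f < +oo ->
  \forall x \ae lam, f x = (fine (f x))%:E.
Proof.
move=> p0 mf f0; rewrite unlock => /lty_poweRy; rewrite invr_eq0 gt_eqF// => /(_ isT) If.
have : lam.-integrable setT (fun x => f x `^ p).
  apply/integrableP; split.
    exact: measurableT_comp (measurable_poweR p) mf.
  apply: le_lt_trans If; rewrite le_eqVlt; apply/orP; left; apply/eqP.
  by apply: eq_integral => x _; rewrite (gee0_abs (f0 x)) gee0_abs// poweR_ge0.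
move=> /(integrable_ae measurableT); apply: lebesgue_aeS => x /(_ I) fx.
rewrite fineK//; move: fx; rewrite !ge0_fin_numE// ?poweR_ge0//.
by apply: lty_poweRy; rewrite gt_eqF.
Qed.

(** If both norms are finite, the functions are finite almost everywhere and Minkowski's inequality
    applies to their real parts; otherwise the right side is infinite. For q = +oo it is
    subadditivity of the essential supremum. *)
Lemma Lnorm_triangle (q : \bar R) (f g : R -> \bar R) : 1 <= q ->
  measurable_fun [set: R] f -> measurable_fun [set: R] g ->
  (forall x, 0 <= f x) -> (forall x, 0 <= g x) ->
  Lnorm lam q (fun x => f x + g x) <= Lnorm lam q f + Lnorm lam q g.
Proof.
move=> q1 mf mg f0 g0; case: q q1 => [p| |]//; last first.
  move=> _; rewrite unlock; case: ifPn => [m0|]; last by rewrite adde0.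
  exact: ess_sup_absD.
rewrite lee_fin => p1; have p0 := lt_le_trans ltr01 p1.
have [ff|] := ltP (Lnorm lam p%:E f) +oo; last first.
  by rewrite leye_eq => /eqP ->; rewrite addye ?leey// gt_eqF// (lt_le_trans _ (Lnorm_ge0 _ _ _)).
have [gf|] := ltP (Lnorm lam p%:E g) +oo; last first.
  by rewrite leye_eq => /eqP ->; rewrite addey ?leey// gt_eqF// (lt_le_trans _ (Lnorm_ge0 _ _ _)).
have fE := Lnorm_lty_ae p0 mf f0 ff; have gE := Lnorm_lty_ae p0 mg g0 gf.
have mff : measurable_fun [set: R] (fine \o f) by exact: measurableT_comp mf.
have mgg : measurable_fun [set: R] (fine \o g) by exact: measurableT_comp mg.
have fge0 (h : R -> \bar R) x : (forall x, 0 <= h x) -> 0 <= (fine (h x))%:E.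
  by move=> h0; rewrite lee_fin fine_ge0.
have := @eminkowski _ _ _ lam (fine \o f) (fine \o g) p%:E mff mgg p1.
rewrite -(ae_eq_Lnorm p mf _ f0 _ fE); [|exact/measurable_EFinP|by move=> x; exact: fge0].
rewrite -(ae_eq_Lnorm p mg _ g0 _ gE); [|exact/measurable_EFinP|by move=> x; exact: fge0].
apply: le_trans; rewrite le_eqVlt; apply/orP; left; apply/eqP.
apply: ae_eq_Lnorm => //.
- exact: emeasurable_funD.
- by apply/measurable_EFinP; exact: measurable_funD.
- by move=> x; rewrite adde_ge0.
- by move=> x; rewrite /= EFinD adde_ge0// fge0.
- have fgE : \forall x \ae lam, f x = (fine (f x))%:E /\ g x = (fine (g x))%:E.
    by apply: filterI fE gE; exact: (ae_filter_ringOfSetsType lam).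
  by apply: lebesgue_aeS fgE => x [fx gx]; rewrite {1}fx {1}gx.
Qed.

Lemma Leb_triangle (q : \bar R) (f g : R -> \bar R) : 1 <= q -> mplus f ->
  mplus g -> Leb q (fun x => f x + g x) <= Leb q f + Leb q g.
Proof.
move=> q1 /mplus_restrict[mf f0] /mplus_restrict[mg g0].
apply: le_trans (Lnorm_triangle q1 mf mg f0 g0).
rewrite /Leb le_eqVlt; apply/orP; left; apply/eqP; congr (Lnorm _ _).
by apply/funext => x /=; rewrite !patchE; case: ifPn => // _; rewrite adde0.
Qed.

(** For finite q the layer cake formula sees only the measures of superlevel sets; for q = +oo the
    essential supremum is the infimum of the levels whose superlevel set is null. *)
Lemma Leb_invariant (q : \bar R) (f g : R -> \bar R) : 1 <= q -> mplus f ->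
  mplus g -> equimeasurable f g -> Leb q f = Leb q g.
Proof.
move=> q1 hf hg fg.
have levelE (h : R -> \bar R) (l : R) : (0 <= l)%R ->
    [set x | l%:E < (h \_ pos_half) x] = pos_half `&` [set x | l%:E < h x].
  move=> l0; apply/seteqP; split => x /=; rewrite patchE.
    by case: ifPn => [/set_mem|]; rewrite // lte_fin ltNge l0.
  by move=> [/mem_set ->].
have lamE (l : R) : (0 <= l)%R -> lam [set x | l%:E < (f \_ pos_half) x] =
    lam [set x | l%:E < (g \_ pos_half) x].
  by move=> l0; rewrite !levelE//; exact: fg.
have [mf f0] := mplus_restrict hf; have [mg g0] := mplus_restrict hg.
(* [equimeasurable] speaks of real levels l >= 0; below 0 the superlevel sets are everything, at +oo
   they are empty. *)
have lamyE (y : \bar R) : lam [set x | y < (f \_ pos_half) x] =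
    lam [set x | y < (g \_ pos_half) x].
  have setTE (h : R -> \bar R) : (forall x, 0 <= h x) -> y < 0 ->
      [set x | y < h x] = setT.
    by move=> h0 y0; apply/seteqP; split => x //= _; exact: lt_le_trans (h0 x).
  case: (ltP y 0) => [y0|]; first by rewrite !setTE.
  case: y {setTE} => [l l0| |]//; first by rewrite lamE.
  have yE (h : R -> \bar R) : [set x | +oo < h x] = set0.
    by apply/seteqP; split => x //=; rewrite ltNge leey.
  by rewrite !yE.
case: q q1 => [p| |]//; last first.
  move=> _; rewrite /Leb unlock; case: ifPn => // m0.
  have nE (h : R -> \bar R) : (forall x, 0 <= h x) -> abse \o h = h.
    by move=> h0; apply/funext => x /=; rewrite gee0_abs.
  rewrite !nE// !ess_supEmu0//; congr ereal_inf.
  have pE (h : R -> \bar R) y : h @^-1` `]y, +oo[ = [set x | y < h x].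
    by apply/seteqP; split => x; rewrite /= in_itv/= andbT.
  apply/seteqP; split => y /=; rewrite !pE lamyE//.
rewrite lee_fin => p1; have p0 := lt_le_trans ltr01 p1.
rewrite !LebE//; congr (_ `^ _).
have mpow (h : R -> \bar R) : measurable_fun [set: R] h ->
    measurable_fun [set: R] (fun x => h x `^ p).
  by move=> mh; exact: measurableT_comp (measurable_poweR p) mh.
rewrite !integral_layer_cake; try (by move=> x; exact: poweR_ge0); try exact: mpow.
apply: eq_integral => l; rewrite inE /pos_half/= in_itv/= andbT => l0.
have pE (h : R -> \bar R) : (forall x, 0 <= h x) ->
    [set x | l%:E < h x `^ p] = [set x | (l `^ p^-1)%:E < h x].
  move=> h0; apply/funext => x; apply/propext => /=.
  by rewrite lt_poweR// lee_fin ltW.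
by rewrite !pE// lamE// powR_ge0.
Qed.

End rearrangement_norm_instances.

Section rearrangement_norm_examples.
Context {R : realType}.
Local Open Scope ereal_scope.
Local Notation lam := (@lebesgue_measure R).

Lemma le_ess_sup_on (A : set R) (f : R -> \bar R) (y : \bar R) :
  measurable A -> 0 < lam A -> (forall x, A x -> y <= f x) -> y <= ess_sup lam f.
Proof.
move=> mA A0 yf; rewrite leNgt; apply/negP => fy.
have [N [mN N0 fN]] := ess_sup_ge lam f.
have AN : A `<=` N.
  by move=> x Ax; apply: fN => /= /(le_trans (yf x Ax)); rewrite leNgt fy.
by move: A0; rewrite (@subset_measure0 _ _ _ lam A N mA mN AN N0) ltxx.
Qed.

Lemma rearr_norm_Leb (q : \bar R) : 1 <= q -> rearr_norm (Leb q : (R -> \bar R) -> \bar R).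
Proof.
move=> q1; split.
- by move=> f g; exact: le_Leb.
- by move=> a f a0 hf; exact: Leb_scale.
- by move=> f g; exact: Leb_triangle.
- by move=> f g; exact: Leb_invariant.
- exists 1%R => //; rewrite -/(disc _ _).
  pose d (k : nat) : \bar R := (k == 0)%N%:R%:E.
  have d0 k : 0 <= d k by rewrite lee_fin.
  have dp (p : R) k : (0 < p)%R -> d k `^ p = d k.
    by rewrite /d => p0; case: eqVneq => _; rewrite poweR_EFin ?powR1 ?powR0 ?gt_eqF.
  case: q q1 => [p| |]//.
    rewrite lee_fin => p1; have p0 := lt_le_trans ltr01 p1.
    rewrite disc_LebE//; under eq_eseriesr do rewrite dp//.
    rewrite (nneseriesD1 (n := 0%N))// eseries0 ?adde0 ?poweR1r//.
    by move=> i _ /= /negPf i0; rewrite /d i0.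
  move=> _; apply/eqP; rewrite eq_le; apply/andP; split.
    by apply: disc_Leby_le => k; rewrite d0/= lee_fin; case: eqVneq.
  have mc : measurable (@unit_cell R 0%N).
    rewrite (_ : unit_cell 0 = pos_half `&` [set x | Num.truncn x = 0%N]); last first.
      by apply/seteqP; split => x []; rewrite /pos_half/= in_itv/= andbT.
    apply: measurableI; first exact: measurable_pos_half.
    apply: is_interval_measurable => x y /= xk yk z /andP[xz zy].
    by apply/eqP; rewrite -leqn0 -yk le_truncn.
  have lc : lam (@unit_cell R 0%N) = 1.
    by have := @lebesgue_unit_cells R [set 0%N]; rewrite bigcup_set1 => ->; rewrite /card_of esum_set1.
  rewrite /disc /Leb unlock; case: ifPn => [_|/negP[]]; last first.
    have h : lam (@unit_cell R 0%N) <= lam setT.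
      by apply: le_measure => //; apply: mem_set.
    by rewrite lc in h; apply: lt_le_trans h.
  apply: (le_ess_sup_on mc); first by rewrite lc.
  move=> x [x0 xk] /=; rewrite patchE mem_set; last by rewrite /pos_half/= in_itv/= andbT.
  by rewrite /step xk eqxx abse1.
Qed.

Lemma ae_posW (P : R -> Prop) : (forall x : R, (0 < x)%R -> P x) -> ae_pos P.
Proof. by move=> H; apply: aeW => x; exact: H. Qed.

Section ri.
Variable E : (R -> \bar R) -> \bar R.
Hypothesis hE : ri_norm E.

Lemma rearr_norm_ri : rearr_norm E.
Proof.
split.
- by move=> f g hf hg fg; apply: (ri_mono hE) => //; exact: ae_posW.
- by move=> a f; exact: (ri_scale hE).
- by move=> f g; exact: (ri_triangle hE).
- by move=> f g; exact: (ri_invariant hE).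
(* Up to null sets the step function is the indicator of (0, 1): its norm is finite by [ri_indic]
   and nonzero by [ri_eq0]. *)
- have d0 k : 0 <= (k == 0)%N%:R%:E :> \bar R by rewrite lee_fin.
  have hd := mplus_step d0.
  have mI : measurable (`]0%R, 1%R[ : set R) by exact: measurable_itv.
  have lI : lam (`]0%R, 1%R[ : set R) = 1.
    by rewrite lebesgue_measure_itv/= lte_fin ltr01 oppr0 adde0.
  have Efin : E (step (fun k => (k == 0)%N%:R%:E)) < +oo.
    have A0 : (`]0%R, 1%R[ : set R) `<=` pos_half.
      by move=> x /=; rewrite /pos_half/= !in_itv/= andbT => /andP[].
    have := ri_indic hE mI A0; rewrite lI ltry => /(_ isT); apply: le_lt_trans.
    apply: (ri_mono hE) => //.
      split; last by move=> x _; rewrite lee_fin.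
      by apply/measurable_EFinP; apply: measurable_funTS; exact: measurable_indic.
    apply: ae_posW => x x0; rewrite /step lee_fin.
    case: eqVneq => [tx|//]; rewrite indicE mem_set//= in_itv/= x0/=.
    by have /andP[_] := truncn_itv (ltW x0); rewrite tx.
  have En0 : E (step (fun k => (k == 0)%N%:R%:E)) != 0.
    apply/eqP => /(ri_eq0 hE hd) [N [mN N0 hN]].
    have AN : (`]0%R, 1%R[ : set R) `<=` N.
      move=> x /=; rewrite in_itv/= => /andP[x0 x1]; apply: hN => /= /(_ x0)/eqP.
      rewrite /step (@truncn_def _ x 0%N) ?(ltW x0)//= eqe.
      by rewrite oner_eq0.
    have lI0 : lam (`]0%R, 1%R[ : set R) = 0.
      exact: (@subset_measure0 _ _ _ lam _ N mI mN AN N0).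
    by move/eqP: lI0; rewrite lI eqe oner_eq0.
  have E0 := ri_ge0 hE hd.
  exists (fine (E (step (fun k => (k == 0)%N%:R%:E)))).
    by rewrite fine_gt0// Efin andbT lt_neqAle eq_sym En0.
  by rewrite fineK// ge0_fin_numE.
Qed.

(** Partial sums increase pointwise to the series, so the Fatou property carries the finite triangle
    inequality to the limit. *)
Lemma disc_nneseries (c : nat -> nat -> \bar R) : (forall j k, 0 <= c j k) ->
  disc E (fun k => \sum_(j <oo) c j k) <= \sum_(j <oo) disc E (c j).
Proof.
move=> c0; have hN := rearr_norm_ri.
pose s n k := \sum_(0 <= j < n) c j k.
have s0 n k : 0 <= s n k by apply: sume_ge0.
have S0 k : 0 <= \sum_(j <oo) c j k by apply: nneseries_ge0.
have cv : E (step (s n)) @[n --> \oo] --> E (step (fun k => \sum_(j <oo) c j k)).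
  apply: (ri_fatou hE) => [n||]; try exact: mplus_step.
  apply: ae_posW => x x0; split.
    move=> m n mn; apply: lee_sum_nneg_natr => //.
  apply: is_cvg_nneseries => //.
rewrite /disc -(cvg_lim _ cv)//; apply: lime_le; first by apply/cvg_ex; eexists; exact: cv.
apply: nearW => n; rewrite -/(disc E _).
apply: le_trans (nneseries_lim_ge n _); last by move=> i _ _; exact: disc_ge0.
elim: n => [|n IH].
  rewrite big_nil (_ : s 0%N = fun=> 0) ?disc0//.
  by apply/funext => k; rewrite /s big_nil.
rewrite big_nat_recr//= (_ : s n.+1 = fun k => s n k + c n k); last first.
  by apply/funext => k; rewrite /s big_nat_recr.
by apply: le_trans (disc_triangle hN _ _) _ => //; rewrite leeD2r.
Qed.

End ri.
End rearrangement_norm_examples.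

(** * Discretization of weighted norms on (0,1) *)

Section discretization.
Context {R : realType}.
Local Open Scope ereal_scope.

(* [lec F G]: F is bounded by a constant multiple of G, uniformly in the index. *)
Definition lec {I : Type} (F G : I -> \bar R) : Prop :=
  exists2 C : R, (0 < C)%R & forall i, F i <= C%:E * G i.

Definition les {I : Type} (x y : I -> nat -> \bar R) : Prop :=
  exists2 C : R, (0 < C)%R & forall i k, x i k <= C%:E * y i k.

Definition nns {I : Type} (x : I -> nat -> \bar R) : Prop := forall i k, 0 <= x i k.

Lemma lecW {I} (F G : I -> \bar R) : (forall i, F i <= G i) -> lec F G.
Proof. by move=> FG; exists 1%R => // i; rewrite mul1e. Qed.

Lemma lec_trans {I} (G F H : I -> \bar R) : lec F G -> lec G H -> lec F H.
Proof.
move=> [C C0 FG] [D D0 GH]; exists (C * D)%R; first exact: mulr_gt0.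
move=> i; apply: le_trans (FG i) _; rewrite EFinM -muleA lee_wpmul2l//.
by rewrite lee_fin ltW.
Qed.

Lemma lecD {I} (F G H : I -> \bar R) : lec F H -> lec G H ->
  lec (fun i => F i + G i) H.
Proof.
move=> [C C0 FH] [D D0 GH]; exists (C + D)%R; first exact: addr_gt0.
by move=> i; rewrite EFinD ge0_muleDl; [exact: leeD|rewrite lee_fin ltW..].
Qed.

Lemma lesW {I} (x y : I -> nat -> \bar R) : (forall i k, x i k <= y i k) -> les x y.
Proof. by move=> xy; exists 1%R => // i k; rewrite mul1e. Qed.

Lemma les_trans {I} (y x z : I -> nat -> \bar R) : les x y -> les y z -> les x z.
Proof.
move=> [C C0 FG] [D D0 GH]; exists (C * D)%R; first exact: mulr_gt0.
move=> i k; apply: le_trans (FG i k) _; rewrite EFinM -muleA lee_wpmul2l//.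
by rewrite lee_fin ltW.
Qed.

Lemma lesD {I} (x y z : I -> nat -> \bar R) : les x z -> les y z ->
  les (fun i k => x i k + y i k) z.
Proof.
move=> [C C0 FH] [D D0 GH]; exists (C + D)%R; first exact: addr_gt0.
by move=> i k; rewrite EFinD ge0_muleDl; [exact: leeD|rewrite lee_fin ltW..].
Qed.

Lemma lee_mulC (a A b B : R) (x y : \bar R) : (0 <= a)%R -> 0 <= x ->
  (a <= A * b)%R -> x <= B%:E * y -> a%:E * x <= (A * B)%:E * (b%:E * y).
Proof.
move=> a0 x0 ab xy; apply: (@le_trans _ _ ((A * b)%:E * (B%:E * y))).
  by apply: lee_pmul => //; rewrite lee_fin.
by rewrite !muleA -!EFinM mulrAC.
Qed.

Definition comparable_by (C a b : R) : Prop := (a <= C * b)%R /\ (b <= C * a)%R.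

(* [ws k] is the size of the weight [w] on the cell [exp_cell k]. *)
Record adm (w : R -> R) (ws : nat -> R) : Prop := Adm {
  adm_gt0 : forall k, (0 < ws k)%R;
  adm_cell : exists2 C : R, (0 < C)%R &
    forall k t, exp_cell k t -> comparable_by C (w t) (ws k);
  adm_succ : exists2 C : R, (0 < C)%R & forall k, comparable_by C (ws k) (ws k.+1) }.

(** Each of [X] and [x] is bounded by the other N cells nearer to 0. This is all that monotonicity
    of f^* gives, as f^* may jump inside a cell, and it suffices because shifts are bounded on
    sequences. *)
Definition approx {I : Type} (X : I -> R -> \bar R) (x : I -> nat -> \bar R) : Prop :=
  exists N : nat, exists2 C : R, (0 < C)%R & forall i m t,
    (exp_cell m t -> X i t <= C%:E * x i (m + N)%N) /\
    (exp_cell (m + N) t -> x i m <= C%:E * X i t).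

Lemma comparable_trans (C D a b c : R) : (0 <= C)%R -> (0 <= D)%R ->
  comparable_by C a b -> comparable_by D b c ->
  comparable_by (C * D) a c.
Proof.
move=> C0 D0 [ab ba] [bc cb]; split.
  by apply: le_trans ab _; rewrite -mulrA ler_wpM2l.
by apply: le_trans cb _; rewrite (mulrC C) -mulrA ler_wpM2l.
Qed.

Lemma adm_shift (w : R -> R) (ws : nat -> R) (N : nat) : adm w ws ->
  exists2 C : R, (0 < C)%R & forall k, comparable_by C (ws k) (ws (k + N)%N).
Proof.
move=> [w0 _ [C C0 hC]]; elim: N => [|N [D D0 hD]].
  by exists 1%R => // k; rewrite addn0; split; rewrite mul1r.
exists (D * C)%R; first exact: mulr_gt0.
by move=> k; rewrite addnS; apply: comparable_trans (hD k) (hC _); exact: ltW.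
Qed.

Lemma adm_ge0 (w : R -> R) (ws : nat -> R) k t : adm w ws -> exp_cell k t -> (0 <= w t)%R.
Proof.
move=> [w0 [C C0 hC] _] /hC [_ h]; have := le_trans (ltW (w0 k)) h.
by rewrite pmulr_rge0.
Qed.

Definition wseq {I : Type} (ws : nat -> R) (x : I -> nat -> \bar R) (i : I) (k : nat) :=
  (ws k)%:E * x i k.

Section norm.
Variable F : (R -> \bar R) -> \bar R.
Hypothesis hF : rearr_norm F.

Lemma lec_disc {I : Type} (x y : I -> nat -> \bar R) : nns x -> nns y -> les x y ->
  lec (fun i => disc F (x i)) (fun i => disc F (y i)).
Proof.
move=> x0 y0 [C C0 xy]; exists C => // i; rewrite -disc_scale//; last exact: ltW.
exact: disc_mono.
Qed.

Lemma tnorm_le_discC (I : set R) (g : R -> \bar R) (c : nat -> \bar R) (C : R) :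
  (0 <= C)%R -> I `<=` `]0%R, 1%R[ -> (forall k, 0 <= c k) ->
  (forall k t, exp_cell k t -> I t -> `|g t| <= C%:E * c k) ->
  tnorm F I g <= C%:E * disc F c.
Proof.
move=> C0 I1 c0 gc; rewrite -disc_scale//; apply: tnorm_le_disc => // k.
by rewrite mule_ge0.
Qed.

Lemma disc_le_tnormC (I : set R) (g : R -> \bar R) (c : nat -> \bar R) (C : R) :
  (0 < C)%R -> (forall k, 0 <= c k) ->
  (forall k t, exp_cell k t -> 0 < c k -> I t /\ c k <= C%:E * `|g t|) ->
  disc F c <= C%:E * tnorm F I g.
Proof.
move=> C0 c0 gc; have Ci : (0 < C^-1)%R by rewrite invr_gt0.
rewrite -lee_pdivrMl// -disc_scale//; last exact: ltW.
apply: disc_le_tnorm => // [k|k t kt ck]; first by rewrite mule_ge0// lee_fin ltW.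
have c0' : 0 < c k by rewrite -(@pmule_rgt0 _ C^-1%:E) ?lte_fin.
by have [It h] := gc k t kt c0'; split => //; rewrite lee_pdivrMl.
Qed.

Section weighted.
Variables (I : Type) (w : R -> R) (ws : nat -> R).
Variables (X : I -> R -> \bar R) (x : I -> nat -> \bar R).
Hypotheses (hw : adm w ws) (hX : approx X x) (x0 : nns x).

Local Notation wx := (wseq ws x).
Let ws0 k : (0 <= (ws k)%:E :> \bar R). Proof. by rewrite lee_fin ltW// (adm_gt0 hw). Qed.

Lemma nns_wseq : nns wx.
Proof. by move=> i k; rewrite /wseq mule_ge0. Qed.

Hypothesis X0 : forall i t, (0 < t < 1)%R -> 0 <= X i t.

Lemma approx_weight : exists N : nat, exists2 C : R, (0 < C)%R & forall i m t,
  (exp_cell m t -> `|(w t)%:E * X i t| <= C%:E * wx i (m + N)%N) /\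
  (exp_cell (m + N) t -> wx i m <= C%:E * `|(w t)%:E * X i t|).
Proof.
have [N [C C0 hC]] := hX; have [D D0 hD] := adm_shift N hw.
have [B B0 hB] := adm_cell hw.
have gtE i k t : exp_cell k t -> `|(w t)%:E * X i t| = (w t)%:E * X i t.
  move=> kt; rewrite gee0_abs// mule_ge0//; last exact/X0/(exp_cell_pos kt).
  by rewrite lee_fin (adm_ge0 hw kt).
exists N; exists (B * D * C)%R; first by rewrite !mulr_gt0.
move=> i m t; split => mt; rewrite (gtE _ _ _ mt).
  have [h _] := hC i m t.
  have [h1 _] := comparable_trans (ltW B0) (ltW D0) (hB _ _ mt) (hD m).
  apply: lee_mulC => //; [exact: adm_ge0 hw mt|exact/X0/(exp_cell_pos mt)|exact: h].
have [_ h] := hC i m t.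
have [_ h1] := comparable_trans (ltW B0) (ltW D0) (hB _ _ mt)
  (conj (proj2 (hD m)) (proj1 (hD m))).
apply: lee_mulC => //; [exact/ltW/(adm_gt0 hw)|exact: h].
Qed.

Lemma tnorm_weight_le :
  lec (fun i => tnorm F `]0%R, 1%R[ (fun t => (w t)%:E * X i t))
      (fun i => disc F (wx i)).
Proof.
have [N [C C0 hC]] := approx_weight; exists C => // i.
apply: (@le_trans _ _ (C%:E * disc F (fun k => wx i (k + N)%N))).
  apply: tnorm_le_discC => [||k|k t kt _]//; first exact: ltW.
    exact: nns_wseq.
  by have [h _] := hC i k t; exact: h.
rewrite lee_wpmul2l ?lee_fin ?(ltW C0)//; apply: (disc_shiftl hF N).
exact: nns_wseq.
Qed.

Lemma disc_weight_le :
  lec (fun i => disc F (wx i))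
      (fun i => tnorm F `]0%R, 1%R[ (fun t => (w t)%:E * X i t)).
Proof.
have [N [C C0 hC]] := approx_weight; exists C => // i.
(* The weighted sequence moved N places to the right: the value at m is then compared with [X] on
   cell m + N, as [approx] demands. *)
pose c k := if (N <= k)%N then wx i (k - N)%N else 0.
have c0 k : 0 <= c k by rewrite /c; case: ifPn => // _; exact: nns_wseq.
apply: (@le_trans _ _ (disc F c)).
  have := disc_shiftl hF N c0; congr (_ <= _); congr disc; apply/funext => k.
  by rewrite /c leq_addl addnK.
apply: disc_le_tnormC => // k t kt ck; split.
  by rewrite /= in_itv/=; exact: exp_cell_pos kt.
move: ck kt; rewrite /c; case: ifPn => [Nk _|_]; last by rewrite ltxx.
by have [_ h] := hC i (k - N)%N t; rewrite subnK// in h.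
Qed.

Hypothesis xdbl : les x (fun i k => x i k.+1).

(** The cells m, m+1, ... fill (0, e^{-m}), so this is the discrete norm over that interval. *)
Definition tail_disc i m := disc F (fun k => if (m <= k)%N then wx i k else 0).

Let tail_ge0 i m k : 0 <= (if (m <= k)%N then wx i k else 0).
Proof. by case: ifPn => // _; exact: nns_wseq. Qed.

Lemma tail_disc_ge0 : nns tail_disc.
Proof. by move=> i m; apply: disc_ge0. Qed.

(** As x k is dominated by x k.+1, dropping the first cell of a tail costs only a constant. The tail
    thus inherits the hypothesis [xdbl], so tail norms can be nested. *)
Lemma tail_disc_dbl : les tail_disc (fun i m => tail_disc i m.+1).
Proof.
have [C C0 hC] := xdbl; have [D D0 hD] := adm_succ hw.
exists (D * C)%R => [|i m]; first exact: mulr_gt0.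
have DC0 : (0 <= D * C)%R by rewrite ltW// mulr_gt0.
apply: (@le_trans _ _ ((D * C)%:E * disc F (fun k => if (m <= k)%N then wx i k.+1 else 0))).
  rewrite -disc_scale//; last by move=> k; case: ifPn => // _; exact: nns_wseq.
  apply: disc_mono => // k; case: ifPn => _; last by rewrite mule0.
  by apply: lee_mulC => //; [exact/ltW/(adm_gt0 hw)|have [] := hD k].
rewrite lee_wpmul2l ?lee_fin//; have := disc_shiftl hF 1 (tail_ge0 i m.+1).
apply: le_trans; apply: disc_mono => // k; last by rewrite addn1 ltnS.
by case: ifPn => // _; exact: nns_wseq.
Qed.

Lemma approx_tail :
  approx (fun i t => tnorm F `]0%R, t[ (fun s => (w s)%:E * X i s)) tail_disc.
Proof.
have [N [C C0 hC]] := approx_weight; have [D D0 hD] := tail_disc_dbl.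
(* The first inequality costs C, the second D * C; this constant exceeds both. *)
exists N, (C * (D + 1))%R => [|i m t]; first by rewrite mulr_gt0// addr_gt0.
have CD1 : (C <= C * (D + 1))%R by rewrite ler_pMr// lerDr ltW.
have CD2 : (D * C <= C * (D + 1))%R by rewrite mulrC ler_pM2l// lerDl.
split => mt.
  apply: (@le_trans _ _ (C%:E * disc F (fun k => if (m <= k)%N then wx i (k + N)%N else 0))).
    apply: tnorm_le_discC => [|s|k|k s ks]; first exact: ltW.
    - rewrite /= !in_itv/= => /andP[-> st]; have /andP[_ t1] := exp_cell_pos mt.
      exact: lt_trans t1.
    - by case: ifPn => // _; exact: nns_wseq.
    - rewrite /= in_itv/= => /andP[_ st].
      rewrite ifT; first by have [h _] := hC i k s; exact: h.
      rewrite leqNgt; apply/negP => km.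
      move: ks mt; rewrite /exp_cell/= !in_itv/= => /andP[ks _] /andP[_ mt].
      have := lt_trans (le_lt_trans ks st) mt; rewrite ltr_expR ltrN2 ltr_nat.
      by rewrite ltnS leqNgt km.
  apply: (@le_trans _ _ (C%:E * tail_disc i (m + N)%N)).
    rewrite lee_wpmul2l ?lee_fin ?(ltW C0)//.
    have := disc_shiftl hF N (tail_ge0 i (m + N)%N).
    apply: le_trans; apply: disc_mono => // k; last by rewrite leq_add2r.
    by case: ifPn => // _; exact: nns_wseq.
  by rewrite lee_wpmul2r ?lee_fin//; exact: tail_disc_ge0.
(* For t in cell m + N only the cells beyond m + N are sure to lie inside (0, t), so the first cell
   of the tail is given up beforehand. *)
apply: le_trans (hD i m) _.
set T := tnorm _ _ _.
have T0 : 0 <= T.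
  exact: tnorm_ge0.
apply: (@le_trans _ _ ((D * C)%:E * T)); last by rewrite lee_wpmul2r ?lee_fin.
rewrite EFinM -muleA lee_wpmul2l ?lee_fin ?(ltW D0)//.
pose c k := if (m + N < k)%N then wx i (k - N)%N else 0.
have c0 k : 0 <= c k by rewrite /c; case: ifPn => // _; exact: nns_wseq.
apply: (@le_trans _ _ (disc F c)).
  have := disc_shiftl hF N c0; apply: le_trans; apply: disc_mono => // k.
  by rewrite /c ltn_add2r addnK.
apply: disc_le_tnormC => // k s ks; rewrite /c; case: ifPn => [mk _|]; last by rewrite ltxx.
split.
  rewrite /= in_itv/=; have /andP[-> _] /= := exp_cell_pos ks.
  move: ks mt; rewrite /exp_cell/= !in_itv/= => /andP[_ ks] /andP[mt _].
  by apply: lt_le_trans ks _; apply: le_trans mt; rewrite ler_expR lerN2 ler_nat.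
have [_ h] := hC i (k - N)%N s; apply: h; rewrite subnK//.
by apply: leq_trans (leq_addl m N) (ltnW mk).
Qed.

(** The cells 0, ..., m fill [e^{-m-1}, 1), so this is the discrete norm over that interval. *)
Definition head_disc i m := disc F (fun k => if (k <= m)%N then wx i k else 0).

Let head_ge0 i m k : 0 <= (if (k <= m)%N then wx i k else 0).
Proof. by case: ifPn => // _; exact: nns_wseq. Qed.

Lemma head_disc_nondecr i m n : (m <= n)%N -> head_disc i m <= head_disc i n.
Proof.
move=> mn; apply: disc_mono => // k; case: ifPn => [km|_]; last exact: head_ge0.
by rewrite (leq_trans km mn).
Qed.

Lemma approx_head :
  approx (fun i t => tnorm F `]t, 1%R[ (fun s => (w s)%:E * X i s)) head_disc.
Proof.
have [N [C C0 hC]] := approx_weight.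
(* One cell more than in [approx_weight]: for t in cell m + N + 1 the cells up to m + N lie entirely
   in (t, 1). In the other inequality the extra cell is harmless, heads being nondecreasing. *)
exists N.+1, C => // i m t; split => mt.
  apply: (@le_trans _ _ (C%:E * disc F (fun k => if (k <= m)%N then wx i (k + N)%N else 0))).
    apply: tnorm_le_discC => [|s|k|k s ks]; first exact: ltW.
    - rewrite /= !in_itv/= => /andP[st ->]; have /andP[t0 _] := exp_cell_pos mt.
      by rewrite (lt_trans t0 st).
    - by case: ifPn => // _; exact: nns_wseq.
    - rewrite /= in_itv/= => /andP[ts _].
      rewrite ifT; first by have [h _] := hC i k s; exact: h.
      rewrite leqNgt; apply/negP => km.
      move: ks mt; rewrite /exp_cell/= !in_itv/= => /andP[_ ks] /andP[mt _].
      have := lt_trans (le_lt_trans mt ts) ks; rewrite ltr_expR ltrN2 ltr_nat.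
      by rewrite ltnS leqNgt km.
  rewrite lee_wpmul2l ?lee_fin ?(ltW C0)//.
  apply: (@le_trans _ _ (head_disc i (m + N)%N)); last first.
    by apply: head_disc_nondecr; rewrite addnS.
  have := disc_shiftl hF N (head_ge0 i (m + N)%N).
  apply: le_trans; apply: disc_mono => // k; last by rewrite leq_add2r.
  by case: ifPn => // _; exact: nns_wseq.
pose c k := if (N <= k <= m + N)%N then wx i (k - N)%N else 0.
have c0 k : 0 <= c k by rewrite /c; case: ifPn => // _; exact: nns_wseq.
apply: (@le_trans _ _ (disc F c)).
  have := disc_shiftl hF N c0; apply: le_trans; apply: disc_mono => // k.
  by rewrite /c leq_add2r leq_addl addnK.
apply: disc_le_tnormC => // k s ks; rewrite /c; case: ifPn => [/andP[Nk km] _|]; last by rewrite ltxx.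
split.
  rewrite /= in_itv/=; have /andP[_ ->] /= := exp_cell_pos ks; rewrite andbT.
  move: ks mt; rewrite /exp_cell/= !in_itv/= => /andP[ks _] /andP[_ mt].
  by apply: lt_le_trans mt _; apply: le_trans ks; rewrite ler_expR lerN2 ler_nat addnS ltnS.
by have [_ h] := hC i (k - N)%N s; apply: h; rewrite subnK.
Qed.

End weighted.
End norm.
End discretization.

(** * Hardy-type inequalities for sequences *)

Section elementary_estimates.
Context {R : realType}.

Lemma geometric_sum_bound (e : R) : 0 < e -> exists2 G : R, 0 < G &
  forall n, \sum_(0 <= k < n) expR (- (e * k%:R)) <= G.
Proof.
move=> e0; pose q := expR (- e).
have q1 : q < 1 by rewrite -expR0 ltr_expR oppr_lt0.
have q0 : 0 < q by exact: expR_gt0.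
have q1' : 0 < 1 - q by rewrite subr_gt0.
exists (1 - q)^-1; first by rewrite invr_gt0.
move=> n; rewrite -div1r ler_pdivlMr//.
suff -> : (\sum_(0 <= k < n) expR (- (e * k%:R))) * (1 - q) = 1 - q ^+ n.
  by rewrite gerBl exprn_ge0// ltW.
elim: n => [|n IH]; first by rewrite big_nil mul0r expr0 subrr.
rewrite big_nat_recr//= mulrDl IH.
have -> : expR (- (e * n%:R)) = q ^+ n by rewrite /q -expRM_natl mulrC mulrN.
by rewrite exprS; ring.
Qed.

Lemma nneseries_geometric (e : R) : 0 < e -> exists2 G : R, 0 < G &
  (\sum_(k <oo) (expR (- (e * k%:R)))%:E <= G%:E)%E.
Proof.
move=> /geometric_sum_bound[G G0 hG]; exists G => //.
apply: lime_le; first by apply: is_cvg_nneseries => n _ _; rewrite lee_fin expR_ge0.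
by apply: nearW => n; rewrite sumEFin lee_fin.
Qed.

(** Young's inequality for the product of y^s and 1, with conjugate exponents 1/s and 1/(1-s). *)
Lemma bernoulli_powR_le1 (s y : R) : 0 < s <= 1 -> 0 <= y -> y `^ s <= 1 + s * (y - 1).
Proof.
move=> /andP[s0]; rewrite le_eqVlt => /predU1P[->|s1] y0.
  by rewrite powRr1// mul1r addrC subrK.
have t0 : 0 < (1 - s) by rewrite subr_gt0.
have := @conjugate_powR R (y `^ s) 1 s^-1 (1 - s)^-1.
rewrite !invrK powR_ge0 ler01 !invr_gt0 s0 t0 => /(_ isT isT isT isT).
rewrite -powRrM mulfV ?gt_eqF// powRr1// powR1 mulr1 => /(_ _) h.
by apply: le_trans (h _) _; lra.
Qed.

(** The concave case with exponent 1/s, applied to y^s. *)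
Lemma bernoulli_powR_ge1 (s y : R) : 1 <= s -> 0 <= y -> 1 + s * (y - 1) <= y `^ s.
Proof.
move=> s1 y0; have s0 := lt_le_trans ltr01 s1.
have := @bernoulli_powR_le1 s^-1 (y `^ s); rewrite invr_gt0 s0 invf_le1// s1 powR_ge0.
rewrite -powRrM mulfV ?gt_eqF// powRr1// => /(_ isT isT) h.
have : s * (y - 1) <= s * (s^-1 * (y `^ s - 1)) by rewrite ler_pM2l//; lra.
by rewrite mulrA mulfV ?gt_eqF// mul1r; lra.
Qed.

(** Scaling Bernoulli's inequality at (x + h)/x by x^s turns it into the comparison of x^s with its
    tangent at x. *)
Lemma powR_tangent (s x h : R) : 0 < x -> 0 <= x + h ->
  (x + h) `^ s = x `^ s * ((x + h) / x) `^ s /\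
  x `^ s * (1 + s * ((x + h) / x - 1)) = x `^ s + s * h * x `^ (s - 1).
Proof.
move=> x0 xh; split.
  by rewrite -powRM ?(ltW x0)// ?divr_ge0 ?(ltW x0)// mulrCA mulfV ?gt_eqF// mulr1.
rewrite powRB ?(gt_eqF x0) ?implybT// powRr1 ?(ltW x0)//.
by field; rewrite gt_eqF.
Qed.

Lemma powR_tangent_le (s x h : R) : 0 < s <= 1 -> 0 < x -> 0 <= x + h ->
  (x + h) `^ s <= x `^ s + s * h * x `^ (s - 1).
Proof.
move=> s1 x0 xh; have [-> <-] := powR_tangent s x0 xh.
by rewrite ler_wpM2l ?powR_ge0// bernoulli_powR_le1// divr_ge0// ltW.
Qed.

Lemma powR_tangent_ge (s x h : R) : 1 <= s -> 0 < x -> 0 <= x + h ->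
  x `^ s + s * h * x `^ (s - 1) <= (x + h) `^ s.
Proof.
move=> s1 x0 xh; have [-> <-] := powR_tangent s x0 xh.
by rewrite ler_wpM2l ?powR_ge0// bernoulli_powR_ge1// divr_ge0// ltW.
Qed.

Lemma natr1_gt0 (n : nat) : 0 < 1 + n%:R :> R.
Proof. by rewrite addrC natr1 ltr0n. Qed.

(** The tangent inequalities bound s (1+j)^(s-1) by an increment of x^s, backward (h = -1) when s <=
    1 and forward (h = 1) when s > 1, and the increments telescope. Together with its converse this
    is how the weight l^(s-1) under an l^1 norm produces the weight l^s of J. *)
Lemma sum_powR_le (s : R) : 0 < s -> exists2 C : R, 0 < C &
  forall m, \sum_(0 <= j < m) (1 + j%:R) `^ (s - 1) <= C * (1 + m%:R) `^ s.
Proof.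
move=> s0; exists s^-1; first by rewrite invr_gt0.
move=> m; rewrite -ler_pdivrMl ?invr_gt0// invrK.
have [s1|s1] := leP s 1.
  apply: (@le_trans _ _ (m%:R `^ s)); last first.
    by apply: ge0_ler_powR; rewrite ?nnegrE ?lerDr// ?ltW ?natr1_gt0.
  elim: m => [|m IH]; first by rewrite big_nil mulr0 powR_ge0.
  rewrite big_nat_recr//= mulrDr.
  have := @powR_tangent_le s (1 + m%:R) (-1); rewrite s0 s1 natr1_gt0 => /(_ isT isT).
  rewrite addrAC subrr add0r ler0n => /(_ isT) h.
  have -> : m.+1%:R = 1 + m%:R :> R by rewrite -natr1 addrC.
  lra.
have h m' : s * (1 + m'%:R) `^ (s - 1) <= (1 + m'.+1%:R) `^ s - (1 + m'%:R) `^ s.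
  have := @powR_tangent_ge s (1 + m'%:R) 1 (ltW s1) (natr1_gt0 _).
  rewrite addr_ge0 ?(ltW (natr1_gt0 _))// => /(_ isT).
  by rewrite -addrA natr1 mulr1; lra.
suff : s * \sum_(0 <= j < m) (1 + j%:R) `^ (s - 1) <= (1 + m%:R) `^ s - 1 by lra.
elim: m => [|m IH]; first by rewrite big_nil mulr0 addr0 powR1 subrr.
by rewrite big_nat_recr//= mulrDr; have := h m; lra.
Qed.

Lemma sum_powR_ge (s : R) : 0 < s -> exists2 C : R, 0 < C &
  forall m, (1 + m%:R) `^ s <= C * \sum_(0 <= j < m.+1) (1 + j%:R) `^ (s - 1).
Proof.
(* For s <= 1 telescoping leaves s times the sum plus 1, and the 1 is absorbed by the summand j = 0;
   for s > 1 the factor s is enough. *)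
move=> s0; exists (1 + s); first by rewrite addr_gt0.
have [s1|s1] := leP s 1.
  have h m : (1 + m%:R) `^ s <= 1 + s * \sum_(0 <= j < m) (1 + j%:R) `^ (s - 1).
    elim: m => [|m IH]; first by rewrite big_nil mulr0 !addr0 powR1.
    rewrite big_nat_recr//= mulrDr.
    have := @powR_tangent_le s (1 + m%:R) 1; rewrite s0 s1 natr1_gt0 => /(_ isT isT).
    rewrite addr_ge0 ?(ltW (natr1_gt0 _))// => /(_ isT).
    by rewrite -addrA natr1 mulr1; lra.
  move=> m; apply: le_trans (h m) _; rewrite mulrDl mul1r; apply: lerD.
    rewrite big_nat_recl//= addr0 powR1 lerDl; apply: sumr_ge0 => j _; exact: powR_ge0.
  by rewrite ler_pM2l// big_nat_recr//= lerDl powR_ge0.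
move=> m; apply: (@le_trans _ _ (s * \sum_(0 <= j < m.+1) (1 + j%:R) `^ (s - 1))).
  elim: m => [|m IH].
    by rewrite big_nat1 addr0 !powR1 mulr1 ltW.
  rewrite big_nat_recr//= mulrDr.
  have := @powR_tangent_ge s (1 + m.+1%:R) (-1) (ltW s1) (natr1_gt0 _).
  rewrite addrAC subrr add0r ler0n => /(_ isT).
  have e : 1 + m%:R = m.+1%:R :> R by rewrite -natr1 addrC.
  by move: IH; rewrite e; lra.
rewrite ler_wpM2r// ?lerDr//; apply: sumr_ge0 => j _; exact: powR_ge0.
Qed.

Lemma powR_le_expR (g d : R) : 0 < d -> exists2 C : R, 0 < C &
  forall n : nat, (1 + n%:R) `^ g <= C * expR (d * n%:R).
Proof.
move=> d0; have [g0|g0] := leP g 0.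
  exists 1 => // n; rewrite mul1r; apply: (@le_trans _ _ 1); last first.
    by rewrite -expR0 ler_expR mulr_ge0// ltW.
  have n1 : 1 <= 1 + n%:R :> R by rewrite lerDl.
  by rewrite -[leRHS](powRr0 (1 + n%:R)); exact: ler_powR.
(* The bound 1 + n <= M exp(e n) is raised to the power g, so e g must equal d; M = 1 + 1/e makes M
   (1 + e n) at least 1 + n. *)
pose e := d / g; have e0 : 0 < e by rewrite divr_gt0.
pose M := 1 + e^-1; have M0 : 0 < M by rewrite addr_gt0// invr_gt0.
exists (M `^ g); first exact: powR_gt0.
move=> n.
have h : 1 + n%:R <= M * expR (e * n%:R).
  apply: (@le_trans _ _ (M * (1 + e * n%:R))); last by rewrite ler_pM2l// expR_ge1Dx.
  rewrite /M mulrDr mulr1 mulrDl mul1r mulrA mulVf ?gt_eqF// mul1r.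
  have := ler0n R n; have : 0 <= e * n%:R by rewrite mulr_ge0// ltW.
  have : 0 < e^-1 by rewrite invr_gt0.
  lra.
apply: (@le_trans _ _ ((M * expR (e * n%:R)) `^ g)).
  by apply: ge0_ler_powR; rewrite ?nnegrE ?(ltW g0) ?(ltW (natr1_gt0 _)) ?mulr_ge0 ?(ltW M0) ?expR_ge0.
rewrite powRM ?(ltW M0) ?expR_ge0// ler_pM2l ?powR_gt0//.
by rewrite -expRM mulrAC divfK ?gt_eqF.
Qed.

End elementary_estimates.

Section geometric_domination.
Context {R : realType}.
Local Open Scope ereal_scope.

Lemma nneseries_geometric_mul (e : R) : (0 < e)%R -> exists2 G : R, (0 < G)%R &
  forall z : \bar R, 0 <= z ->
    \sum_(n <oo) (expR (- (e * n%:R)))%:E * z <= G%:E * z.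
Proof.
move=> /nneseries_geometric[G G0 hG]; exists G => // -[r| |]//; last first.
  by move=> _; rewrite gt0_muley ?lte_fin// leey.
move=> r0; under eq_eseriesr do rewrite muleC.
rewrite nneseriesZl; last by move=> n _; rewrite lee_fin expR_ge0.
by rewrite muleC lee_wpmul2r.
Qed.

Lemma les_geometric (I : Type) (y z : I -> nat -> \bar R)
    (t : I -> nat -> nat -> \bar R) (e B : R) : (0 < e)%R -> (0 < B)%R ->
  (forall i m n, 0 <= t i m n) -> nns z ->
  les y (fun i m => \sum_(n <oo) t i m n) ->
  (forall i m n, t i m n <= (B * expR (- (e * n%:R)))%:E * z i m) ->
  les y z.
Proof.
move=> e0 B0 t0 z0 [C C0 yC] tz; have [G G0 hG] := nneseries_geometric_mul e0.
exists (C * (B * G))%R => [|i m]; first by rewrite !mulr_gt0.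
apply: le_trans (yC i m) _; rewrite [in leRHS]EFinM -[leRHS]muleA.
rewrite lee_wpmul2l ?lee_fin ?(ltW C0)//.
apply: (@le_trans _ _ (\sum_(n <oo) B%:E * ((expR (- (e * n%:R)))%:E * z i m))).
  by apply: lee_nneseries => // n _; rewrite muleA -EFinM.
rewrite nneseriesZl; last by move=> n _; rewrite mule_ge0// lee_fin expR_ge0.
by rewrite EFinM -muleA lee_wpmul2l ?lee_fin ?(ltW B0)// hG.
Qed.

End geometric_domination.

Section hardy.
Context {R : realType}.
Local Open Scope ereal_scope.
Variables (I : Type) (x y : I -> nat -> \bar R) (v : nat -> R) (e D : R).
Hypotheses (x0 : nns x) (y0 : nns y) (v0 : forall k, (0 < v k)%R) (e0 : (0 < e)%R)
  (D0 : (0 < D)%R).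

Local Notation g n := (expR (- (e * n%:R))).

Lemma nns_wseq_pos (z : I -> nat -> \bar R) : nns z -> nns (wseq v z).
Proof. by move=> z0 i k; rewrite /wseq mule_ge0// lee_fin ltW. Qed.

(** [T n] is a shift by n. Moving the weight across it gains the factor exp(-e n), and shifts do not
    increase the norm, so the countable triangle inequality leaves a convergent geometric series. *)
Let hardy (E : (R -> \bar R) -> \bar R) (T : nat -> (nat -> \bar R) -> nat -> \bar R) :
  ri_norm E ->
  (forall n c, (forall k, 0 <= c k) -> forall k, 0 <= T n c k) ->
  (forall n c, (forall k, 0 <= c k) -> disc E (T n c) <= disc E c) ->
  les y (fun i m => \sum_(n <oo) T n (x i) m) ->
  (forall i m n, (v m)%:E * T n (x i) m <= (D * g n)%:E * T n (wseq v x i) m) ->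
  lec (fun i => disc E (wseq v y i)) (fun i => disc E (wseq v x i)).
Proof.
move=> hE T0 TE [C C0 yC] hT; have hN := rearr_norm_ri hE.
have [G G0 hG] := nneseries_geometric_mul e0.
have wx0 := nns_wseq_pos x0.
have gT0 i n k : 0 <= (g n)%:E * T n (wseq v x i) k.
  by rewrite mule_ge0// ?lee_fin ?expR_ge0// T0.
exists (C * D * G)%R => [|i]; first by rewrite !mulr_gt0.
apply: (@le_trans _ _ ((C * D)%:E *
    disc E (fun m => \sum_(n <oo) (g n)%:E * T n (wseq v x i) m))).
  rewrite -disc_scale//; [|by rewrite mulr_ge0// ltW|by move=> k; apply: nneseries_ge0].
  apply: disc_mono => // [|m]; first exact: nns_wseq_pos.
  rewrite EFinM -muleA /wseq.
  apply: (@le_trans _ _ ((v m)%:E * (C%:E * \sum_(n <oo) T n (x i) m))).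
    by rewrite lee_wpmul2l ?lee_fin ?(ltW (v0 _)).
  rewrite [leLHS]muleCA lee_wpmul2l ?lee_fin ?(ltW C0)// -!nneseriesZl;
    try (by move=> n _; exact: T0); try (by move=> n _; exact: gT0).
  apply: lee_nneseries => n _.
    by move=> _; rewrite mule_ge0 ?lee_fin ?(ltW (v0 _))// T0.
  by have := hT i m n; rewrite /wseq EFinM -muleA.
rewrite [in leRHS]EFinM -[leRHS]muleA.
rewrite lee_wpmul2l ?lee_fin ?(ltW (mulr_gt0 C0 D0))//.
apply: le_trans (disc_nneseries hE (gT0 i)) _.
apply: (@le_trans _ _ (\sum_(n <oo) disc E (wseq v x i) * (g n)%:E)).
  apply: lee_nneseries => n _; first by move=> _; exact: disc_ge0.
  rewrite disc_scale ?expR_ge0//; last exact: T0.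
  by rewrite muleC lee_wpmul2r ?lee_fin ?expR_ge0// TE.
under eq_eseriesr do rewrite muleC.
by apply: hG; exact: disc_ge0.
Qed.

Lemma hardy_tail (E : (R -> \bar R) -> \bar R) : ri_norm E ->
  (forall m n, (v m <= D * g n * v (m + n)%N)%R) ->
  les y (fun i m => \sum_(n <oo) x i (m + n)%N) ->
  lec (fun i => disc E (wseq v y i)) (fun i => disc E (wseq v x i)).
Proof.
move=> hE hv hy; apply: (hardy (T := fun n c m => c (m + n)%N)) => // [n c c0|i m n].
  by apply: disc_shiftl => //; exact: rearr_norm_ri.
by rewrite /wseq muleA -EFinM lee_wpmul2r ?lee_fin.
Qed.

Lemma hardy_head (E : (R -> \bar R) -> \bar R) : ri_norm E ->
  (forall m n, (v (m + n)%N <= D * g n * v m)%R) ->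
  les y (fun i m => \sum_(n <oo) if (n <= m)%N then x i (m - n)%N else 0) ->
  lec (fun i => disc E (wseq v y i)) (fun i => disc E (wseq v x i)).
Proof.
move=> hE hv hy.
apply: (hardy (T := fun n c m => if (n <= m)%N then c (m - n)%N else 0)) => // [n c c0 k|n c c0|i m n].
- by case: ifPn.
- by apply: disc_shiftr => //; exact: rearr_norm_ri.
case: ifPn => [nm|_]; last by rewrite !mule0.
rewrite /wseq muleA -EFinM lee_wpmul2r// lee_fin.
by have := hv (m - n)%N n; rewrite subnK.
Qed.

End hardy.

(** * Admissible weights: powers, logarithms and their products *)

Section admissible_weights.
Context {R : realType}.

Lemma adm_pos (w : R -> R) ws k t : adm w ws -> exp_cell k t -> 0 < w t.
Proof.
move=> [w0 [C C0 hC] _] /hC [_ h]; have := lt_le_trans (w0 k) h.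
by rewrite pmulr_rgt0.
Qed.

Lemma comparable_powR (C a b e : R) : 0 < C -> 0 < a -> 0 < b ->
  comparable_by C a b -> comparable_by (C `^ `|e|) (a `^ e) (b `^ e).
Proof.
move=> C0 a0 b0; have H x y : 0 < x -> 0 < y -> x <= C * y -> y <= C * x ->
    x `^ e <= C `^ `|e| * y `^ e.
  move=> x0 y0 xy yx; have [e0|e0] := leP 0 e.
    rewrite ger0_norm// -powRM ?(ltW C0) ?(ltW y0)//.
    by apply: ge0_ler_powR; rewrite ?nnegrE ?(ltW x0) ?mulr_ge0 ?(ltW C0) ?(ltW y0).
  (* A negative power reverses the order, so the bound of y by x is the one used here. *)
  rewrite ltr0_norm// -{1 3}(opprK e) ![_ `^ (- - e)]powRN.
  have xe : 0 < x `^ (- e) by exact: powR_gt0.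
  have ye : 0 < y `^ (- e) by exact: powR_gt0.
  rewrite ler_pdivlMr// mulrC ler_pdivrMr// -powRM ?(ltW C0) ?(ltW x0)//.
  by apply: ge0_ler_powR; rewrite ?oppr_ge0 ?nnegrE ?(ltW e0) ?(ltW y0) ?mulr_ge0 ?(ltW C0) ?(ltW x0).
by move=> [h1 h2]; split; apply: H.
Qed.

Lemma adm_powR (w : R -> R) ws (e : R) : adm w ws ->
  adm (fun t => w t `^ e) (fun k => ws k `^ e).
Proof.
move=> hw; have [w0 [C C0 hC] [D D0 hD]] := hw; split.
- by move=> k; exact: powR_gt0.
- exists (C `^ `|e|); first exact: powR_gt0.
  move=> k t kt; apply: comparable_powR => //; last exact: hC.
  exact: adm_pos hw kt.
- exists (D `^ `|e|); first exact: powR_gt0.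
  by move=> k; apply: comparable_powR.
Qed.

Lemma adm_mul (w w' : R -> R) ws ws' : adm w ws -> adm w' ws' ->
  adm (fun t => w t * w' t) (fun k => ws k * ws' k).
Proof.
move=> hw hw'; have [w0 [C C0 hC] [D D0 hD]] := hw.
have [w0' [C' C0' hC'] [D' D0' hD']] := hw'.
have M (A B a b c d : R) : 0 <= a -> 0 <= b -> 0 <= c -> 0 <= d ->
    comparable_by A a b -> comparable_by B c d -> comparable_by (A * B) (a * c) (b * d).
  move=> a0 b0 c0 d0 [ab ba] [cd dc].
  by split; rewrite mulrACA; apply: ler_pM.
split.
- by move=> k; exact: mulr_gt0.
- exists (C * C'); first exact: mulr_gt0.
  move=> k t kt; apply: M; rewrite ?(ltW (w0 _)) ?(ltW (w0' _))//.
  + exact/ltW/(adm_pos hw kt).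
  + exact/ltW/(adm_pos hw' kt).
  + exact: hC.
  + exact: hC'.
- exists (D * D'); first exact: mulr_gt0.
  by move=> k; apply: M; rewrite ?(ltW (w0 _)) ?(ltW (w0' _)).
Qed.

Lemma adm_id : adm (fun t : R => t) (fun k => expR (- k%:R)).
Proof.
have e1 : 0 < expR 1 :> R by exact: expR_gt0.
have E k : expR 1 * expR (- k.+1%:R) = expR (- k%:R) :> R.
  by rewrite -expRD -natr1; congr expR; ring.
split.
- by move=> k; exact: expR_gt0.
- exists (expR 1) => // k t; rewrite /exp_cell/= in_itv/= => /andP[kt tk]; split.
    apply: (le_trans (ltW tk)); rewrite ler_peMl ?expR_ge0//.
    by rewrite -expR0 ler_expR.
  by rewrite -E ler_pM2l.
- exists (expR 1) => // k; split; first by rewrite E.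
  rewrite -expRD ler_expR -natr1; lra.
Qed.

Lemma ell_cell k (t : R) : exp_cell k t -> 1 + k%:R <= ell t <= 2 + k%:R.
Proof.
move=> kt; have /andP[t0 t1] := exp_cell_pos kt.
move: kt; rewrite /exp_cell/= in_itv/= => /andP[kt tk].
have : ln (expR (- k.+1%:R)) <= ln t by rewrite ler_ln ?posrE ?expR_gt0.
have : ln t < ln (expR (- k%:R)) by rewrite ltr_ln ?posrE ?expR_gt0.
rewrite !expRK /ell -natr1 => h1 h2; have := ler0n R k => k0.
by rewrite ler0_norm; lra.
Qed.

Lemma adm_ell : adm ell (fun k : nat => 1 + k%:R : R).
Proof.
split; first by move=> k; exact: natr1_gt0.
- exists 2 => // k t /ell_cell/andP[h1 h2]; have := ler0n R k => k0.
  by split; lra.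
- exists 2 => // k; have := ler0n R k => k0; rewrite -natr1; split; lra.
Qed.

Lemma adm_eq (w w' : R -> R) (ws ws' : nat -> R) :
  (forall t, 0 < t < 1 -> w t = w' t) -> ws =1 ws' -> adm w ws -> adm w' ws'.
Proof.
move=> ww' /funext <- [w0 [C C0 hC] hD]; split => //; exists C => // k t kt.
by rewrite -ww'; [exact: hC|exact: exp_cell_pos kt].
Qed.

(** The value of t^e at t = e^{-k}; likewise [logw e k] is that of ell(t)^e, since ell(e^{-k}) = 1 +
    k. *)
Definition expw (e : R) (k : nat) : R := expR (- (e * k%:R)).

Definition logw (e : R) (k : nat) : R := (1 + k%:R) `^ e.

Lemma expw_gt0 e k : 0 < expw e k. Proof. exact: expR_gt0. Qed.

Lemma logw_gt0 e k : 0 < logw e k. Proof. exact/powR_gt0/natr1_gt0. Qed.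

Lemma adm_expw e : adm (fun t => t `^ e) (expw e).
Proof.
apply: adm_eq (adm_powR e adm_id) => // k.
by rewrite -expRM; congr expR; ring.
Qed.

Lemma adm_logw e : adm (fun t => ell t `^ e) (logw e).
Proof. exact: adm_powR adm_ell. Qed.

Lemma expwD e k n : expw e (k + n) = expw e k * expw e n.
Proof. by rewrite /expw -expRD natrD; congr expR; ring. Qed.

Lemma logw_le e k n : 0 <= e -> (k <= n)%N -> logw e k <= logw e n.
Proof.
move=> e0 kn; apply: ge0_ler_powR; rewrite ?nnegrE ?(ltW (natr1_gt0 _))//.
by rewrite lerD2l ler_nat.
Qed.

Lemma logw_ge e k n : e <= 0 -> (k <= n)%N -> logw e n <= logw e k.
Proof.
move=> e0 kn; rewrite /logw -(opprK e) ![_ `^ (- - e)]powRN.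
rewrite lef_pV2 ?posrE ?powR_gt0 ?natr1_gt0//.
by apply: logw_le => //; rewrite oppr_ge0.
Qed.

Lemma logwD e e' k : logw e k * logw e' k = logw (e + e') k.
Proof. by rewrite /logw powRD// (gt_eqF (natr1_gt0 k)) implybT. Qed.

Lemma logwDn e k n : 0 <= e -> logw e (k + n) <= logw e k * logw e n.
Proof.
move=> e0; rewrite /logw -powRM ?(ltW (natr1_gt0 _))//.
apply: ge0_ler_powR; rewrite ?nnegrE ?mulr_ge0 ?(ltW (natr1_gt0 _))//.
have := ler0n R k; have := ler0n R n; rewrite natrD => k0 n0.
by have := mulr_ge0 k0 n0; lra.
Qed.

End admissible_weights.

Section disc_extra.
Context {R : realType}.
Local Open Scope ereal_scope.
Variable F : (R -> \bar R) -> \bar R.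
Hypothesis hF : rearr_norm F.

(** A sequence dominates each of its coordinates times a unit sequence, and all unit sequences share
    one positive norm. *)
Lemma disc_ge_term : exists2 C : R, (0 < C)%R &
  forall c, (forall k, 0 <= c k) -> forall j, c j <= C%:E * disc F c.
Proof.
have [kappa k0 hk] := disc_delta hF; exists (kappa^-1)%R; first by rewrite invr_gt0.
by move=> c c0 j; rewrite lee_pdivlMl//; exact: le_disc_delta.
Qed.

Variables (I : Type) (ws : nat -> R).
Hypothesis ws0 : forall k, (0 < ws k)%R.

Let tail_ge0 (x : I -> nat -> \bar R) i m k : nns x ->
  0 <= (if (m <= k)%N then wseq ws x i k else 0).
Proof. by move=> x0; case: ifPn => // _; exact: nns_wseq_pos. Qed.

Let head_ge0 (x : I -> nat -> \bar R) i m k : nns x ->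
  0 <= (if (k <= m)%N then wseq ws x i k else 0).
Proof. by move=> x0; case: ifPn => // _; exact: nns_wseq_pos. Qed.

Lemma tail_disc_shift (x : I -> nat -> \bar R) i m : nns x ->
  tail_disc F ws x i m <= disc F (fun n => wseq ws x i (n + m)%N).
Proof.
move=> x0; have := @disc_shiftr _ F hF m (fun n => wseq ws x i (n + m)%N).
have x0' k : 0 <= wseq ws x i (k + m)%N by exact: nns_wseq_pos.
move=> /(_ x0'); apply: le_trans; apply: disc_mono => // k; first exact: tail_ge0.
by case: ifPn => // mk; rewrite subnK.
Qed.

Lemma tail_disc_nonincr (x : I -> nat -> \bar R) i m n : nns x -> (m <= n)%N ->
  tail_disc F ws x i n <= tail_disc F ws x i m.
Proof.
move=> x0 mn; apply: disc_mono => // k; first exact: tail_ge0.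
by case: ifPn => [nk|_]; [rewrite (leq_trans mn nk)|exact: tail_ge0].
Qed.

Lemma tail_discD (x y z : I -> nat -> \bar R) i m : nns x -> nns y -> nns z ->
  (forall k, x i k <= y i k + z i k) ->
  tail_disc F ws x i m <= tail_disc F ws y i m + tail_disc F ws z i m.
Proof.
move=> x0 y0 z0 xyz; rewrite /tail_disc.
apply: le_trans (disc_triangle hF _ _) => [|k|k]; try exact: tail_ge0.
apply: disc_mono => // k; first exact: tail_ge0.
case: ifPn => _; last by rewrite adde0.
by rewrite /wseq -ge0_muleDr// lee_wpmul2l// lee_fin ltW.
Qed.

Lemma head_discD (x y z : I -> nat -> \bar R) i m : nns x -> nns y -> nns z ->
  (forall k, x i k <= y i k + z i k) ->
  head_disc F ws x i m <= head_disc F ws y i m + head_disc F ws z i m.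
Proof.
move=> x0 y0 z0 xyz; rewrite /head_disc.
apply: le_trans (disc_triangle hF _ _) => [|k|k]; try exact: head_ge0.
apply: disc_mono => // k; first exact: head_ge0.
case: ifPn => _; last by rewrite adde0.
by rewrite /wseq -ge0_muleDr// lee_wpmul2l// lee_fin ltW.
Qed.

Lemma nns_tail_disc (x : I -> nat -> \bar R) : nns x -> nns (tail_disc F ws x).
Proof. by move=> x0 i m; apply: disc_ge0 => // k; exact: tail_ge0. Qed.

Lemma nns_head_disc (x : I -> nat -> \bar R) : nns x -> nns (head_disc F ws x).
Proof. by move=> x0 i m; apply: disc_ge0 => // k; exact: head_ge0. Qed.

Lemma tail_disc_ge_term : exists2 C : R, (0 < C)%R &
  forall x : I -> nat -> \bar R, nns x -> forall i m, wseq ws x i m <= C%:E * tail_disc F ws x i m.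
Proof.
have [C C0 hC] := disc_ge_term; exists C => // x x0 i m.
have := hC (fun k => if (m <= k)%N then wseq ws x i k else 0).
by move=> /(_ (fun k => tail_ge0 i m k x0) m); rewrite leqnn.
Qed.

Lemma head_disc_ge_term : exists2 C : R, (0 < C)%R &
  forall x : I -> nat -> \bar R, nns x -> forall i m k, (k <= m)%N -> wseq ws x i k <= C%:E * head_disc F ws x i m.
Proof.
have [C C0 hC] := disc_ge_term; exists C => // x x0 i m k km.
have := hC (fun k => if (k <= m)%N then wseq ws x i k else 0).
by move=> /(_ (fun k => head_ge0 i m k x0) k); rewrite km.
Qed.

Lemma le_tail_disc (x y : I -> nat -> \bar R) i j m n : nns x -> nns y ->
  (forall k, (m <= k)%N -> x i k <= (if (n <= k)%N then y j k else 0)) ->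
  tail_disc F ws x i m <= tail_disc F ws y j n.
Proof.
move=> x0 y0 xy; apply: disc_mono => // k; first exact: tail_ge0.
case: ifPn => [/xy|_]; last exact: tail_ge0.
case: ifPn => _ h; rewrite /wseq; first by rewrite lee_wpmul2l// lee_fin ltW.
by rewrite mule_ge0_le0// lee_fin ltW.
Qed.

End disc_extra.

(** Reindexes a head by the distance to its last index, the form that [hardy_head] takes. *)
Lemma nneseries_rev {R : realType} (c : nat -> \bar R) (m : nat) : (forall k, 0 <= c k)%E ->
  (\sum_(k <oo) (if (k <= m)%N then c k else 0) =
   \sum_(k <oo) (if (k <= m)%N then c (m - k)%N else 0))%E.
Proof.
move=> c0.
have fin (d : nat -> \bar R) : (forall k, 0 <= d k)%E ->
    (\sum_(k <oo) (if (k <= m)%N then d k else 0) = \sum_(0 <= k < m.+1) d k)%E.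
  move=> d0; rewrite (nneseries_split 0 m.+1); last by move=> k _; case: ifPn.
  rewrite add0n [X in (_ + X)%E]eseries0 ?adde0; last first.
    by move=> k mk _; rewrite leqNgt mk.
  by apply: eq_big_nat => k /andP[_]; rewrite ltnS => ->.
rewrite !fin// big_nat_rev/=; apply: eq_big_nat => k _; first by rewrite add0n subSS.
Qed.

(** * Holmstedt's formula for sequences *)

Section holmstedt_sequences.
Context {R : realType}.
Local Open Scope ereal_scope.
Variables (p0 p1 s tau : R).
Hypotheses (hp0 : (1 <= p0)%R) (hp01 : (p0 < p1)%R) (hs : (0 < s)%R) (htau : (0 < tau)%R).

Let hp1 : (1 <= p1)%R. Proof. exact: le_trans (ltW hp01). Qed.
Let delta : R := (p0^-1 - p1^-1)%R.
Let delta0 : (0 < delta)%R.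
Proof.
by rewrite subr_gt0 ltf_pV2// posrE (lt_le_trans ltr01).
Qed.

Let N0 := rearr_norm_Leb (hp0 : 1 <= p0%:E).
Let N1 := rearr_norm_Leb (hp1 : 1 <= p1%:E).
Let Nsum := rearr_norm_Leb (lexx (1 : \bar R)).
Let Nsup := rearr_norm_Leb (leey (1 : \bar R)).

(** The inner norm of the small Lebesgue space, taken over (0, e^{-m}). *)
Definition smallA {I : Type} (phi : I -> nat -> \bar R) :=
  tail_disc (Leb p0%:E) (expw p0^-1) phi.
Definition smallI {I : Type} (phi : I -> nat -> \bar R) :=
  tail_disc (Leb 1%:E) (logw (s - 1)) (smallA phi).
(** What the outer norm over (e^{-m}, 1) contributes for a function supported on a set of measure
    e^{-m}: its inner norm is constant there, and the weights l^(s-1) add up to l^s. *)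
Definition smallJ {I : Type} (phi : I -> nat -> \bar R) := wseq (logw s) (smallA phi).
(** Only the inner L_{p1} norm of the grand Lebesgue space; the term D_m of the overview is
    [grandS]. *)
Definition grandD {I : Type} (phi : I -> nat -> \bar R) :=
  head_disc (Leb p1%:E) (expw p1^-1) phi.
Definition grandS {I : Type} (phi : I -> nat -> \bar R) :=
  head_disc (Leb +oo) (logw (- tau)) (grandD phi).
(** The value rho(e^{-m}) of the theorem once s = alpha/p0' and tau = beta/p1. *)
Definition rhos (m : nat) : R := (expw delta m * logw (s + tau) m)%R.
(* Equivalent to K(rho_m, f) when phi_k = f^*(e^{-k}). *)
Definition holm {I : Type} (phi : I -> nat -> \bar R) (i : I) (m : nat) :=
  smallI phi i m + smallJ phi i m + (rhos m)%:E * grandS phi i m.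
Definition norm0 {I : Type} (phi : I -> nat -> \bar R) (i : I) :=
  disc (Leb 1%:E) (wseq (logw (s - 1)) (smallA phi) i).
Definition norm1 {I : Type} (phi : I -> nat -> \bar R) (i : I) :=
  disc (Leb +oo) (wseq (logw (- tau)) (grandD phi) i).
(* The common size of the terms: omega_k bounds [smallJ] from below, omega_k / rho_k
   bounds [grandS] from below. *)
Definition omega {I : Type} (phi : I -> nat -> \bar R) :=
  wseq (fun k => logw s k * expw p0^-1 k)%R phi.
Definition omegar {I : Type} (phi : I -> nat -> \bar R) :=
  wseq (fun k => logw (- tau) k * expw p1^-1 k)%R phi.

Lemma rhos_gt0 m : (0 < rhos m)%R.
Proof. by rewrite mulr_gt0 ?expw_gt0 ?logw_gt0. Qed.

(** Half of the exponential decay is spent on the logarithmic factor (1 + n)^(s + tau), the other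
    half remains as the geometric rate delta / 2. *)
Lemma rhos_ratio : exists2 C : R, (0 < C)%R & forall m n,
  (rhos (m + n)%N <= C * expR (- (delta / 2 * n%:R)) * rhos m)%R.
Proof.
have d2 : (0 < delta / 2)%R by rewrite divr_gt0.
have [C C0 hC] := powR_le_expR (s + tau) d2; exists C => // m n.
have st0 : (0 <= s + tau)%R by rewrite addr_ge0// ltW.
rewrite /rhos expwD; have := logwDn m n st0; have := hC n.
rewrite -/(logw _ _) => h1 h2.
have e1 : (0 < expw delta n)%R := expw_gt0 _ _; have e2 : (0 < expw delta m)%R := expw_gt0 _ _.
have l1 : (0 < logw (s + tau) m)%R := logw_gt0 _ _.
apply: (@le_trans _ _ (expw delta m * expw delta n *
    (logw (s + tau) m * (C * expR (delta / 2 * n%:R))))%R).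
  rewrite ler_pM2l ?mulr_gt0//; apply: le_trans h2 _.
  by rewrite ler_pM2l.
rewrite le_eqVlt; apply/orP; left; apply/eqP.
have -> : expw delta n = (expR (- (delta / 2 * n%:R)) * expR (- (delta / 2 * n%:R)))%R.
  by rewrite /expw -expRD; congr expR; field.
have : (expR (- (delta / 2 * n%:R)) * expR (delta / 2 * n%:R) = 1)%R.
  by rewrite -expRD addNr expR0.
set E := expR (- _)%R; set G := expR _ => EG.
transitivity (E * (E * G) * C * expw delta m * logw (s + tau) m)%R; first by ring.
by rewrite EG; ring.
Qed.

Lemma rhos_ratio_ge m n : (expR (- (delta * n%:R)) * rhos m <= rhos (m + n)%N)%R.
Proof.
rewrite /rhos expwD -/(expw delta n) mulrA (mulrC (expw delta n)).
rewrite ler_pM2l ?mulr_gt0 ?expw_gt0//; apply: logw_le; last exact: leq_addr.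
by rewrite addr_ge0// ltW.
Qed.

Lemma omegaE {I} (phi : I -> nat -> \bar R) i k :
  omega phi i k = (rhos k)%:E * omegar phi i k.
Proof.
rewrite /omega /omegar /wseq muleA -EFinM; congr (_%:E * _).
have L : (logw (s + tau) k * logw (- tau) k = logw s k)%R by rewrite logwD addrK.
have W : (expw delta k * expw p1^-1 k = expw p0^-1 k)%R.
  by rewrite /expw -expRD; congr expR; rewrite /delta; ring.
by rewrite -L -W /rhos; ring.
Qed.

Lemma nns_smallA {I} (phi : I -> nat -> \bar R) : nns phi -> nns (smallA phi).
Proof. by move=> h; apply: nns_tail_disc => // k; exact: expw_gt0. Qed.

Lemma nns_smallI {I} (phi : I -> nat -> \bar R) : nns phi -> nns (smallI phi).
Proof.
move=> h; apply: nns_tail_disc => //; first by move=> k; exact: logw_gt0.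
exact: nns_smallA.
Qed.

Lemma nns_smallJ {I} (phi : I -> nat -> \bar R) : nns phi -> nns (smallJ phi).
Proof. by move=> h; apply: nns_wseq_pos; [move=> k; exact: logw_gt0|exact: nns_smallA]. Qed.

Lemma nns_grandD {I} (phi : I -> nat -> \bar R) : nns phi -> nns (grandD phi).
Proof. by move=> h; apply: nns_head_disc => // k; exact: expw_gt0. Qed.

Lemma nns_grandS {I} (phi : I -> nat -> \bar R) : nns phi -> nns (grandS phi).
Proof.
move=> h; apply: nns_head_disc => //; first by move=> k; exact: logw_gt0.
exact: nns_grandD.
Qed.

Lemma nns_rgrandS {I} (phi : I -> nat -> \bar R) : nns phi -> nns (wseq rhos (grandS phi)).
Proof. by move=> h; apply: nns_wseq_pos; [exact: rhos_gt0|exact: nns_grandS]. Qed.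

Lemma nns_omega {I} (phi : I -> nat -> \bar R) : nns phi -> nns (omega phi).
Proof.
by move=> h; apply: nns_wseq_pos => // k; rewrite mulr_gt0 ?expw_gt0 ?logw_gt0.
Qed.

Lemma nns_omegar {I} (phi : I -> nat -> \bar R) : nns phi -> nns (omegar phi).
Proof.
by move=> h; apply: nns_wseq_pos => // k; rewrite mulr_gt0 ?expw_gt0 ?logw_gt0.
Qed.

Lemma norm0_ge0 {I} (phi : I -> nat -> \bar R) i : nns phi -> 0 <= norm0 phi i.
Proof.
move=> h; apply: disc_ge0 => // k; apply: nns_wseq_pos; first by move=> ?; exact: logw_gt0.
exact: nns_smallA.
Qed.

Lemma norm1_ge0 {I} (phi : I -> nat -> \bar R) i : nns phi -> 0 <= norm1 phi i.
Proof.
move=> h; apply: disc_ge0 => // k; apply: nns_wseq_pos; first by move=> ?; exact: logw_gt0.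
exact: nns_grandD.
Qed.

(** The l^{p0} norm is replaced by the l^1 norm, and l^s, nondecreasing in the index, moves inside
    the series. *)
Lemma smallJ_le {I} (phi : I -> nat -> \bar R) : nns phi ->
  les (smallJ phi) (fun i m => \sum_(n <oo) omega phi i (m + n)%N).
Proof.
move=> h; apply: lesW => i m.
have w0 : forall k, (0 < expw p0^-1 k)%R by move=> k; exact: expw_gt0.
have t0 n : 0 <= wseq (expw p0^-1) phi i (n + m)%N by exact: nns_wseq_pos.
apply: (@le_trans _ _ ((logw s m)%:E * \sum_(n <oo) wseq (expw p0^-1) phi i (n + m)%N)).
  rewrite /smallJ /wseq lee_wpmul2l//; first by rewrite lee_fin ltW ?logw_gt0.
  by apply: le_trans (tail_disc_shift N0 w0 i m h) _; exact: disc_Leb_le_sum.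
rewrite -nneseriesZl//; apply: lee_nneseries => n _.
  by move=> _; rewrite mule_ge0// lee_fin ltW// logw_gt0.
rewrite /omega /wseq muleA -EFinM addnC lee_wpmul2r//; rewrite lee_fin ler_pM2r//.
by apply: logw_le; [exact: ltW|exact: leq_addr].
Qed.

Lemma smallI_le {I} (phi : I -> nat -> \bar R) : nns phi ->
  les (smallI phi) (fun i m => \sum_(n <oo) smallJ phi i (m + n)%N).
Proof.
move=> h; apply: lesW => i m; have a0 := nns_smallA h.
have w0 : forall k, (0 < logw (s - 1) k)%R by move=> k; exact: logw_gt0.
apply: le_trans (tail_disc_shift Nsum w0 i m a0) _.
rewrite disc_Leb1; last by move=> k; exact: nns_wseq_pos.
apply: lee_nneseries => n _; first by move=> _; exact: nns_wseq_pos.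
rewrite /smallJ /wseq addnC lee_wpmul2r// lee_fin.
by apply: ler_powR; rewrite ?lerDl// lerBlDr lerDl.
Qed.

(** Again l^{p1} is replaced by l^1. The factor l^{-tau} at j is at most its value at any k <= j, so
    it can be moved onto each summand. *)
Lemma grandS_le {I} (phi : I -> nat -> \bar R) : nns phi ->
  les (grandS phi) (fun i m => \sum_(n <oo) if (n <= m)%N then omegar phi i (m - n)%N else 0).
Proof.
move=> h; apply: lesW => i m; have o0 := nns_omegar h; have d0 := nns_grandD h.
rewrite -(nneseries_rev m (o0 i)).
have S0 : 0 <= \sum_(k <oo) (if (k <= m)%N then omegar phi i k else 0).
  by apply: nneseries_ge0 => k _ _; case: ifPn.
apply: disc_Leby_le => j; case: ifPn => [jm|_]; last by rewrite lexx S0.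
rewrite nns_wseq_pos//=; last by move=> ?; exact: logw_gt0.
have w0 : forall k, (0 < expw p1^-1 k)%R by move=> k; exact: expw_gt0.
have t0 k : 0 <= (if (k <= j)%N then wseq (expw p1^-1) phi i k else 0).
  by case: ifPn => // _; exact: nns_wseq_pos.
apply: (@le_trans _ _ ((logw (- tau) j)%:E *
    \sum_(k <oo) (if (k <= j)%N then wseq (expw p1^-1) phi i k else 0))).
  rewrite /wseq lee_wpmul2l ?lee_fin ?(ltW (logw_gt0 _ _))//.
  exact: disc_Leb_le_sum.
rewrite -nneseriesZl//; apply: lee_nneseries => k _.
  by move=> _; rewrite mule_ge0// lee_fin ltW// logw_gt0.
case: ifPn => [kj|_]; last by rewrite mule0; case: ifPn.
rewrite (leq_trans kj jm) /omegar /wseq muleA -EFinM lee_wpmul2r// lee_fin ler_pM2r//.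
by apply: logw_ge => //; rewrite oppr_le0 ltW.
Qed.

Lemma omega_le {I} (phi : I -> nat -> \bar R) : nns phi -> les (omega phi) (smallJ phi).
Proof.
move=> h; have w0 : forall k, (0 < expw p0^-1 k)%R by move=> k; exact: expw_gt0.
have [C C0 hC] := @tail_disc_ge_term _ _ N0 I _ w0; exists C => // i m.
rewrite /omega /smallJ /wseq EFinM -muleA [leRHS]muleCA lee_wpmul2l//.
  by rewrite lee_fin ltW// logw_gt0.
exact: hC.
Qed.

Lemma grandD_le {I} (phi : I -> nat -> \bar R) : nns phi ->
  les (wseq (logw (- tau)) (grandD phi)) (grandS phi).
Proof.
move=> h; have w0 : forall k, (0 < logw (- tau) k)%R by move=> k; exact: logw_gt0.
have [C C0 hC] := @head_disc_ge_term _ _ Nsup I _ w0; exists C => // i m.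
by apply: hC => //; exact: nns_grandD.
Qed.

Lemma omegar_le {I} (phi : I -> nat -> \bar R) : nns phi ->
  les (omegar phi) (wseq (logw (- tau)) (grandD phi)).
Proof.
move=> h; have w0 : forall k, (0 < expw p1^-1 k)%R by move=> k; exact: expw_gt0.
have [C C0 hC] := @head_disc_ge_term _ _ N1 I _ w0; exists C => // i m.
rewrite /omegar /wseq EFinM -muleA [leRHS]muleCA lee_wpmul2l//.
  by rewrite lee_fin ltW// logw_gt0.
exact: hC.
Qed.

(** The inner norms A_j decrease in j, so A_m times the sum of l^(s-1) over j <= m is part of
    [norm0]; by [sum_powR_ge] that sum is of order l^s. *)
Lemma smallJ_le_norm0 {I} (phi : I -> nat -> \bar R) : nns phi ->
  les (smallJ phi) (fun i _ => norm0 phi i).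
Proof.
move=> h; have [C C0 hC] := sum_powR_ge hs; exists C => // i m.
have a0 := nns_smallA h.
have w0 : forall k, (0 < expw p0^-1 k)%R by move=> k; exact: expw_gt0.
apply: (@le_trans _ _ (C%:E * \sum_(0 <= j < m.+1) (logw (s - 1) j)%:E * smallA phi i m)).
  rewrite -ge0_sume_distrl; last by move=> j _; rewrite lee_fin powR_ge0.
  by rewrite sumEFin muleA -EFinM lee_wpmul2r// lee_fin; exact: hC.
rewrite lee_wpmul2l ?lee_fin ?(ltW C0)//.
have wa0 : nns (wseq (logw (s - 1)) (smallA phi)).
  by apply: nns_wseq_pos => // k; exact: logw_gt0.
rewrite /norm0 disc_Leb1//; apply: le_trans (nneseries_lim_ge m.+1 _); last by [].
rewrite big_nat_cond [leRHS]big_nat_cond; apply: lee_sum => j; rewrite andbT => /andP[_ jm].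
rewrite /wseq lee_wpmul2l ?lee_fin ?powR_ge0//.
by apply: (tail_disc_nonincr N0 w0) => //.
Qed.

Lemma smallI_le_norm0 {I} (phi : I -> nat -> \bar R) : nns phi ->
  les (smallI phi) (fun i _ => norm0 phi i).
Proof.
move=> h; apply: lesW => i m.
have wa0 : nns (wseq (logw (s - 1)) (smallA phi)).
  by apply: nns_wseq_pos; [move=> k; exact: logw_gt0|exact: nns_smallA].
by apply: disc_mono => // k; case: ifPn => // _; exact: wa0.
Qed.

Lemma grandS_le_norm1 {I} (phi : I -> nat -> \bar R) : nns phi ->
  les (grandS phi) (fun i _ => norm1 phi i).
Proof.
move=> h; apply: lesW => i m.
have wa0 : nns (wseq (logw (- tau)) (grandD phi)).
  by apply: nns_wseq_pos; [move=> k; exact: logw_gt0|exact: nns_grandD].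
by apply: disc_mono => // k; case: ifPn => // _; exact: wa0.
Qed.

Let d20 : (0 < delta / 2)%R. Proof. by rewrite divr_gt0. Qed.

(** The sequence form of K(t, f) <= ||f||_{Y0}. In the grand term, rho_m times [omegar] at m - n is
    omega at m - n times rho_m / rho_{m-n}, which decays geometrically in n, and omega is below
    [norm0]. *)
Lemma holm_le_norm0 {I} (phi : I -> nat -> \bar R) : nns phi ->
  les (holm phi) (fun i _ => norm0 phi i).
Proof.
move=> h; apply: lesD; first apply: lesD.
- exact: smallI_le_norm0.
- exact: smallJ_le_norm0.
have [C C0 hC] := rhos_ratio.
have [D D0 hD] := les_trans (omega_le h) (smallJ_le_norm0 h).
have [B B0 hB] := grandS_le h.
have o0 := nns_omegar h.
pose t i m n := (rhos m)%:E * (if (n <= m)%N then omegar phi i (m - n)%N else 0).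
apply: (@les_geometric _ _ _ _ t _ (C * D) d20); rewrite ?mulr_gt0//.
- move=> i m n; rewrite mule_ge0 ?lee_fin ?(ltW (rhos_gt0 _))//.
  by case: ifPn => // _; exact: o0.
- by move=> i m; exact: norm0_ge0.
- exists B => // i m; rewrite /t nneseriesZl; last by move=> n _; case: ifPn => // _; exact: o0.
  rewrite [leRHS]muleCA lee_wpmul2l ?lee_fin ?(ltW (rhos_gt0 _))//; exact: hB.
- move=> i m n; rewrite /t; case: ifPn => [nm|_]; last first.
    by rewrite mule0 mule_ge0 ?norm0_ge0// lee_fin ltW// !mulr_gt0// expR_gt0.
  apply: (@le_trans _ _ ((C * expR (- (delta / 2 * n%:R)))%:E * omega phi i (m - n)%N)).
    rewrite omegaE [leRHS]muleA -EFinM; apply: lee_wpmul2r; first exact: o0.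
    by rewrite lee_fin -{1}(subnK nm).
  rewrite (mulrAC C) [in leRHS]EFinM -[leRHS]muleA lee_wpmul2l//.
  by rewrite lee_fin mulr_ge0 ?expR_ge0// ltW.
Qed.

(** The sequence form of K(t, f) <= t ||f||_{Y1}. Here omega at m + n is at most a constant times
    rho_{m+n} [norm1], with rho_{m+n} geometrically smaller than rho_m; this bounds J, and then I as
    a series of values of J. *)
Lemma holm_le_norm1 {I} (phi : I -> nat -> \bar R) : nns phi ->
  les (holm phi) (fun i m => (rhos m)%:E * norm1 phi i).
Proof.
move=> h; have o0 := nns_omegar h; have [C C0 hC] := rhos_ratio.
have z0 : nns (fun (i : I) m => (rhos m)%:E * norm1 phi i).
  by move=> i m; rewrite mule_ge0 ?norm1_ge0// lee_fin ltW// rhos_gt0.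
have dec i m n (z : \bar R) (B : R) : (0 <= B)%R -> 0 <= z ->
    z <= B%:E * ((rhos (m + n)%N)%:E * norm1 phi i) ->
    z <= (B * C * expR (- (delta / 2 * n%:R)))%:E * ((rhos m)%:E * norm1 phi i).
  move=> B0 zz0 zle; apply: le_trans zle _.
  rewrite -(mulrA B) [in leRHS]EFinM -[leRHS]muleA lee_wpmul2l// muleA -EFinM.
  by rewrite lee_wpmul2r ?norm1_ge0// lee_fin.
have HJ : les (smallJ phi) (fun i m => (rhos m)%:E * norm1 phi i).
  have [D D0 hD] := omegar_le h; have [B B0 hB] := disc_ge_term Nsup.
  apply: (@les_geometric _ _ _ _ (fun i m n => omega phi i (m + n)%N) _ (D * B * C) d20) => //.
  - by rewrite !mulr_gt0.
  - by move=> i m n; exact: nns_omega.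
  - exact: smallJ_le.
  move=> i m n; apply: dec; first by rewrite ltW// mulr_gt0.
    exact: nns_omega.
  rewrite omegaE [leRHS]muleCA lee_wpmul2l ?lee_fin ?(ltW (rhos_gt0 _))//.
  rewrite EFinM -muleA; apply: le_trans (hD i _) _.
  rewrite lee_wpmul2l ?lee_fin ?(ltW D0)//; apply: hB => k.
  by apply: nns_wseq_pos; [move=> ?; exact: logw_gt0|exact: nns_grandD].
apply: lesD; first apply: lesD => //.
- have [D D0 hD] := HJ.
  apply: (@les_geometric _ _ _ _ (fun i m n => smallJ phi i (m + n)%N) _ (D * C) d20) => //.
  + by rewrite !mulr_gt0.
  + by move=> i m n; exact: nns_smallJ.
  + exact: smallI_le.
  by move=> i m n; apply: dec; rewrite ?(ltW D0)//; exact: nns_smallJ.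
- have [D D0 hD] := grandS_le_norm1 h; exists D => // i m.
  by rewrite [leRHS]muleCA lee_wpmul2l ?lee_fin ?(ltW (rhos_gt0 _)).
Qed.

Lemma norm0_shift {I} (phi : I -> nat -> \bar R) : nns phi ->
  lec (norm0 (fun i k => phi i k.+1)) (norm0 phi).
Proof.
move=> h; have w0 k : (0 < expw p0^-1 k)%R by exact: expw_gt0.
have l0 k : (0 < logw (s - 1) k)%R by exact: logw_gt0.
have h1 : nns (fun i k => phi i k.+1) by move=> i k; exact: h.
have [C C0 hC] : exists2 C : R, (0 < C)%R & forall k, comparable_by C (expw p0^-1 k) (expw p0^-1 k.+1).
  exact: (adm_succ (adm_expw _)).
apply: (lec_disc Nsum); try (by apply: nns_wseq_pos => //; exact: nns_smallA).
exists C => // i m; rewrite /wseq [leRHS]muleCA lee_wpmul2l ?lee_fin ?(ltW (l0 _))//.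
have t0 k : 0 <= (if (m <= k)%N then wseq (expw p0^-1) phi i k else 0).
  by case: ifPn => // _; exact: nns_wseq_pos.
apply: (@le_trans _ _ (C%:E * disc (Leb p0%:E)
    (fun k => if (m <= k.+1)%N then wseq (expw p0^-1) phi i k.+1 else 0))).
  rewrite -disc_scale//; last by rewrite ltW.
  apply: disc_mono => // k; first by case: ifPn => // _; exact: nns_wseq_pos.
  case: ifPn => [mk|_].
    by rewrite (leq_trans mk)// /wseq muleA -EFinM lee_wpmul2r// lee_fin; have [] := hC k.
  by case: ifPn => _; rewrite mule_ge0 ?lee_fin ?(ltW C0)//; exact: nns_wseq_pos.
rewrite lee_wpmul2l ?lee_fin ?(ltW C0)//; have := disc_shiftl N0 1 t0.
by under [X in disc _ X]eq_fun do rewrite addn1.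
Qed.

Lemma norm1_shift {I} (phi : I -> nat -> \bar R) : nns phi ->
  lec (norm1 (fun i k => phi i k.+1)) (norm1 phi).
Proof.
move=> h; have w0 k : (0 < expw p1^-1 k)%R by exact: expw_gt0.
have l0 k : (0 < logw (- tau) k)%R by exact: logw_gt0.
have h1 : nns (fun i k => phi i k.+1) by move=> i k; exact: h.
have [C C0 hC] : exists2 C : R, (0 < C)%R & forall k, comparable_by C (expw p1^-1 k) (expw p1^-1 k.+1).
  exact: (adm_succ (adm_expw _)).
have [D D0 hD] : exists2 C : R, (0 < C)%R & forall k, comparable_by C (logw (- tau) k) (logw (- tau) k.+1).
  exact: (adm_succ (adm_logw _)).
have dd : les (grandD (fun i k => phi i k.+1)) (fun i m => grandD phi i m.+1).
  exists C => // i m.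
  have t0 k : 0 <= (if (k <= m.+1)%N then wseq (expw p1^-1) phi i k else 0).
    by case: ifPn => // _; exact: nns_wseq_pos.
  apply: (@le_trans _ _ (C%:E * disc (Leb p1%:E)
      (fun k => if (k.+1 <= m.+1)%N then wseq (expw p1^-1) phi i k.+1 else 0))).
    rewrite -disc_scale//; last by rewrite ltW.
    apply: disc_mono => // k; first by case: ifPn => // _; exact: nns_wseq_pos.
    rewrite ltnS; case: ifPn => mk; last by rewrite mule0.
    by rewrite /wseq muleA -EFinM lee_wpmul2r// lee_fin; have [] := hC k.
  rewrite lee_wpmul2l ?lee_fin ?(ltW C0)//; have := disc_shiftl N1 1 t0.
  by under [X in disc _ X]eq_fun do rewrite addn1.
have wd0 : nns (wseq (logw (- tau)) (grandD phi)).
  by apply: nns_wseq_pos => //; exact: nns_grandD.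
apply: (@lec_trans _ _ (fun i => disc (Leb +oo) (fun k => wseq (logw (- tau)) (grandD phi) i k.+1))).
  apply: (lec_disc Nsup (y := fun i k => wseq (logw (- tau)) (grandD phi) i k.+1)).
  - by apply: nns_wseq_pos => //; exact: nns_grandD.
  - by move=> i k; exact: wd0.
  have [B B0 hB] := dd; exists (D * B)%R => [|i k]; first exact: mulr_gt0.
  apply: lee_mulC => //; first exact: ltW.
    exact: nns_grandD.
  by have [] := hD k.
apply: lecW => i; have := disc_shiftl Nsup 1 (wd0 i).
by under [X in disc _ X]eq_fun do rewrite addn1.
Qed.

Lemma holmD {I} (phi psi0 psi1 : I -> nat -> \bar R) : nns phi -> nns psi0 -> nns psi1 ->
  (forall i k, phi i k <= psi0 i k + psi1 i k) ->
  forall i m, holm phi i m <= holm psi0 i m + holm psi1 i m.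
Proof.
move=> h h0 h1 H i m.
have w0 k : (0 < expw p0^-1 k)%R by exact: expw_gt0.
have w1 k : (0 < expw p1^-1 k)%R by exact: expw_gt0.
have l0 (e : R) k : (0 < logw e k)%R by exact: logw_gt0.
have A j : smallA phi i j <= smallA psi0 i j + smallA psi1 i j.
  by apply: (tail_discD N0 w0) => // k; exact: H.
have D j : grandD phi i j <= grandD psi0 i j + grandD psi1 i j.
  by apply: (head_discD N1 w1) => // k; exact: H.
have a n0 := @nns_smallA I n0; have d n0 := @nns_grandD I n0.
have HI : smallI phi i m <= smallI psi0 i m + smallI psi1 i m.
  by apply: (tail_discD Nsum (l0 _)); [exact: a|exact: a|exact: a|exact: A].
have HS : grandS phi i m <= grandS psi0 i m + grandS psi1 i m.
  by apply: (head_discD Nsup (l0 _)); [exact: d|exact: d|exact: d|exact: D].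
have HJ : smallJ phi i m <= smallJ psi0 i m + smallJ psi1 i m.
  rewrite /smallJ /wseq -ge0_muleDr; [|exact: a|exact: a].
  by rewrite lee_wpmul2l// lee_fin ltW.
rewrite /holm addeACA; apply: leeD.
  by rewrite addeACA; apply: leeD.
rewrite -ge0_muleDr; [|exact: nns_grandS|exact: nns_grandS].
by rewrite lee_wpmul2l// lee_fin ltW// rhos_gt0.
Qed.

(** The lower bound for K: subadditivity of each term, then one endpoint estimate for each part. The
    index k.+1 reflects the halved argument in the rearrangement of a sum, and [norm0_shift] and
    [norm1_shift] undo it. *)
Lemma holm_lower {I} (phi phi0 phi1 : I -> nat -> \bar R) : nns phi -> nns phi0 -> nns phi1 ->
  (forall i k, phi i k <= phi0 i k.+1 + phi1 i k.+1) ->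
  les (holm phi) (fun i m => norm0 phi0 i + (rhos m)%:E * norm1 phi1 i).
Proof.
move=> h h0 h1 H.
have h0' : nns (fun i k => phi0 i k.+1) by move=> i k; exact: h0.
have h1' : nns (fun i k => phi1 i k.+1) by move=> i k; exact: h1.
have r0 m : 0 <= (rhos m)%:E :> \bar R by rewrite lee_fin ltW// rhos_gt0.
apply: (@les_trans _ _ (fun i m => holm (fun i k => phi0 i k.+1) i m + holm (fun i k => phi1 i k.+1) i m)).
  by apply: lesW; apply: holmD.
apply: lesD.
  apply: les_trans (holm_le_norm0 h0') _; have [C C0 hC] := norm0_shift h0.
  exists C => // i m; apply: le_trans (hC i) _.
  rewrite lee_wpmul2l ?lee_fin ?(ltW C0)// leeDl// mule_ge0//; exact: norm1_ge0.
apply: les_trans (holm_le_norm1 h1') _; have [C C0 hC] := norm1_shift h1.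
exists C => // i m; rewrite ge0_muleDr ?mule_ge0 ?norm0_ge0 ?norm1_ge0//.
rewrite [X in _ + X]muleCA; apply: (@le_trans _ _ ((rhos m)%:E * (C%:E * norm1 phi1 i))).
  by rewrite lee_wpmul2l.
by rewrite leeDr// mule_ge0 ?norm0_ge0// lee_fin ltW.
Qed.

(** For l >= m the terms make up I. For l < m the tail of [phi0] from l is only its tail from m, so
    A_m is multiplied by the sum of l^(s-1) over l < m, which gives J. *)
Lemma norm0_trunc {I} (phi phi0 : I -> nat -> \bar R) (m : I -> nat) : nns phi -> nns phi0 ->
  (forall i k, phi0 i k <= (if (m i <= k)%N then phi i k else 0)) ->
  lec (norm0 phi0) (fun i => smallI phi i (m i) + smallJ phi i (m i)).
Proof.
move=> h h0 H; have [C C0 hC] := sum_powR_le hs.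
have w0 k : (0 < expw p0^-1 k)%R by exact: expw_gt0.
have l0 (e : R) k : (0 < logw e k)%R by exact: logw_gt0.
have a := nns_smallA h.
exists (1 + C)%R => [|i]; first by rewrite addr_gt0.
have IJ0 : 0 <= smallI phi i (m i) + smallJ phi i (m i).
  by rewrite adde_ge0 ?nns_smallI ?nns_smallJ.
pose c1 l := if (m i <= l)%N then wseq (logw (s - 1)) (smallA phi) i l else 0.
pose c2 l := if (l < m i)%N then (logw (s - 1) l)%:E * smallA phi i (m i) else 0.
have c10 l : 0 <= c1 l by rewrite /c1; case: ifPn => // _; exact: nns_wseq_pos.
have c20 l : 0 <= c2 l.
  by rewrite /c2; case: ifPn => // _; rewrite mule_ge0 ?a// lee_fin ltW.
apply: (@le_trans _ _ (disc (Leb 1%:E) c1 + disc (Leb 1%:E) c2)).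
  apply: le_trans (disc_triangle Nsum c10 c20); apply: disc_mono => // l.
    by apply: nns_wseq_pos => //; exact: nns_smallA.
  rewrite /c1 /c2; case: (leqP (m i) l) => ml; rewrite ?adde0 ?add0e /wseq;
    rewrite lee_wpmul2l ?lee_fin ?(ltW (l0 _ _))//.
  - apply: (le_tail_disc N0 w0) => // k lk; have := H i k.
    by rewrite (leq_trans ml lk) lk.
  - by apply: (le_tail_disc N0 w0) => // k lk; exact: H.
rewrite EFinD ge0_muleDl ?lee_fin ?(ltW C0)// mul1e; apply: leeD.
  by rewrite leeDl// nns_smallJ.
have -> : disc (Leb 1%:E) c2 = (\sum_(0 <= l < m i) logw (s - 1) l)%:E * smallA phi i (m i).
  rewrite disc_Leb1// (nneseries_split 0 (m i)) ?add0n//.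
  rewrite [X in (_ + X)]eseries0 ?adde0; last first.
    by move=> k mk _; rewrite /c2 ltnNge mk.
  rewrite -sumEFin ge0_sume_distrl; last by move=> j _; rewrite lee_fin ltW.
  by apply: eq_big_nat => k /andP[_ km]; rewrite /c2 km.
apply: (@le_trans _ _ (C%:E * smallJ phi i (m i))).
  by rewrite /smallJ /wseq muleA -EFinM lee_wpmul2r ?a// lee_fin; exact: hC.
by rewrite lee_wpmul2l ?lee_fin ?(ltW C0)// leeDr// nns_smallI.
Qed.

(** Beyond m the sequence stays below phi_m, and the weights e^{-k/p1} sum geometrically to the
    order of their value at m, so heads longer than m gain only a constant. The factor l^{-tau} is
    largest at the shorter head. *)
Lemma norm1_trunc {I} (phi phi1 : I -> nat -> \bar R) (m : I -> nat) : nns phi -> nns phi1 ->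
  (forall i k, phi1 i k <= phi i (minn k (m i))) ->
  lec (norm1 phi1) (fun i => grandS phi i (m i)).
Proof.
move=> h h1 H.
have w1 k : (0 < expw p1^-1 k)%R by exact: expw_gt0.
have l0 (e : R) k : (0 < logw e k)%R by exact: logw_gt0.
have p10 : (0 < p1^-1)%R by rewrite invr_gt0 (lt_le_trans ltr01).
have [G G0 hG] := nneseries_geometric_mul p10.
have [B B0 hB] := @head_disc_ge_term _ _ N1 I _ w1.
have D i l : grandD phi1 i l <= (1 + G * B)%:E * grandD phi i (minn l (m i)).
  have dm0 : 0 <= grandD phi i (minn l (m i)) by exact: nns_grandD.
  rewrite EFinD ge0_muleDl ?lee_fin ?mulr_ge0 ?(ltW G0) ?(ltW B0)// mul1e.
  (* The constant sequence phi_m bounding [phi1] beyond m; [c1] covers the indices up to min(l, m),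
     [c2] the remaining ones. *)
  pose x (_ : I) (_ : nat) := phi i (m i).
  have x0 : nns x by move=> ? ?; exact: h.
  pose c1 k := if (k <= minn l (m i))%N then wseq (expw p1^-1) phi i k else 0.
  pose c2 k := if (minn l (m i) < l)%N && (m i <= k)%N then wseq (expw p1^-1) x i k else 0.
  have c10 k : 0 <= c1 k by rewrite /c1; case: ifPn => // _; exact: nns_wseq_pos.
  have c20 k : 0 <= c2 k by rewrite /c2; case: ifPn => // _; exact: nns_wseq_pos.
  apply: (@le_trans _ _ (disc (Leb p1%:E) c1 + disc (Leb p1%:E) c2)).
    apply: le_trans (disc_triangle N1 c10 c20); apply: disc_mono => // k.
      by case: ifPn => // _; exact: nns_wseq_pos.
    case: ifPn => [kl|_]; last by rewrite adde_ge0.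
    have Hk := H i k; have [km|km] := leqP k (m i).
      have -> : c1 k = wseq (expw p1^-1) phi i k by rewrite /c1 leq_min kl km.
      rewrite -[leLHS]adde0 leeD// /wseq lee_wpmul2l ?lee_fin ?(ltW (w1 _))//.
      by move: Hk; rewrite (minn_idPl km).
    have ml : (minn l (m i) < l)%N by rewrite gtn_min ltnn/= (leq_trans km kl).
    have -> : c2 k = wseq (expw p1^-1) x i k by rewrite /c2 ml (ltnW km).
    rewrite -[leLHS]add0e leeD// /wseq lee_wpmul2l ?lee_fin ?(ltW (w1 _))//.
    by move: Hk; rewrite (minn_idPr (ltnW km)).
  apply: leeD => //; rewrite /c2; case: (ltnP (minn l (m i)) l) => ml /=; last first.
    rewrite disc0//; by rewrite mule_ge0// lee_fin mulr_ge0// ltW.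
  have mE : minn l (m i) = m i.
    by apply/minn_idPr; move: ml; rewrite gtn_min ltnn/= => /ltnW.
  rewrite mE; apply: le_trans (tail_disc_shift N1 w1 i (m i) x0) _.
  apply: (@le_trans _ _ (\sum_(n <oo) (expR (- (p1^-1 * n%:R)))%:E * wseq (expw p1^-1) phi i (m i))).
    apply: le_trans (disc_Leb_le_sum hp1 _) _; first by move=> k; exact: nns_wseq_pos.
    rewrite le_eqVlt; apply/orP; left; apply/eqP; apply: eq_eseriesr => n _.
    by rewrite /wseq expwD EFinM muleA.
  apply: le_trans (hG _ _) _; first exact: nns_wseq_pos.
  by rewrite EFinM -muleA lee_wpmul2l ?lee_fin ?(ltW G0)//; exact: hB.
have [A A0 hA] := grandD_le h.
exists ((1 + G * B) * A)%R => [|i]; first by rewrite mulr_gt0// addr_gt0// mulr_gt0.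
have GB0 : (0 <= 1 + G * B)%R by rewrite addr_ge0// mulr_ge0// ltW.
apply: disc_Leby_le => l; rewrite nns_wseq_pos//=; last exact: nns_grandD.
set n := minn l (m i).
apply: (@le_trans _ _ ((1 + G * B)%:E * wseq (logw (- tau)) (grandD phi) i n)).
  rewrite /wseq [leRHS]muleCA; apply: lee_pmul => //; rewrite ?lee_fin ?(ltW (l0 _ _))//.
    exact: nns_grandD.
  by apply: logw_ge; rewrite ?oppr_le0 ?(ltW htau)// geq_minl.
rewrite EFinM -muleA lee_wpmul2l ?lee_fin//; apply: le_trans (hA i n) _.
rewrite lee_wpmul2l ?lee_fin ?(ltW A0)//.
apply: (head_disc_nondecr Nsup (adm_logw (- tau)) (nns_grandD h)).
exact: geq_minr.
Qed.

End holmstedt_sequences.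

(** * Slowly varying weights and change of scale *)

Section slowly_varying.
Context {R : realType}.
Variable b : R -> R.
Hypothesis hb : SV01 b.

Lemma ext1_gt0 s : 0 < s -> 0 < ext1 b s.
Proof. by move=> s0; rewrite /ext1; case: (ltP s 1) => // s1; apply: (SV_gt0 hb); rewrite s0. Qed.

(** Almost monotonicity of t^e b bounds b(s) by b(t), that of t^{-e} b bounds b(t) by b(s); the sum
    of the two constants serves both. *)
Let potter01 (e : R) : 0 < e -> exists2 C : R, 0 < C & forall s t, 0 < s -> s <= t -> t < 1 ->
  b s <= C * (t / s) `^ e * b t /\ b t <= C * (t / s) `^ e * b s.
Proof.
move=> e0; have [phi phinc [c1 [C1 [c10 C10 h1]]]] := SV_incr hb e0.
have [psi psidec [c2 [C2 [c20 C20 h2]]]] := SV_decr hb e0.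
exists (C1 / c1 + C2 / c2); first by rewrite addr_gt0// divr_gt0.
move=> s t s0 st t1; have t0 := lt_le_trans s0 st; have s1 := le_lt_trans st t1.
have Ds : `]0, 1[%classic s by rewrite /= in_itv/= s0.
have Dt : `]0, 1[%classic t by rewrite /= in_itv/= t0.
have bs : 0 < b s by apply: (SV_gt0 hb); rewrite s0.
have bt : 0 < b t by apply: (SV_gt0 hb); rewrite t0.
have tsE : (t / s) `^ e = t `^ e / s `^ e.
  rewrite powRM ?invr_ge0 ?(ltW s0) ?(ltW t0)//; congr (_ * _).
  by rewrite -(powR_inv1 (ltW s0)) -powRrM mulN1r powRN.
have te : 0 < t `^ e by exact: powR_gt0.
have se : 0 < s `^ e by exact: powR_gt0.
have q1 : 0 < C1 / c1 by exact: divr_gt0.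
have q2 : 0 < C2 / c2 by exact: divr_gt0.
have ts0 : 0 <= (t / s) `^ e by exact: powR_ge0.
have := phinc s t Ds Dt st; have := psidec s t Ds Dt st.
have /andP[a1 a2] := h1 s Ds; have /andP[a3 a4] := h1 t Dt.
have /andP[a5 a6] := h2 s Ds; have /andP[a7 a8] := h2 t Dt => psts phst.
split.
  apply: (@le_trans _ _ (C1 / c1 * (t / s) `^ e * b t)); last first.
    by rewrite ler_wpM2r ?(ltW bt)// ler_wpM2r// lerDl ltW.
  have : s `^ e * b s <= C1 / c1 * (t `^ e * b t).
    apply: le_trans a2 _; rewrite -mulrA ler_pM2l// ler_pdivlMl//.
    by apply: le_trans a3; rewrite ler_pM2l.
  by rewrite tsE -ler_pdivlMl// => /le_trans; apply; rewrite le_eqVlt; apply/orP; left; apply/eqP; ring.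
apply: (@le_trans _ _ (C2 / c2 * (t / s) `^ e * b s)); last first.
  by rewrite ler_wpM2r ?(ltW bs)// ler_wpM2r// lerDr ltW.
have : t `^ (- e) * b t <= C2 / c2 * (s `^ (- e) * b s).
  apply: le_trans a8 _; rewrite -mulrA ler_pM2l// ler_pdivlMl//.
  by apply: le_trans a5; rewrite ler_pM2l.
rewrite !powRN ler_pdivrMl// => /le_trans; apply.
by rewrite tsE le_eqVlt; apply/orP; left; apply/eqP; ring.
Qed.

Lemma potter (e : R) : 0 < e -> exists2 C : R, 0 < C & forall s t, 0 < s -> s <= t ->
  ext1 b s <= C * (t / s) `^ e * ext1 b t /\ ext1 b t <= C * (t / s) `^ e * ext1 b s.
Proof.
move=> e0; have [K K0 hK] := potter01 e0.
pose h : R := 2^-1; have h0 : 0 < h by rewrite invr_gt0.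
have h1 : h < 1 by rewrite invf_lt1// ltr1n.
have bh : 0 < b h by apply: (SV_gt0 hb); rewrite h0.
(* K 2^e is the cost of passing through 1/2; b(1/2) and its inverse compare b(1/2) with the value 1
   of the extension, in either direction. *)
pose M := K * 2 `^ e * (b h + (b h)^-1).
have p2 : 0 < 2 `^ e :> R by exact: powR_gt0.
have M0 : 0 < M by rewrite !mulr_gt0// addr_gt0// invr_gt0.
(* For s < 1 <= t, the value at s is compared with the value at 1/2. *)
have mid s t : 0 < s -> s < 1 -> 1 <= t ->
    b s <= M * (t / s) `^ e /\ 1 <= M * (t / s) `^ e * b s.
  move=> s0 s1 t1; have bs : 0 < b s by apply: (SV_gt0 hb); rewrite s0.
  have ts1 : 1 <= t / s by rewrite ler_pdivlMr// mul1r (le_trans (ltW s1)).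
  have [r r1 [r2 r3]] : exists2 r : R, r <= 2 `^ e * (t / s) `^ e &
      b s <= K * r * b h /\ b h <= K * r * b s.
    have [sh|hs] := leP s h.
      exists ((h / s) `^ e); last exact: hK.
      rewrite -powRM ?(le_trans ler01 ts1)//; apply: ge0_ler_powR; rewrite ?nnegrE ?(ltW e0)//.
      - by rewrite divr_ge0// ltW.
      - by rewrite mulr_ge0// (le_trans ler01 ts1).
      - apply: (@le_trans _ _ (t / s)); last by rewrite ler_peMl ?(le_trans ler01 ts1)// ler1n.
        by rewrite ler_pM2r ?invr_gt0// (le_trans (ltW h1)).
    exists ((s / h) `^ e); last by have [a c] := hK h s h0 (ltW hs) s1.
    rewrite -powRM ?(le_trans ler01 ts1)//; apply: ge0_ler_powR; rewrite ?nnegrE ?(ltW e0)//.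
    - by rewrite divr_ge0// ltW.
    - by rewrite mulr_ge0// (le_trans ler01 ts1).
    - rewrite /h invrK mulrC ler_pM2l//; exact: le_trans (ltW s1) ts1.
  have ib : 0 < (b h)^-1 by rewrite invr_gt0.
  have P0 : 0 <= 2 `^ e * (t / s) `^ e by rewrite mulr_ge0 ?powR_ge0.
  split.
    apply: (le_trans r2); apply: (@le_trans _ _ (K * (2 `^ e * (t / s) `^ e) * b h)).
      by rewrite ler_pM2r// ler_pM2l.
    rewrite /M -!mulrA ler_pM2l// ler_pM2l// mulrC ler_wpM2r ?powR_ge0//.
    by rewrite lerDl ltW.
  have : 1 <= (b h)^-1 * (K * (2 `^ e * (t / s) `^ e) * b s).
    rewrite ler_pdivlMl// mulr1; apply: (le_trans r3).
    by rewrite ler_pM2r// ler_pM2l.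
  move/le_trans; apply.
  rewrite (_ : M * _ * _ = (b h + (b h)^-1) * (K * (2 `^ e * (t / s) `^ e) * b s)); last by rewrite /M; ring.
  rewrite ler_wpM2r//; first by rewrite mulr_ge0 ?(ltW bs)// mulr_ge0// ltW.
  by rewrite lerDr ltW.
exists (K + M + 1); first by rewrite !addr_gt0.
move=> s t s0 st; have t0 := lt_le_trans s0 st.
have ts1 : 1 <= (t / s) `^ e.
  rewrite -(powRr0 (t / s)); apply: ler_powR; last exact: ltW.
  by rewrite ler_pdivlMr// mul1r.
have ts0 := le_trans ler01 ts1.
have up (x A B z : R) : 0 <= z -> 0 <= B -> x <= A * (t / s) `^ e * z -> x <= (A + B) * (t / s) `^ e * z.
  move=> z0 B0 /le_trans; apply; rewrite ler_wpM2r// ler_wpM2r// lerDl//.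
rewrite /ext1; case: (ltP t 1) => t1.
  have s1 := le_lt_trans st t1; rewrite s1.
  have bs : 0 < b s by apply: (SV_gt0 hb); rewrite s0.
  have bt : 0 < b t by apply: (SV_gt0 hb); rewrite t0.
  have [a c] := hK s t s0 st t1.
  by rewrite -addrA; split; apply: up; rewrite ?(ltW bs) ?(ltW bt) ?addr_ge0 ?(ltW M0).
case: (ltP s 1) => s1.
  have bs : 0 < b s by apply: (SV_gt0 hb); rewrite s0.
  have [a c] := mid s t s0 s1 t1.
  rewrite (addrC K) -addrA; split; apply: up; rewrite ?(ltW bs) ?addr_ge0 ?(ltW K0)//.
  by rewrite mulr1.
have : 1 <= (K + M + 1) * (t / s) `^ e.
  rewrite -[leLHS]mulr1; apply: ler_pM => //.
  by rewrite lerDr addr_ge0// ltW.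
by rewrite mulr1.
Qed.

Lemma ext1_comparable (C : R) : 0 < C -> exists2 D : R, 0 < D &
  forall s t, 0 < s -> 0 < t -> comparable_by C s t -> comparable_by D (ext1 b s) (ext1 b t).
Proof.
move=> C0; have [K K0 hK] := potter ltr01; exists (K * C); first exact: mulr_gt0.
have H s t : 0 < s -> s <= t -> t <= C * s -> comparable_by (K * C) (ext1 b s) (ext1 b t).
  move=> s0 st ts; have [h1 h2] := hK s t s0 st; have t0 := lt_le_trans s0 st.
  rewrite powRr1 ?divr_ge0 ?(ltW s0) ?(ltW t0)// in h1 h2.
  have tsC : t / s <= C by rewrite ler_pdivrMr.
  split; [apply: (le_trans h1)|apply: (le_trans h2)]; rewrite ler_wpM2r ?ler_pM2l//;
    by apply/ltW/ext1_gt0.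
move=> s t s0 t0 [h1 h2]; have [st|ts] := leP s t; first exact: H.
by have [a c] := H t s t0 (ltW ts) h1.
Qed.

Lemma adm_ext1 (r : R -> R) rs : adm r rs ->
  adm (fun t => ext1 b (r t)) (fun k => ext1 b (rs k)).
Proof.
move=> hr; have [r0 [C C0 hC] [D D0 hD]] := hr; split.
- by move=> k; exact: ext1_gt0.
- have [A A0 hA] := ext1_comparable C0; exists A => // k t kt.
  by apply: hA => //; [exact: adm_pos hr kt|exact: hC].
- have [A A0 hA] := ext1_comparable D0; exists A => // k.
  by apply: hA => //; exact: hD.
Qed.

End slowly_varying.

(** * Change of scale between e^{-n} and rho_n *)

Section reparametrization.
Context {R : realType}.
Variable (E : (R -> \bar R) -> \bar R).
Hypothesis hE : rearr_norm E.
Variables (I : Type) (Gam : I -> R -> \bar R).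
Hypothesis Gam0 : forall i t, 0 < t -> (0 <= Gam i t)%E.
Hypothesis Gam_dbl : forall C : R, 0 < C -> exists2 D : R, 0 < D & forall i s t,
  0 < s -> 0 < t -> comparable_by C s t -> (Gam i s <= D%:E * Gam i t)%E.

Lemma lec_disc_reparam (A B : nat -> R) (sg : nat -> nat) (N : nat) (C : R) :
  0 < C -> (forall n, 0 < A n) -> (forall n, 0 < B n) ->
  (forall n, comparable_by C (A n) (B (sg n))) ->
  (forall i j, sg i = sg j -> (i < j + N)%N) ->
  lec (fun i => disc E (fun n => Gam i (A n))) (fun i => disc E (fun n => Gam i (B n))).
Proof.
move=> C0 A0 B0 AB sN; have [D D0 hD] := Gam_dbl C0.
have N0 : (0 < N)%N by have := sN 0%N 0%N erefl.
exists (D * N%:R) => [|i]; first by rewrite mulr_gt0// ltr0n.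
have GB k : (0 <= Gam i (B k))%E by exact: Gam0.
rewrite EFinM -muleA; apply: (@le_trans _ _ (D%:E * disc E ((fun n => Gam i (B n)) \o sg))%E).
  rewrite -disc_scale; [|by []|exact: ltW|by move=> k; exact: Gam0].
  by apply: disc_mono => // n; [exact: Gam0|exact: hD].
by rewrite lee_wpmul2l ?lee_fin ?(ltW D0)//; exact: disc_comp.
Qed.

Variables (q : nat -> R) (d c : R).
Hypotheses (d0 : 0 < d) (c0 : 0 <= c) (q0 : q 0%N = 0) (qS : forall m, q m.+1 <= q m + d)
  (qD : forall m n, q m + d / 2 * n%:R - c <= q (m + n)%N).

Let comparable_expR (x y k : R) : `|x - y| <= k ->
  comparable_by (expR k) (expR (- x)) (expR (- y)).
Proof.
by rewrite ler_norml => /andP[h1 h2]; split; rewrite -expRD ler_expR; lra.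
Qed.

Lemma lec_disc_expR : lec (fun i => disc E (fun n => Gam i (expR (- n%:R))))
  (fun i => disc E (fun n => Gam i (expR (- q n)))).
Proof.
(* Take the least m with n <= q m. As q grows by at most d per step, it overshoots n by at most
   d. *)
have ex n : exists m, `|n%:R - q m| <= d.
  have ub : exists m, n%:R <= q m.
    pose m := (Num.truncn ((n%:R + c) / (d / 2))).+1; exists m.
    have := qD 0%N m; rewrite add0n q0 add0r.
    have d20 : 0 < d / 2 by rewrite divr_gt0.
    have := truncnS_gt ((n%:R + c) / (d / 2)); rewrite -/m ltr_pdivrMr// mulrC; lra.
  case: (ex_minnP ub) => -[|m] hm mmin; [exists 0%N|exists m.+1].
    move: hm; rewrite q0 => hm; have := ler0n R n => n0.
    rewrite subr0 ger0_norm//; exact: le_trans hm (ltW d0).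
  have qm : q m < n%:R.
    by rewrite ltNge; apply/negP => /mmin; rewrite ltnn.
  by have := qS m; rewrite ler_norml => h; apply/andP; split; lra.
have [sg hsg] := choice ex.
(* Integers sent to the same m lie within d of q m, hence within 2d of each other. *)
apply: (@lec_disc_reparam _ _ sg (Num.truncn (2 * d)).+1 (expR d)).
- exact: expR_gt0.
- by move=> n; exact: expR_gt0.
- by move=> n; exact: expR_gt0.
- by move=> n; apply: comparable_expR; exact: hsg.
move=> i j sij; have := hsg i; have := hsg j; rewrite sij !ler_norml => /andP[a1 a2] /andP[a3 a4].
rewrite -(ltr_nat R) natrD; have := truncnS_gt (2 * d); lra.
Qed.

Lemma lec_expR_disc : lec (fun i => disc E (fun n => Gam i (expR (- q n))))
  (fun i => disc E (fun n => Gam i (expR (- n%:R)))).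
Proof.
(* Since q m >= -c, the integer 0 is close enough when q m is negative; otherwise the integer part
   of q m is. *)
have ex m : exists n, `|q m - n%:R| <= c + 1.
  have [qm|qm] := leP 0 (q m).
    exists (Num.truncn (q m)); have /andP[h1 h2] := truncn_itv qm.
    rewrite ger0_norm ?subr_ge0// lerBlDl; apply: le_trans (ltW h2) _.
    by rewrite -natr1 lerD2l lerDr.
  exists 0%N; have := qD 0%N m; rewrite add0n q0 add0r.
  have : 0 <= d / 2 * m%:R by rewrite mulr_ge0// divr_ge0// ltW.
  by rewrite subr0 ler_norml => h1 h2; apply/andP; split; lra.
have [sg hsg] := choice ex.
(* Indices with the same image have values of q within 2 (c + 1); growth at rate d / 2 up to the
   error c then bounds their distance by K. *)
pose K := (2 * (c + 1) + c) / (d / 2); have d20 : 0 < d / 2 by rewrite divr_gt0.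
have K0 : 0 <= K by rewrite divr_ge0 ?(ltW d20)// !addr_ge0// mulr_ge0// addr_ge0.
apply: (@lec_disc_reparam _ _ sg (Num.truncn K).+1 (expR (c + 1))).
- exact: expR_gt0.
- by move=> n; exact: expR_gt0.
- by move=> n; exact: expR_gt0.
- by move=> n; apply: comparable_expR; exact: hsg.
move=> i j sij; have [ij|ji] := leqP i j; first by rewrite addnS ltnS (leq_trans ij)// leq_addr.
have := hsg i; have := hsg j; rewrite sij !ler_norml => /andP[a1 a2] /andP[a3 a4].
have := qD j (i - j)%N; rewrite (subnKC (ltnW ji)) => h.
have : (d / 2) * (i - j)%:R <= 2 * (c + 1) + c by lra.
rewrite mulrC -ler_pdivlMr// -/K => hK.
rewrite -ltn_subLR; last exact: ltnW.
by rewrite -(ltr_nat R); apply: le_lt_trans hK _; exact: truncnS_gt.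
Qed.

End reparametrization.

Section rho_scale.
Context {R : realType}.
Variables (p0 p1 s tau : R).
Hypotheses (hp0 : 1 <= p0) (hp01 : p0 < p1) (hs : 0 < s) (htau : 0 < tau).

Local Notation rho := (rhos p0 p1 s tau).
Let delta := p0^-1 - p1^-1.
Let delta0 : 0 < delta.
Proof. by rewrite subr_gt0 ltf_pV2// posrE (lt_le_trans ltr01)// (le_trans hp0 (ltW hp01)). Qed.

Let rho0 m : 0 < rho m. Proof. exact: rhos_gt0. Qed.

Section weights.
Variable b : R -> R.
Hypothesis hb : SV01 b.
Local Notation bh := (ext1 b).

(** The power eta is split in half. Potter's bound with exponent eta / 2 controls the change of b,
    and the other half yields decay at rate delta / 2 times eta / 2. As rho decreases only up to the
    factor A, both orders of rho_m and rho_{m+n} have to be treated. *)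
Let ratio (eta : R) : 0 < eta -> exists e C : R, [/\ 0 < e, 0 < C & forall m n,
  rho (m + n) `^ eta * bh (rho m) <= C * expR (- (e * n%:R)) * (rho m `^ eta * bh (rho (m + n))) /\
  rho (m + n) `^ eta * bh (rho (m + n)) <= C * expR (- (e * n%:R)) * (rho m `^ eta * bh (rho m))].
Proof.
move=> eta0; have h20 : 0 < eta / 2 by rewrite divr_gt0.
have [A A0 hA] := rhos_ratio hp0 hp01 hs htau.
have [K K0 hK] := potter hb h20.
exists (delta * eta / 4), (K * (A * A) `^ (eta / 2) * A `^ (eta / 2)); split.
- by rewrite divr_gt0// mulr_gt0.
- by rewrite !mulr_gt0// powR_gt0// mulr_gt0.
move=> m n.
have A1 : 1 <= A.
  have := hA 0%N 0%N; rewrite mulr0 oppr0 expR0 mulr1 addn0 ler_pMl//.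
move: (hA m n) (rho0 m) (rho0 (m + n)).
move: (rho m) (rho (m + n)) => x y hxy x0 y0.
have yA : y <= A * x.
  apply: le_trans hxy _; rewrite ler_pM2r// ler_piMr ?(ltW A0)//.
  by rewrite -expR0 ler_expR oppr_le0 mulr_ge0// divr_ge0// ltW.
(* max(x/y, y/x) <= A^2 x / y *)
have pot : bh x <= K * (A * A * x / y) `^ (eta / 2) * bh y /\
           bh y <= K * (A * A * x / y) `^ (eta / 2) * bh x.
  have bx := ltW (ext1_gt0 hb x0); have by0 := ltW (ext1_gt0 hb y0).
  have mono z : 0 <= z -> z <= A * A * x / y -> z `^ (eta / 2) <= (A * A * x / y) `^ (eta / 2).
    by move=> z0 zz; apply: ge0_ler_powR; rewrite ?nnegrE ?(ltW h20)// (le_trans z0).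
  have [xy|yx] := leP x y.
    have [h1 h2] := hK x y x0 xy.
    have yx : (y / x) `^ (eta / 2) <= (A * A * x / y) `^ (eta / 2).
      apply: mono; first by rewrite divr_ge0// ltW.
      rewrite ler_pdivrMr// mulrAC ler_pdivlMr//.
      rewrite -[leRHS]mulrA (_ : A * A * (x * x) = (A * x) * (A * x)); last by ring.
      by apply: ler_pM => //; exact: ltW.
    by split; [apply: (le_trans h1)|apply: (le_trans h2)]; rewrite ler_wpM2r// ler_pM2l.
  have [h1 h2] := hK y x y0 (ltW yx).
  have xy : (x / y) `^ (eta / 2) <= (A * A * x / y) `^ (eta / 2).
    apply: mono; first by rewrite divr_ge0// ltW.
    rewrite ler_pM2r ?invr_gt0// ler_peMl ?(ltW x0)//.
    by rewrite -[leLHS]mulr1; apply: ler_pM.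
  by split; [apply: (le_trans h2)|apply: (le_trans h1)]; rewrite ler_wpM2r// ler_pM2l.
have key : y `^ eta * (K * (A * A * x / y) `^ (eta / 2)) <=
    K * (A * A) `^ (eta / 2) * A `^ (eta / 2) * expR (- (delta * eta / 4 * n%:R)) * x `^ eta.
  have y2 : y `^ (eta / 2) <= A `^ (eta / 2) * expR (- (delta * eta / 4 * n%:R)) * x `^ (eta / 2).
    have -> : expR (- (delta * eta / 4 * n%:R)) = expR (- (delta / 2 * n%:R)) `^ (eta / 2).
      by rewrite -expRM; congr expR; field.
    rewrite -!powRM ?mulr_ge0 ?expR_ge0 ?(ltW A0) ?(ltW x0)//.
    apply: ge0_ler_powR.
    - exact: ltW h20.
    - by rewrite nnegrE ltW.
    - by rewrite nnegrE mulr_ge0 ?(ltW x0)// mulr_ge0 ?(ltW A0)// expR_ge0.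
    - exact: hxy.
  have half z : 0 < z -> z `^ eta = z `^ (eta / 2) * z `^ (eta / 2).
    by move=> z0; rewrite -powRD ?(gt_eqF z0) ?implybT//; congr (_ `^ _); field.
  have AAxy : (A * A * x / y) `^ (eta / 2) * y `^ (eta / 2) = (A * A) `^ (eta / 2) * x `^ (eta / 2).
    rewrite -!powRM ?divr_ge0 ?mulr_ge0 ?(ltW A0) ?(ltW x0) ?(ltW y0)//.
    by rewrite divfK// gt_eqF.
  rewrite (half y)// (half x)//.
  rewrite [leLHS](_ : _ = K * ((A * A) `^ (eta / 2) * x `^ (eta / 2)) * y `^ (eta / 2)); last first.
    by rewrite -AAxy; ring.
  rewrite [leRHS](_ : _ = K * ((A * A) `^ (eta / 2) * x `^ (eta / 2)) *
    (A `^ (eta / 2) * expR (- (delta * eta / 4 * n%:R)) * x `^ (eta / 2))); last by ring.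
  by rewrite ler_pM2l// !mulr_gt0// powR_gt0// mulr_gt0.
have [h1 h2] := pot.
have fin u v : 0 <= v -> u <= K * (A * A * x / y) `^ (eta / 2) * v ->
    y `^ eta * u <= K * (A * A) `^ (eta / 2) * A `^ (eta / 2) *
      expR (- (delta * eta / 4 * n%:R)) * (x `^ eta * v).
  move=> v0 uv; apply: (@le_trans _ _ (y `^ eta * (K * (A * A * x / y) `^ (eta / 2) * v))).
    by rewrite ler_wpM2l// powR_ge0.
  by move: (ler_wpM2r v0 key); rewrite -!mulrA.
by split; apply: fin => //; apply/ltW/ext1_gt0.
Qed.

Lemma rho_tail_weight (theta : R) : 0 < theta -> exists e C : R, [/\ 0 < e, 0 < C &
  forall m n, rho m `^ (- theta) * bh (rho m) <=
    C * expR (- (e * n%:R)) * (rho (m + n) `^ (- theta) * bh (rho (m + n)))].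
Proof.
move=> /ratio[e [C [e0 C0 h]]]; exists e, C; split => // m n; have [h1 _] := h m n.
rewrite !powRN; move: h1 (powR_gt0 theta (rho0 m)) (powR_gt0 theta (rho0 (m + n))).
move: (rho m `^ theta) (rho (m + n) `^ theta) (bh (rho m)) (bh (rho (m + n))) (C * _).
move=> X Y B B' D h1 X0 Y0; rewrite -(ler_pM2l Y0) -(ler_pM2l X0).
rewrite (_ : X * (Y * (X^-1 * B)) = Y * B); last by field; rewrite gt_eqF.
by rewrite (_ : X * (Y * (D * (Y^-1 * B'))) = D * (X * B')); last by field; rewrite gt_eqF.
Qed.

Lemma rho_head_weight (eta : R) : 0 < eta -> exists e C : R, [/\ 0 < e, 0 < C &
  forall m n, rho (m + n) `^ eta * bh (rho (m + n)) <=
    C * expR (- (e * n%:R)) * (rho m `^ eta * bh (rho m))].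
Proof.
by move=> /ratio[e [C [e0 C0 h]]]; exists e, C; split => // m n; have [] := h m n.
Qed.

End weights.

Section reparam.
Variable (E : (R -> \bar R) -> \bar R).
Hypothesis hE : rearr_norm E.
Variables (I : Type) (Gam : I -> R -> \bar R).
Hypothesis Gam0 : forall i t, 0 < t -> (0 <= Gam i t)%E.
Hypothesis Gam_dbl : forall C : R, 0 < C -> exists2 D : R, 0 < D & forall i s t,
  0 < s -> 0 < t -> comparable_by C s t -> (Gam i s <= D%:E * Gam i t)%E.

Let q m := - ln (rho m).

Let qE m : expR (- q m) = rho m.
Proof. by rewrite /q opprK lnK// posrE. Qed.

Let q_props : exists c, [/\ 0 <= c, q 0%N = 0, forall m, q m.+1 <= q m + delta &
  forall m n, q m + delta / 2 * n%:R - c <= q (m + n)%N].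
Proof.
have [A A0 hA] := rhos_ratio hp0 hp01 hs htau.
have A1 : 1 <= A.
  have := hA 0%N 0%N; rewrite mulr0 oppr0 expR0 mulr1 addn0 ler_pMl//.
exists (ln A); split; first exact: ln_ge0.
- by rewrite /q /rhos /expw /logw mulr0 oppr0 expR0 addr0 powR1 mulr1 ln1 oppr0.
- move=> m; have := @rhos_ratio_ge _ p0 p1 s tau hs htau m 1; rewrite mulr1 addn1 => h.
  have P := mulr_gt0 (expR_gt0 (- delta)) (rho0 m).
  have : ln (expR (- delta) * rho m) <= ln (rho m.+1) by rewrite ler_ln ?posrE.
  by rewrite lnM ?posrE ?expR_gt0// expRK /q; lra.
- move=> m n; have P := mulr_gt0 A0 (expR_gt0 (- (delta / 2 * n%:R))).
  have P' := mulr_gt0 P (rho0 m).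
  have : ln (rho (m + n)) <= ln (A * expR (- (delta / 2 * n%:R)) * rho m).
    by rewrite ler_ln ?posrE.
  by rewrite (lnM P (rho0 m)) (lnM A0 (expR_gt0 _)) expRK /q; lra.
Qed.

Lemma lec_disc_rho : lec (fun i => disc E (fun n => Gam i (expR (- n%:R))))
  (fun i => disc E (fun n => Gam i (rho n))).
Proof.
have [c [c0 q0 qS qD]] := q_props.
have := lec_disc_expR hE Gam0 Gam_dbl delta0 q0 qS qD.
by under [X in lec _ X]eq_fun do under [X in disc _ X]eq_fun do rewrite qE.
Qed.

Lemma lec_rho_disc : lec (fun i => disc E (fun n => Gam i (rho n)))
  (fun i => disc E (fun n => Gam i (expR (- n%:R)))).
Proof.
have [c [c0 q0 qS qD]] := q_props.
have := lec_expR_disc hE Gam0 Gam_dbl delta0 c0 q0 qD.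
by under [X in lec X _]eq_fun do under [X in disc _ X]eq_fun do rewrite qE.
Qed.

End reparam.
End rho_scale.

(** * Function spaces on the probability space *)

Section fstar_theory.
Context {R : realType} {d : measure_display} {T : measurableType d}.
Variable mu : probability T R.
Local Open Scope ereal_scope.

Lemma fstar_ge0 (f : T -> R) t : 0 <= fstar mu f t.
Proof. exact: rearr_ge0. Qed.

Lemma fstar_nonincr (f : T -> R) (s t : R) : (s <= t)%R -> fstar mu f t <= fstar mu f s.
Proof. exact: rearr_nonincr. Qed.

Let measf (f : T -> R) : measurable_fun setT f -> measurable_fun setT (EFin \o f).
Proof. by move=> mf; exact/measurable_EFinP. Qed.

(** On a probability space the sets where |f| > n decrease to the empty set, so their measure falls
    below t. *)
Lemma fstar_lty (f : T -> R) (t : R) : measurable_fun setT f -> (0 < t)%R ->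
  fstar mu f t < +oo.
Proof.
move=> mf t0; pose F n := [set x | n%:R%:E < `|(EFin \o f) x|].
have mF n : measurable (F n) by apply: measurable_gt_abse; exact: measf.
have mI : measurable (\bigcap_n F n) by exact: bigcapT_measurable.
have cF : mu (F n) @[n --> \oo] --> mu (\bigcap_n F n).
  apply: nonincreasing_cvg_mu => //.
    by rewrite (le_lt_trans (probability_le1 mu (mF _)))// ltry.
  move=> n k nk; apply/subsetPset => x; apply: le_lt_trans.
  by rewrite lee_fin ler_nat.
have F0 : \bigcap_n F n = set0.
  apply/seteqP; split => x //= /(_ (Num.truncn `|f x|).+1 I); rewrite /F/= lte_fin.
  by move/(lt_trans (truncnS_gt _)); rewrite ltxx.
rewrite F0 measure0 in cF.
have [n nt] : exists n, mu (F n) <= t%:E.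
  have : nbhs (0 : \bar R) [set y | y < t%:E].
    by apply: open_nbhs_nbhs; split; [exact: open_ereal_lt_ereal|rewrite /= lte_fin].
  by move=> /cF [n _ /(_ n (leqnn n)) /= nt]; exists n; exact: ltW.
apply: (@le_lt_trans _ _ n%:R%:E); last by rewrite ltry.
by apply: ereal_inf_lbound; exists n%:R%R => //; split.
Qed.

Lemma fstar_fineK (f : T -> R) (t : R) : measurable_fun setT f -> (0 < t)%R ->
  (fine (fstar mu f t))%:E = fstar mu f t.
Proof. by move=> mf t0; rewrite fineK// ge0_fin_numE ?fstar_ge0// fstar_lty. Qed.

Lemma fstar_attained (f : T -> R) (t : R) : measurable_fun setT f -> (0 < t)%R ->
  mu [set x | fstar mu f t < `|(f x)%:E|] <= t%:E.
Proof.
move=> mf t0; have c0 : (0 <= fine (fstar mu f t))%R by rewrite fine_ge0// fstar_ge0.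
have := rearr_gtP mu t (measf mf) c0; rewrite fstar_fineK//.
by rewrite -/(fstar mu f t) ltxx => /esym/negbT; rewrite -leNgt.
Qed.

Lemma fstar_le (f : T -> R) (t c : R) : (0 <= c)%R ->
  mu [set x | (c < `|f x|)%R] <= t%:E -> fstar mu f t <= c%:E.
Proof.
move=> c0 mc; by apply: ereal_inf_lbound; exists c.
Qed.

Lemma measurable_gt_norm (f : T -> R) (c : R) : measurable_fun setT f ->
  measurable [set x | (c < `|f x|)%R].
Proof. by move=> /measf/(measurable_gt_abse c%:E). Qed.

Lemma fstar_attained_fine (f : T -> R) (t : R) : measurable_fun setT f -> (0 < t)%R ->
  mu [set x | (fine (fstar mu f t) < `|f x|)%R] <= t%:E.
Proof.
move=> mf t0; apply: le_trans (fstar_attained mf t0); rewrite le_eqVlt; apply/orP; left.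
by apply/eqP; congr (mu _); apply/funext => x; rewrite -fstar_fineK.
Qed.

Lemma fstar_mono (f g : T -> R) (t : R) : measurable_fun setT f -> measurable_fun setT g ->
  (forall x, `|f x| <= `|g x|)%R -> fstar mu f t <= fstar mu g t.
Proof.
move=> mf mg fg; apply: le_rearr => l l0; apply: le_trans; apply: le_measure.
- by apply: mem_set; apply: measurable_gt_abse; exact: measf.
- by apply: mem_set; apply: measurable_gt_abse; exact: measf.
- by move=> x /= lf; apply: lt_le_trans lf _; rewrite lee_fin.
Qed.

Lemma fstarD (f0 f1 : T -> R) (s t : R) : measurable_fun setT f0 -> measurable_fun setT f1 ->
  (0 < s)%R -> (s + s <= t)%R ->
  fstar mu (f0 + f1)%R t <= fstar mu f0 s + fstar mu f1 s.
Proof.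
move=> m0 m1 s0 st; rewrite -(fstar_fineK m0 s0) -(fstar_fineK m1 s0) -EFinD.
set c0 := fine _; set c1 := fine _.
have c00 : (0 <= c0)%R by rewrite fine_ge0// fstar_ge0.
have c10 : (0 <= c1)%R by rewrite fine_ge0// fstar_ge0.
apply: fstar_le; first exact: addr_ge0.
apply: (@le_trans _ _ (mu ([set x | (c0 < `|f0 x|)%R] `|` [set x | (c1 < `|f1 x|)%R]))).
  apply: le_measure.
  - by apply: mem_set; apply: measurable_gt_norm; exact: measurable_funD.
  - by apply: mem_set; apply: measurableU; exact: measurable_gt_norm.
  - move=> x /= h; have [a|a] := ltP c0 `|f0 x|%R; first by left.
    right; rewrite ltNge; apply/negP => b; move: h; rewrite ltNge => /negP; apply.
    by apply: le_trans (ler_normD _ _) _; exact: lerD.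
apply: le_trans (measureU2 _ _ _) _; try exact: measurable_gt_norm.
apply: (@le_trans _ _ (s%:E + s%:E)); last by rewrite -EFinD lee_fin.
by apply: leeD; exact: fstar_attained_fine.
Qed.

Definition clip (c : R) (f : T -> R) (x : T) : R := Num.max (- c)%R (Num.min (f x) c).

Lemma measurable_clip (c : R) (f : T -> R) : measurable_fun setT f ->
  measurable_fun setT (clip c f).
Proof.
by move=> mf; apply: measurable_maxr => //; exact: measurable_minr.
Qed.

Lemma clip_norm (c : R) (f : T -> R) x : (0 <= c)%R ->
  [/\ `|clip c f x| <= `|f x|, `|clip c f x| <= c, `|f x - clip c f x| <= `|f x| &
      (`|f x| <= c -> f x - clip c f x = 0)]%R.
Proof.
move=> c0; rewrite /clip; have [fc|cf] := leP (f x) c.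
  have [cf|fc'] := leP (- c)%R (f x).
    rewrite subrr normr0; split => //.
    by rewrite ler_norml cf.
  have f0 : (f x < 0)%R by lra.
  rewrite (ltr0_norm f0) normrN (ger0_norm c0); split => //; [lra| |lra].
  by rewrite ler0_norm; lra.
have cc : (- c <= c)%R by lra.
rewrite (max_idPr cc) (ger0_norm c0).
have f0 : (0 < f x)%R by lra.
rewrite (gtr0_norm f0); split; [lra|lra| |lra].
by rewrite ger0_norm; lra.
Qed.

(** Used as index type, so that [lec] over it is an inequality with a constant independent of the
    function. *)
Definition mfun_idx := {f : T -> R | measurable_fun setT f}.

Definition fseq (i : mfun_idx) (k : nat) : \bar R := fstar mu (sval i) (expR (- k%:R)).

Lemma fseq_ge0 : nns fseq.
Proof. by move=> i k; exact: fstar_ge0. Qed.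

Lemma fseq_nondecr i j k : (j <= k)%N -> fseq i j <= fseq i k.
Proof. by move=> jk; apply: fstar_nonincr; rewrite ler_expR lerN2 ler_nat. Qed.

Lemma fseq_dbl : les fseq (fun i k => fseq i k.+1).
Proof. by apply: lesW => i k; exact: fseq_nondecr. Qed.

Lemma approx_fseq : approx (fun i t => fstar mu (sval i) t) fseq.
Proof.
exists 1%N, 1%R => // i m t; rewrite !mul1e addn1; split; rewrite /exp_cell/= in_itv/= => /andP[h1 h2].
  exact: fstar_nonincr.
apply: fstar_nonincr; apply: (le_trans (ltW h2)).
by rewrite ler_expR lerN2 ler_nat.
Qed.

Lemma fseqD (i i0 i1 : mfun_idx) k : sval i = (sval i0 + sval i1)%R ->
  fseq i k <= fseq i0 k.+1 + fseq i1 k.+1.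
Proof.
move=> E; rewrite /fseq E; apply: fstarD; rewrite ?expR_gt0//; try exact: svalP.
have -> : expR (- k%:R) = (expR 1 * expR (- k.+1%:R))%R :> R.
  by rewrite -expRD -natr1; congr expR; ring.
(* Because e >= 2, two arguments e^{-k-1} fit into e^{-k}: the sum costs a single index. *)
have : (2 <= expR 1 :> R)%R by have := expR_ge1Dx (1 : R); rewrite (_ : 1 + 1 = 2)%R.
by rewrite -(ler_pM2r (expR_gt0 (- k.+1%:R))); lra.
Qed.

Definition clip1 (i : mfun_idx) (m : nat) : mfun_idx :=
  exist _ (clip (fine (fseq i m)) (sval i)) (measurable_clip _ (svalP i)).

Definition clip0 (i : mfun_idx) (m : nat) : mfun_idx :=
  exist _ (sval i - sval (clip1 i m))%R
    (measurable_funB (svalP i) (svalP (clip1 i m))).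

Let c0 i m : (0 <= fine (fseq i m))%R.
Proof. by rewrite fine_ge0// fseq_ge0. Qed.

(** The remainder vanishes where |f| <= phi_m, and the complement has measure at most e^{-m}; hence
    its rearrangement is 0 at e^{-k} for k < m. *)
Lemma fseq_clip0 i m k : fseq (clip0 i m) k <= (if (m <= k)%N then fseq i k else 0).
Proof.
case: ifPn => [mk|km].
  apply: fstar_mono; try exact: svalP.
  by move=> x; have [_ _ + _] := clip_norm (sval i) x (c0 i m).
apply: fstar_le => //.
apply: (@le_trans _ _ (expR (- m%:R))%:E); last first.
  by rewrite lee_fin ler_expR lerN2 ler_nat ltnW// ltnNge.
apply: le_trans (fstar_attained_fine (svalP i) (expR_gt0 _)); apply: le_measure.
- by apply: mem_set; apply: measurable_gt_norm; exact: svalP.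
- by apply: mem_set; apply: measurable_gt_norm; exact: svalP.
- move=> x /= h; rewrite ltNge; apply/negP => fc.
  have [_ _ _ /(_ fc) E] := clip_norm (sval i) x (c0 i m).
  by move: h; rewrite [X in `|X|%R]E normr0 ltxx.
Qed.

(** The truncated function is bounded both by |f| and by the level phi_m. *)
Lemma fseq_clip1 i m k : fseq (clip1 i m) k <= fseq i (minn k m).
Proof.
have [km|mk] := leqP k m.
  apply: fstar_mono; try exact: svalP.
  by move=> x; have [+ _ _ _] := clip_norm (sval i) x (c0 i m).
rewrite -[leRHS]fstar_fineK; [|exact: svalP|exact: expR_gt0].
apply: fstar_le; first exact: c0.
rewrite (_ : [set x | _] = set0) ?measure0 ?lee_fin ?expR_ge0//.
apply/seteqP; split => x //=; rewrite ltNge => /negP; apply.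
by have [_ + _ _] := clip_norm (sval i) x (c0 i m).
Qed.

Lemma clipK i m : sval i = (sval (clip0 i m) + sval (clip1 i m))%R.
Proof. by rewrite /= subrK. Qed.

End fstar_theory.

(** * The essential supremum in the grand Lebesgue norm *)

Section grand_norm.
Context {R : realType}.
Local Open Scope ereal_scope.
Local Notation lam := (@lebesgue_measure R).
Variables (I : Type) (w : R -> R) (ws : nat -> R).
Variables (X : I -> R -> \bar R) (x : I -> nat -> \bar R).
Hypotheses (hw : adm w ws) (hX : approx X x) (x0 : nns x).
Hypothesis X0 : forall i t, (0 < t < 1)%R -> 0 <= X i t.

Let Nsup : rearr_norm (Leb +oo : (R -> \bar R) -> \bar R).
Proof. exact: rearr_norm_Leb (leey 1). Qed.

Let wx0 : nns (wseq ws x).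
Proof. by apply: nns_wseq_pos => //; exact: (adm_gt0 hw). Qed.

Let cell_gt0 k : 0 < lam (exp_cell k).
Proof.
rewrite /exp_cell lebesgue_measure_itv/= lte_fin ltr_expR ltrN2 ltr_nat ltnSn.
by rewrite -EFinB lte_fin subr_gt0 ltr_expR ltrN2 ltr_nat.
Qed.

(** In [grandL] the outer norm is an essential supremum for Lebesgue measure on (0, 1) and not a
    [tnorm]. Each cell has positive Lebesgue measure, so it still compares with a supremum over
    cells. *)
Lemma Leby_weight_le :
  lec (fun i => Leb +oo ((fun t => (w t)%:E * X i t) \_ `]0%R, 1%R[))
      (fun i => disc (Leb +oo) (wseq ws x i)).
Proof.
have [N [C C0 hC]] := approx_weight hw hX x0 X0; have [B B0 hB] := disc_ge_term Nsup.
exists (C * B)%R => [|i]; first exact: mulr_gt0.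
have d0 : 0 <= (C * B)%:E * disc (Leb +oo) (wseq ws x i).
  by rewrite mule_ge0 ?disc_ge0// lee_fin mulr_ge0// ltW.
rewrite [leLHS]/Leb unlock; case: ifPn => // _.
apply/ess_supP; apply: nearW => t /=; rewrite !patchE.
case: ifPn => _; last by rewrite abse0.
case: ifPn => [/set_mem/= t01|_]; last by rewrite abse0.
have [k kt] := exp_cell_cover t01; have [h _] := hC i k t; apply: le_trans (h kt) _.
by rewrite EFinM -muleA lee_wpmul2l ?lee_fin ?(ltW C0)//; exact: hB.
Qed.

Lemma disc_weight_Leby :
  lec (fun i => disc (Leb +oo) (wseq ws x i))
      (fun i => Leb +oo ((fun t => (w t)%:E * X i t) \_ `]0%R, 1%R[)).
Proof.
have [N [C C0 hC]] := approx_weight hw hX x0 X0; exists C => // i.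
apply: disc_Leby_le => m; rewrite wx0/= -lee_pdivrMl//.
rewrite /Leb unlock ifT; last first.
  apply: lt_le_trans (cell_gt0 0) _; apply: le_measure => //; apply: mem_set => //.
  exact: measurable_itv.
apply: (le_ess_sup_on (A := exp_cell (m + N)%N)) => //; first exact: measurable_itv.
move=> t mt /=; rewrite lee_pdivrMl//; have [_ h] := hC i m t; apply: le_trans (h mt) _.
rewrite patchE mem_set; last exact: exp_cell_pos_half mt.
by rewrite patchE mem_set//= in_itv/=; exact: exp_cell_pos mt.
Qed.

End grand_norm.

(** * Holmstedt's formula for the small and grand Lebesgue spaces *)

Section spaces_as_sequences.
Context {R : realType} {d : measure_display} {T : measurableType d}.
Variable mu : probability T R.
Local Open Scope ereal_scope.
Local Notation J := (@mfun_idx R d T).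
Local Notation fs := (fseq mu).

Lemma fstar_ge0_01 (i : J) t : (0 < t < 1)%R -> 0 <= fstar mu (sval i) t.
Proof. by move=> _; exact: fstar_ge0. Qed.

Lemma tnorm_ge0_01 (F : (R -> \bar R) -> \bar R) (hF : rearr_norm F) (Iv : R -> set R)
    (g : J -> R -> \bar R) i t :
  (0 < t < 1)%R -> 0 <= tnorm F (Iv t) (g i).
Proof. by move=> _; exact: tnorm_ge0. Qed.

Lemma adm_wstar (p : R) : adm (fun t => t `^ p^-1 * cst 1 t)%R (expw p^-1).
Proof. by apply: adm_eq (adm_expw p^-1) => // t _; rewrite mulr1. Qed.

Section tails.
Variable p : R.
Hypothesis hp : (1 <= p)%R.
Let hN : rearr_norm (Leb p%:E : (R -> \bar R) -> \bar R).
Proof. exact: rearr_norm_Leb. Qed.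

Lemma approx_small : approx (fun (i : J) t => tnorm (Leb p%:E) `]0%R, t[
  (wstar mu p (cst 1%R) (sval i))) (smallA p fs).
Proof.
exact: (approx_tail hN (adm_wstar p) (approx_fseq mu) (@fseq_ge0 _ _ _ mu)
  fstar_ge0_01 (fseq_dbl mu)).
Qed.

Lemma approx_grand : approx (fun (i : J) t => tnorm (Leb p%:E) `]t, 1%R[
  (wstar mu p (cst 1%R) (sval i))) (grandD p fs).
Proof.
exact: (approx_head hN (adm_wstar p) (approx_fseq mu) (@fseq_ge0 _ _ _ mu)
  fstar_ge0_01).
Qed.

Lemma smallA_dbl : les (smallA p fs) (fun i k => smallA p fs i k.+1).
Proof.
exact: (tail_disc_dbl hN (adm_expw p^-1) (@fseq_ge0 _ _ _ mu) (fseq_dbl mu)).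
Qed.

End tails.

Variables (p0 p1 alpha beta : R).
Hypotheses (hp0 : (1 < p0)%R) (hp01 : (p0 < p1)%R) (halpha : (0 < alpha)%R) (hbeta : (0 < beta)%R).
Let s : R := (alpha / conj_exp p0)%R.
Let tau : R := (beta / p1)%R.
Let hp0' : (1 <= p0)%R. Proof. exact: ltW. Qed.
Let hp1' : (1 <= p1)%R. Proof. exact: le_trans (ltW hp01). Qed.

Lemma s_gt0 : (0 < s)%R.
Proof.
rewrite divr_gt0// /conj_exp divr_gt0//; first exact: lt_trans hp0.
by rewrite subr_gt0.
Qed.

Lemma tau_gt0 : (0 < tau)%R.
Proof. by rewrite divr_gt0// (lt_le_trans ltr01). Qed.

Let hs := s_gt0.
Let htau := tau_gt0.

Local Notation S0 := (smallL mu p0 alpha).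
Local Notation S1 := (grandL mu p1 beta).
Local Notation rho := (rhos p0 p1 s tau).

Let N1 : rearr_norm (Leb 1%:E : (R -> \bar R) -> \bar R).
Proof. exact: rearr_norm_Leb. Qed.
Let Np (p : R) : (1 <= p)%R -> rearr_norm (Leb p%:E : (R -> \bar R) -> \bar R).
Proof. by move=> hp; exact: rearr_norm_Leb. Qed.

Let fs0 : nns fs := @fseq_ge0 _ _ _ mu.

Lemma smallL_le : lec (fun i : J => nnorm S0 (sval i)) (norm0 p0 s fs).
Proof.
exact: (tnorm_weight_le N1 (adm_logw (s - 1)) (approx_small hp0') (nns_smallA hp0' fs0)
  (tnorm_ge0_01 (Np hp0') (fun t => `]0%R, t[%classic) (fun i => wstar mu p0 (cst 1%R) (sval i)))).
Qed.

Lemma smallL_ge : lec (norm0 p0 s fs) (fun i : J => nnorm S0 (sval i)).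
Proof.
exact: (disc_weight_le N1 (adm_logw (s - 1)) (approx_small hp0') (nns_smallA hp0' fs0)
  (tnorm_ge0_01 (Np hp0') (fun t => `]0%R, t[%classic) (fun i => wstar mu p0 (cst 1%R) (sval i)))).
Qed.

Lemma grandL_le : lec (fun i : J => nnorm S1 (sval i)) (norm1 p1 tau fs).
Proof.
exact: (Leby_weight_le (adm_logw (- tau)) (approx_grand hp1') (nns_grandD hp0' hp01 fs0)
  (tnorm_ge0_01 (Np hp1') (fun t => `]t, 1%R[%classic) (fun i => wstar mu p1 (cst 1%R) (sval i)))).
Qed.

Lemma grandL_ge : lec (norm1 p1 tau fs) (fun i : J => nnorm S1 (sval i)).
Proof.
exact: (disc_weight_Leby (adm_logw (- tau)) (approx_grand hp1') (nns_grandD hp0' hp01 fs0)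
  (tnorm_ge0_01 (Np hp1') (fun t => `]t, 1%R[%classic) (fun i => wstar mu p1 (cst 1%R) (sval i)))).
Qed.

Definition Kf (i : J) (t : R) := Kfun S0 S1 t (sval i).

Lemma smallL_ge0 f : 0 <= nnorm S0 f.
Proof. exact: tnorm_ge0. Qed.

Lemma grandL_ge0 f : 0 <= nnorm S1 f.
Proof. exact: Lnorm_ge0. Qed.

Lemma Kf_ge0 i t : (0 <= t)%R -> 0 <= Kf i t.
Proof.
move=> t0; apply/ereal_infP => _ [f0 [f1 [_ _ _ ->]]].
by rewrite adde_ge0 ?smallL_ge0// mule_ge0 ?grandL_ge0.
Qed.

Lemma Kf_mono i (a t C : R) : (0 <= a)%R -> (0 <= t)%R -> (0 < C)%R -> (a <= C * t)%R ->
  Kf i a <= (1 + C)%:E * Kf i t.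
Proof.
move=> a0 t0 C0 aC; have C1 : (0 < 1 + C)%R by rewrite addr_gt0.
rewrite -lee_pdivrMl//; apply/ereal_infP => _ [f0 [f1 [c0 c1 E ->]]].
rewrite lee_pdivrMl//; apply: (@le_trans _ _ (nnorm S0 f0 + a%:E * nnorm S1 f1)).
  by apply: ereal_inf_lbound; exists f0, f1.
rewrite ge0_muleDr ?smallL_ge0// ?mule_ge0 ?grandL_ge0//; apply: leeD.
  by rewrite -{1}(mul1e (nnorm S0 f0)) lee_wpmul2r ?smallL_ge0// lee_fin lerDl ltW.
rewrite muleA -EFinM lee_wpmul2r ?grandL_ge0// lee_fin; apply: (le_trans aC).
by rewrite mulrDl mul1r lerDr.
Qed.

(** [holm_lower] is applied to the family of all triples (f, f0, f1) with f = f0 + f1, so that its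
    constant survives the infimum over decompositions. *)
Lemma Kf_lower : les (holm p0 p1 s tau fs) (fun i m => Kf i (rho m)).
Proof.
pose J3 := {j : J * J * J | sval j.1.1 = (sval j.1.2 + sval j.2)%R}.
pose g (k : J * J * J -> J) (j : J3) := k (sval j).
have [C C0 hC] := @holm_lower R p0 p1 s tau hp0' hp01 hs htau J3
  (fun j => fs (g (fun z => z.1.1) j)) (fun j => fs (g (fun z => z.1.2) j))
  (fun j => fs (g (fun z => z.2) j)) (fun j k => fs0 _ _) (fun j k => fs0 _ _) (fun j k => fs0 _ _)
  (fun j k => fseqD mu k (svalP j)).
have [A A0 hA] := smallL_ge; have [B B0 hB] := grandL_ge.
exists (C * (A + B))%R => [|i m]; first by rewrite mulr_gt0// addr_gt0.
rewrite EFinM -muleA -lee_pdivrMl// -lee_pdivrMl ?addr_gt0//.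
apply/ereal_infP => _ [f0 [f1 [c0 c1 E ->]]].
pose i0 : J := exist _ f0 c0.1; pose i1 : J := exist _ f1 c1.1.
rewrite lee_pdivrMl ?addr_gt0// lee_pdivrMl//.
have := hC (exist _ (i, i0, i1) E) m; rewrite /g/= => h; apply: (le_trans h).
rewrite lee_wpmul2l ?lee_fin ?(ltW C0)//.
have r0 : 0 <= (rho m)%:E :> \bar R by rewrite lee_fin ltW// rhos_gt0.
rewrite ge0_muleDr ?smallL_ge0// ?mule_ge0 ?grandL_ge0//; apply: leeD.
  apply: le_trans (hA i0) _; rewrite lee_wpmul2r ?smallL_ge0//.
  by rewrite lee_fin lerDl ltW.
rewrite muleCA lee_wpmul2l//; apply: le_trans (hB i1) _.
by rewrite lee_wpmul2r ?grandL_ge0// lee_fin lerDr ltW.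
Qed.

(** The decomposition truncates f at a level depending on m, so the family is indexed by pairs (f,
    m). *)
Lemma Kf_upper : les (fun i m => Kf i (rho m)) (holm p0 p1 s tau fs).
Proof.
pose J2 := (J * nat)%type.
have [C C0 hC] := @norm0_trunc R p0 s hp0' hs J2 (fun j => fs j.1)
  (fun j => fs (clip0 mu j.1 j.2)) (fun j => j.2) (fun j k => fs0 _ _) (fun j k => fs0 _ _)
  (fun j k => fseq_clip0 mu j.1 j.2 k).
have [D D0 hD] := @norm1_trunc R p0 p1 tau hp0' hp01 htau J2 (fun j => fs j.1)
  (fun j => fs (clip1 mu j.1 j.2)) (fun j => j.2) (fun j k => fs0 _ _) (fun j k => fs0 _ _)
  (fun j k => fseq_clip1 mu j.1 j.2 k).
have [A A0 hA] := smallL_le; have [B B0 hB] := grandL_le.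
have IJ0 i m : 0 <= smallI p0 s fs i m + smallJ p0 s fs i m.
  by rewrite adde_ge0 ?nns_smallI ?nns_smallJ.
have gS0 i m : 0 <= grandS p1 tau fs i m by exact: (nns_grandS tau hp0' hp01 fs0).
have rS0 i m : 0 <= (rho m)%:E * grandS p1 tau fs i m.
  by rewrite mule_ge0// lee_fin ltW// rhos_gt0.
exists (A * C + B * D)%R => [|i m]; first by rewrite addr_gt0// mulr_gt0.
have E0 : nnorm S0 (sval (clip0 mu i m)) <= (A * C)%:E *
    (smallI p0 s fs i m + smallJ p0 s fs i m).
  apply: le_trans (hA _) _; rewrite EFinM -muleA lee_wpmul2l ?lee_fin ?(ltW A0)//.
  exact: (hC (i, m)).
have E1 : nnorm S1 (sval (clip1 mu i m)) <= (B * D)%:E * grandS p1 tau fs i m.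
  apply: le_trans (hB _) _; rewrite EFinM -muleA lee_wpmul2l ?lee_fin ?(ltW B0)//.
  exact: (hD (i, m)).
have AC0 : (0 < A * C)%R by exact: mulr_gt0.
have BD0 : (0 < B * D)%R by exact: mulr_gt0.
(* The two pieces compete in the infimum only as members of their spaces, which the finiteness of
   the right side ensures. *)
have [fin|] := ltP (holm p0 p1 s tau fs i m) +oo; last first.
  by rewrite leye_eq => /eqP ->; rewrite gt0_muley ?leey// lte_fin addr_gt0.
have [finI finS] : smallI p0 s fs i m + smallJ p0 s fs i m < +oo /\
    (rho m)%:E * grandS p1 tau fs i m < +oo.
  by split; apply: le_lt_trans fin; rewrite /holm ?leeDl ?leeDr.
have finS' : grandS p1 tau fs i m < +oo.
  move: finS; rewrite !ltey; apply: contra => /eqP ->.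
  by rewrite gt0_muley// lte_fin rhos_gt0.
apply: (@le_trans _ _ (nnorm S0 (sval (clip0 mu i m)) +
    (rho m)%:E * nnorm S1 (sval (clip1 mu i m)))).
  apply: ereal_inf_lbound; exists (sval (clip0 mu i m)), (sval (clip1 mu i m)); split => //.
  - split; first exact: (svalP (clip0 mu i m)).
    by apply: le_lt_trans E0 _; rewrite lte_mul_pinfty ?lee_fin ?(ltW AC0).
  - split; first exact: (svalP (clip1 mu i m)).
    by apply: le_lt_trans E1 _; rewrite lte_mul_pinfty ?lee_fin ?(ltW BD0).
  - exact: clipK.
rewrite EFinD ge0_muleDl ?lee_fin ?(ltW AC0) ?(ltW BD0)//; apply: leeD.
  by apply: le_trans E0 _; rewrite lee_wpmul2l ?lee_fin ?(ltW AC0)// leeDl.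
apply: (@le_trans _ _ ((B * D)%:E * ((rho m)%:E * grandS p1 tau fs i m))).
  by rewrite [leRHS]muleCA lee_wpmul2l// lee_fin ltW// rhos_gt0.
by rewrite lee_wpmul2l ?lee_fin ?(ltW BD0)// leeDr.
Qed.

Lemma approx_Kf : approx Kf (fun i n => Kf i (expR (- n%:R))).
Proof.
(* In either inequality the argument on the left is at most e^2 times the one on the right. *)
exists 1%N, (1 + expR 2)%R => [|i m t]; first by rewrite addr_gt0// expR_gt0.
split => mt; apply: Kf_mono; rewrite ?expR_ge0 ?expR_gt0//;
  try (by have /andP[t0 _] := exp_cell_pos mt; exact: ltW).
  move: mt; rewrite /exp_cell/= in_itv/= => /andP[_ tm]; apply: (le_trans (ltW tm)).
  by rewrite -expRD ler_expR addn1 -natr1; lra.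
move: mt; rewrite /exp_cell/= in_itv/= => /andP[mt _].
rewrite -ler_pdivrMl ?expR_gt0//; apply: le_trans mt.
by rewrite -expRN -expRD ler_expR addn1 -!natr1; lra.
Qed.

End spaces_as_sequences.

(** * The interpolation norm *)

Section interpolation_norm.
Context {R : realType} {d : measure_display} {T : measurableType d}.
Variable mu : probability T R.
Local Open Scope ereal_scope.
Variables (E : (R -> \bar R) -> \bar R) (b : R -> R) (p0 p1 alpha beta : R).
Hypotheses (hE : ri_norm E) (hb : SV01 b) (hp0 : (1 < p0)%R) (hp01 : (p0 < p1)%R)
  (halpha : (0 < alpha)%R) (hbeta : (0 < beta)%R).

Local Notation J := (@mfun_idx R d T).
Local Notation fs := (fseq mu).
Let s : R := (alpha / conj_exp p0)%R.
Let tau : R := (beta / p1)%R.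
Let hs : (0 < s)%R := s_gt0 hp0 halpha.
Let hp0' : (1 <= p0)%R. Proof. exact: ltW. Qed.
Let hp1' : (1 <= p1)%R. Proof. exact: le_trans (ltW hp01). Qed.
Let htau : (0 < tau)%R. Proof. by rewrite divr_gt0// (lt_le_trans ltr01). Qed.
Local Notation rho := (rhos p0 p1 s tau).
Local Notation S0 := (smallL mu p0 alpha).
Local Notation S1 := (grandL mu p1 beta).
Let hN := rearr_norm_ri hE.
Let fs0 : nns fs := @fseq_ge0 _ _ _ mu.
Let rho0 m : (0 < rho m)%R. Proof. exact: rhos_gt0. Qed.

Lemma les_wseq {I : Type} (v : nat -> R) (x y : I -> nat -> \bar R) :
  (forall k, (0 < v k)%R) -> les x y -> les (wseq v x) (wseq v y).
Proof.
move=> v0 [C C0 hC]; exists C => // i k; rewrite /wseq muleCA lee_wpmul2l//.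
by rewrite lee_fin ltW.
Qed.

Definition rhow (theta : R) (m : nat) : R := (rho m `^ (- theta) * ext1 b (rho m))%R.

Lemma rhow_gt0 theta m : (0 < rhow theta m)%R.
Proof. by rewrite mulr_gt0 ?powR_gt0// ext1_gt0. Qed.

Lemma adm_rho : adm (fun u => u `^ (p0^-1 - p1^-1) *
  ell u `^ (alpha / conj_exp p0 + beta / p1))%R rho.
Proof. exact: adm_mul (adm_expw _) (adm_logw _). Qed.

Lemma adm_brho : adm (fun u => ext1 b (u `^ (p0^-1 - p1^-1) *
  ell u `^ (alpha / conj_exp p0 + beta / p1)))%R (fun k => ext1 b (rho k)).
Proof. by have H := adm_ext1 hb adm_rho; exact: H. Qed.

Let adm_interp (theta : R) : adm (fun t => t `^ (- theta) * b t)%R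
  (fun n => expR (- n%:R) `^ (- theta) * ext1 b (expR (- n%:R)))%R.
Proof.
apply: adm_eq (adm_mul (adm_powR (- theta) adm_id) (adm_ext1 hb adm_id)) => // t /andP[_ t1].
by rewrite /ext1 t1.
Qed.

(** The integrand of the interpolation norm on all of (0, +oo): rho_m can exceed 1 for small m,
    where the logarithm outweighs the power, hence [ext1 b]. *)
Let Gam (theta : R) (i : J) (t : R) : \bar R :=
  (t `^ (- theta) * ext1 b t)%:E * Kf mu p0 p1 alpha beta i t.

Let Gam0 theta i t : (0 < t)%R -> 0 <= Gam theta i t.
Proof.
move=> t0; rewrite mule_ge0 ?Kf_ge0 ?(ltW t0)// lee_fin mulr_ge0 ?powR_ge0//.
exact/ltW/ext1_gt0.
Qed.

Let Gam_dbl theta (C : R) : (0 < C)%R -> exists2 D : R, (0 < D)%R & forall i a t,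
  (0 < a)%R -> (0 < t)%R -> comparable_by C a t -> Gam theta i a <= D%:E * Gam theta i t.
Proof.
move=> C0; have [D D0 hD] := ext1_comparable hb C0.
exists (C `^ `|- theta| * D * (1 + C))%R.
  by rewrite !mulr_gt0 ?powR_gt0// addr_gt0.
move=> i a t a0 t0 at_; apply: lee_mulC.
- by rewrite mulr_ge0 ?powR_ge0//; exact/ltW/ext1_gt0.
- by rewrite Kf_ge0// ltW.
- have [h1 _] := comparable_powR (- theta) C0 a0 t0 at_.
  have [h2 _] := hD a t a0 t0 at_.
  by rewrite mulrACA; apply: ler_pM => //; [exact: powR_ge0|exact/ltW/ext1_gt0].
- by apply: Kf_mono; rewrite ?(ltW a0) ?(ltW t0)//; have [] := at_.
Qed.

Let K0 : nns (fun i n => Kf mu p0 p1 alpha beta i (expR (- n%:R))).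
Proof. by move=> i n; rewrite Kf_ge0// expR_ge0. Qed.

Let K01 (i : J) (t : R) : (0 < t < 1)%R -> 0 <= Kf mu p0 p1 alpha beta i t.
Proof. by move=> /andP[t0 _]; rewrite Kf_ge0// ltW. Qed.

Lemma nns_holm {I : Type} (phi : I -> nat -> \bar R) : nns phi -> nns (holm p0 p1 s tau phi).
Proof.
move=> h i m; rewrite /holm !adde_ge0 ?nns_smallI ?nns_smallJ//.
exact: (nns_rgrandS s tau hp0' hp01 h).
Qed.

Local Notation interpN theta := (fun i : J => nnorm (interp S0 S1 theta b E) (sval i)).
Local Notation discN theta x := (fun i : J => disc E (wseq (rhow theta) x i)).

Lemma interp_le_holm theta : lec (interpN theta) (discN theta (holm p0 p1 s tau fs)).
Proof.
apply: lec_trans (tnorm_weight_le hN (adm_interp theta)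
  (approx_Kf mu p0 p1 alpha beta) K0 K01) _.
apply: lec_trans (lec_disc_rho hp0' hp01 hs htau hN (Gam0 theta) (Gam_dbl theta)) _.
apply: (lec_disc hN).
- by move=> i m; exact: Gam0.
- by apply: nns_wseq_pos; [exact: rhow_gt0|exact: nns_holm].
- apply: (les_wseq (rhow_gt0 theta)); exact: Kf_upper.
Qed.

Lemma holm_le_interp theta : lec (discN theta (holm p0 p1 s tau fs)) (interpN theta).
Proof.
apply: (@lec_trans _ _ (fun i => disc E (fun n => Gam theta i (rho n)))).
  apply: (lec_disc hN).
  - by apply: nns_wseq_pos; [exact: rhow_gt0|exact: nns_holm].
  - by move=> i m; exact: Gam0.
  - apply: (les_wseq (rhow_gt0 theta)); exact: Kf_lower.
apply: lec_trans (lec_rho_disc hp0' hp01 hs htau hN (Gam0 theta) (Gam_dbl theta)) _.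
exact: (disc_weight_le hN (adm_interp theta) (approx_Kf mu p0 p1 alpha beta) K0 K01).
Qed.

Lemma lec_disc_rhow theta (x y : J -> nat -> \bar R) : nns x -> nns y -> les x y ->
  lec (discN theta x) (discN theta y).
Proof.
move=> x0 y0 xy; apply: (lec_disc hN); try (by apply: nns_wseq_pos => //; exact: rhow_gt0).
by apply: les_wseq => //; exact: rhow_gt0.
Qed.

Lemma holm_disc_le theta (G : J -> \bar R) :
  lec (discN theta (smallI p0 s fs)) G -> lec (discN theta (smallJ p0 s fs)) G ->
  lec (discN theta (wseq rho (grandS p1 tau fs))) G ->
  lec (discN theta (holm p0 p1 s tau fs)) G.
Proof.
move=> hI hJ hS; have v0 := rhow_gt0 theta.
have I0 := nns_smallI s hp0' fs0; have J0 := nns_smallJ s hp0' fs0.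
have S0' := nns_rgrandS s tau hp0' hp01 fs0.
apply: lec_trans (lecD (lecD hI hJ) hS); apply: lecW => i.
have IJ0 k : 0 <= wseq (rhow theta) (smallI p0 s fs) i k + wseq (rhow theta) (smallJ p0 s fs) i k.
  by rewrite adde_ge0// nns_wseq_pos.
apply: le_trans (leeD (disc_triangle hN _ _) (lexx _)); try (by move=> k; exact: nns_wseq_pos).
apply: le_trans (disc_triangle hN _ _) => //; last by move=> k; exact: nns_wseq_pos.
rewrite le_eqVlt; apply/orP; left; apply/eqP; congr disc; apply/funext => k.
have r0 : 0 <= (rho k)%:E * grandS p1 tau fs i k by exact: S0'.
by rewrite /wseq /holm !ge0_muleDr// adde_ge0.
Qed.

Lemma smallJ_rhow_le theta : (0 < theta)%R ->
  lec (discN theta (smallJ p0 s fs)) (discN theta (omega p0 s fs)).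
Proof.
move=> t0; have [e [D [e0 D0 h]]] := rho_tail_weight hp0' hp01 hs htau hb t0.
exact: (hardy_tail (nns_omega p0 s fs0) (nns_smallJ s hp0' fs0) (rhow_gt0 theta) e0 D0 hE h
  (smallJ_le hp0' hs fs0)).
Qed.

Lemma smallI_rhow_le theta : (0 < theta)%R ->
  lec (discN theta (smallI p0 s fs)) (discN theta (omega p0 s fs)).
Proof.
move=> t0; have [e [D [e0 D0 h]]] := rho_tail_weight hp0' hp01 hs htau hb t0.
apply: lec_trans (smallJ_rhow_le t0).
exact: (hardy_tail (nns_smallJ s hp0' fs0) (nns_smallI s hp0' fs0) (rhow_gt0 theta) e0 D0 hE h
  (smallI_le s hp0' fs0)).
Qed.

Lemma rhow_rho theta m : (rhow theta m * rho m = rho m `^ (1 - theta) * ext1 b (rho m))%R.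
Proof.
rewrite /rhow addrC powRD ?(gt_eqF (rho0 m)) ?implybT// powRr1 ?(ltW (rho0 m))//.
by rewrite mulrAC.
Qed.

Lemma wseq_rhow_rho theta (x : J -> nat -> \bar R) :
  wseq (rhow theta) (wseq rho x) = wseq (fun m => rho m `^ (1 - theta) * ext1 b (rho m))%R x.
Proof. by apply/funext => i; apply/funext => k; rewrite /wseq muleA -EFinM rhow_rho. Qed.

Lemma omega_wseq : omega p0 s fs = wseq rho (omegar p1 tau fs).
Proof. by apply/funext => i; apply/funext => k; exact: omegaE. Qed.

(** Written with omega = rho times [omegar], both sides carry the weight rho^(1-theta) b(rho), which
    decays geometrically exactly because theta < 1. *)
Lemma grandS_rhow_le theta : (theta < 1)%R ->
  lec (discN theta (wseq rho (grandS p1 tau fs))) (discN theta (omega p0 s fs)).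
Proof.
rewrite -subr_gt0 => t0; have [e [D [e0 D0 h]]] := rho_head_weight hp0' hp01 hs htau hb t0.
have v0 k : (0 < rho k `^ (1 - theta) * ext1 b (rho k))%R.
  by rewrite mulr_gt0 ?powR_gt0// ext1_gt0.
rewrite omega_wseq (wseq_rhow_rho theta (grandS p1 tau fs)).
rewrite (wseq_rhow_rho theta (omegar p1 tau fs)).
exact: (hardy_head (nns_omegar p1 tau fs0) (nns_grandS tau hp0' hp01 fs0) v0 e0 D0 hE h
  (grandS_le hp0' hp01 htau fs0)).
Qed.

Lemma space_eq_interp theta (Y : nspace R (T -> R)) :
  (forall f, carr Y f <-> measurable_fun setT f /\ nnorm Y f < +oo) ->
  lec (interpN theta) (fun i : J => nnorm Y (sval i)) ->
  lec (fun i : J => nnorm Y (sval i)) (interpN theta) ->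
  space_eq (interp S0 S1 theta b E) Y.
Proof.
move=> hY [C C0 hC] [D D0 hD]; split.
  apply/seteqP; split => f.
    move=> [[mf _] /= Nf]; apply/hY; split => //.
    apply: le_lt_trans (hD (exist _ f mf)) _.
    by rewrite lte_mul_pinfty ?lee_fin ?(ltW D0)// tnorm_ge0.
  move=> /hY[mf Yf]; pose i : J := exist _ f mf.
  have Nf : nnorm (interp S0 S1 theta b E) f < +oo.
    (* The norm of an abstract [Y] might be negative, and multiplication by C is then bounded by
       0. *)
    have := hC i; case: (ltP (nnorm Y f) 0) => [Yneg|Y0] h.
      by apply: le_lt_trans h _; rewrite (le_lt_trans _ (ltry 0))// mule_ge0_le0 ?lee_fin ?(ltW C0) ?(ltW Yneg).
    by apply: le_lt_trans h _; rewrite lte_mul_pinfty ?lee_fin ?(ltW C0).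
  split => //; split => //.
  (* The interpolation space also asks for f in the small Lebesgue space. At index 0 the tail in I
     is the whole sequence, so the holm sequence at 0 dominates [norm0], and it is finite as one
     coordinate of a finite norm. *)
  have [A A0 hA] := holm_le_interp theta; have [B B0 hB] := disc_ge_term hN.
  have [F F0 hF] := smallL_le mu alpha hp0.
  apply: le_lt_trans (hF i) _.
  have H0 := nns_holm fs0.
  have wH0 : nns (wseq (rhow theta) (holm p0 p1 s tau fs)).
    by apply: nns_wseq_pos => //; exact: rhow_gt0.
  have : wseq (rhow theta) (holm p0 p1 s tau fs) i 0%N < +oo.
    apply: le_lt_trans (hB _ (wH0 i) 0%N) _.
    rewrite lte_mul_pinfty ?lee_fin ?(ltW B0)//.
    apply: le_lt_trans (hA i) _.
    by rewrite lte_mul_pinfty ?lee_fin ?(ltW A0)// tnorm_ge0.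
  have I0 := nns_smallI s hp0' fs0; have J0 := nns_smallJ s hp0' fs0.
  have S0' := nns_rgrandS s tau hp0' hp01 fs0.
  have n0E : norm0 p0 s fs i <= holm p0 p1 s tau fs i 0%N.
    rewrite /holm -addeA leeDl//; rewrite adde_ge0//; exact: S0'.
  rewrite /wseq => wH; rewrite lte_mul_pinfty ?lee_fin ?(ltW F0)//.
  apply: le_lt_trans n0E _; move: wH; rewrite !ltey; apply: contra => /eqP ->.
  by rewrite gt0_muley// lte_fin rhow_gt0.
exists D^-1%R, C; split => //; first by rewrite invr_gt0.
move=> f [[mf _] _]; split; last exact: (hC (exist _ f mf)).
by rewrite lee_pdivrMl//; exact: (hD (exist _ f mf)).
Qed.

End interpolation_norm.

(** * The three interpolation formulas *)

Section interpolation_spaces.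
Context {R : realType} {d : measure_display} {T : measurableType d}.
Variable mu : probability T R.
Local Open Scope ereal_scope.
Variables (E : (R -> \bar R) -> \bar R) (b : R -> R) (p0 p1 alpha beta : R).
Hypotheses (hE : ri_norm E) (hb : SV01 b) (hp0 : (1 < p0)%R) (hp01 : (p0 < p1)%R)
  (halpha : (0 < alpha)%R) (hbeta : (0 < beta)%R).

Local Notation J := (@mfun_idx R d T).
Local Notation fs := (fseq mu).
Let s : R := (alpha / conj_exp p0)%R.
Let tau : R := (beta / p1)%R.
Let hs : (0 < s)%R := s_gt0 hp0 halpha.
Let hp0' : (1 <= p0)%R. Proof. exact: ltW. Qed.
Let hp1' : (1 <= p1)%R. Proof. exact: le_trans (ltW hp01). Qed.
Let htau : (0 < tau)%R. Proof. by rewrite divr_gt0// (lt_le_trans ltr01). Qed.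
Local Notation rho := (rhos p0 p1 s tau).
Local Notation S0 := (smallL mu p0 alpha).
Local Notation S1 := (grandL mu p1 beta).
Let hN := rearr_norm_ri hE.
Let fs0 : nns fs := @fseq_ge0 _ _ _ mu.
Let rho0 m : (0 < rho m)%R. Proof. exact: rhos_gt0. Qed.
Let hLeb (q : \bar R) : 1 <= q -> rearr_norm (Leb q : (R -> \bar R) -> \bar R).
Proof. exact: rearr_norm_Leb. Qed.

Let I0 := nns_smallI s hp0' fs0.
Let J0 := nns_smallJ s hp0' fs0.
Let rS0 := nns_rgrandS s tau hp0' hp01 fs0.
Let om0 := nns_omega p0 s fs0.

Local Notation rw := (rhow b p0 p1 alpha beta).
Local Notation interpN theta := (fun i : J => nnorm (interp S0 S1 theta b E) (sval i)).
Local Notation discN theta x := (fun i : J => disc E (wseq (rw theta) x i)).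
Local Notation brho := (fun k => ext1 b (rho k)).
Local Notation rhof := (fun u : R => u `^ (p0^-1 - p1^-1) *
  ell u `^ (alpha / conj_exp p0 + beta / p1))%R.

Let hbrho := adm_brho p0 p1 alpha beta hb.

Let rhow0 : rw 0 = brho.
Proof. by apply/funext => m; rewrite /rhow oppr0 powRr0 mul1r. Qed.

Let holm_rho1 (x : J -> nat -> \bar R) : wseq (rw 1) (wseq rho x) = wseq brho x.
Proof.
rewrite wseq_rhow_rho; congr wseq; apply/funext => m.
by rewrite subrr powRr0 mul1r.
Qed.

Let wseqM (u v : nat -> R) (x : J -> nat -> \bar R) :
  wseq u (wseq v x) = wseq (fun k => u k * v k)%R x.
Proof. by apply/funext => i; apply/funext => k; rewrite /wseq muleA -EFinM. Qed.

Lemma le_holm_interp theta (x : J -> nat -> \bar R) : nns x ->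
  les x (holm p0 p1 s tau fs) -> lec (discN theta x) (interpN theta).
Proof.
move=> x0 xH; apply: lec_trans (holm_le_interp mu hE hb hp0 hp01 halpha hbeta theta).
by apply: (lec_disc_rhow p0 p1 alpha beta hE hb) => //; exact: nns_holm.
Qed.

Lemma smallI_le_holm : les (smallI p0 s fs) (holm p0 p1 s tau fs).
Proof. by apply: lesW => i k; rewrite /holm -addeA leeDl// adde_ge0//; exact: rS0. Qed.

Lemma smallJ_le_holm : les (smallJ p0 s fs) (holm p0 p1 s tau fs).
Proof.
apply: lesW => i k; rewrite /holm addeAC leeDr// adde_ge0//; exact: rS0.
Qed.

Lemma grandS_le_holm : les (wseq rho (grandS p1 tau fs)) (holm p0 p1 s tau fs).
Proof. by apply: lesW => i k; rewrite /holm leeDr// adde_ge0. Qed.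

Lemma lec_maxe {I : Type} (F G H : I -> \bar R) : (forall i, 0 <= F i) -> (forall i, 0 <= G i) ->
  lec F H -> lec G H -> lec (fun i => maxe (F i) (G i)) H.
Proof.
move=> F0 G0 FH GH; apply: lec_trans (lecD FH GH); apply: lecW => i.
by rewrite ge_max leeDl// leeDr.
Qed.

Lemma lec_maxl {I : Type} (F G H : I -> \bar R) : lec F G -> lec F (fun i => maxe (G i) (H i)).
Proof. by move=> /lec_trans; apply; apply: lecW => i; rewrite le_max lexx. Qed.

Lemma lec_maxr {I : Type} (F G H : I -> \bar R) : lec F H -> lec F (fun i => maxe (G i) (H i)).
Proof. by move=> /lec_trans; apply; apply: lecW => i; rewrite le_max lexx orbT. Qed.

Lemma space_eq_cap theta (N1 N2 : (T -> R) -> \bar R) :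
  (forall f, 0 <= N1 f) -> (forall f, 0 <= N2 f) ->
  lec (interpN theta) (fun i => maxe (N1 (sval i)) (N2 (sval i))) ->
  lec (fun i => N1 (sval i)) (interpN theta) -> lec (fun i => N2 (sval i)) (interpN theta) ->
  space_eq (interp S0 S1 theta b E) (space_cap (space_of N1) (space_of N2)).
Proof.
move=> N10 N20 h h1 h2; apply: (space_eq_interp hE hb hp0 hp01 halpha hbeta) => //=.
  move=> f; rewrite gt_max; split=> [[[mf ->] [_ ->]] //|[mf /andP[f1 f2]]]; split; split => //.
by apply: lec_maxe.
Qed.

(** For 0 < theta < 1 both Hardy inequalities hold, so all three terms reduce to omega. The
    exponents of rho^{-theta} and omega combine to 1/p for the power and to the exponent of B_theta
    for the logarithm, which is [wE]. *)
Lemma interp_mid theta p : (0 < theta < 1)%R -> (p^-1 = (1 - theta) / p0 + theta / p1)%R ->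
  space_eq (interp S0 S1 theta b E)
    (ultraL mu p (fun u => ell u `^ (alpha * (1 - theta) / conj_exp p0 - beta * theta / p1) *
      ext1 b (rhof u))%R E).
Proof.
move=> /andP[t0 t1] hp.
pose kap := (alpha * (1 - theta) / conj_exp p0 - beta * theta / p1)%R.
have hw := adm_mul (adm_expw p^-1) (adm_mul (adm_logw kap) hbrho).
have wE : wseq (fun k => expw p^-1 k * (logw kap k * ext1 b (rho k)))%R fs =
    wseq (rw theta) (omega p0 s fs).
  rewrite /omega wseqM; congr wseq; apply/funext => k.
  rewrite /rhow -/s -/tau.
  have -> : (rho k `^ (- theta) = expw (- theta * (p0^-1 - p1^-1)) k *
      logw (- theta * (s + tau)) k)%R.
    rewrite /rhos powRM ?(ltW (expw_gt0 _ _)) ?(ltW (logw_gt0 _ _))//.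
    congr (_ * _)%R; first by rewrite /expw -expRM; congr expR; ring.
    by rewrite /logw -powRrM; congr powR; ring.
  have -> : (kap = - theta * (s + tau) + s)%R by rewrite /kap /s /tau; ring.
  rewrite -logwD hp.
  have -> : (expw ((1 - theta) / p0 + theta / p1) k =
      expw (- theta * (p0^-1 - p1^-1)) k * expw p0^-1 k)%R.
    by rewrite /expw -expRD; congr expR; ring.
  by ring.
have apx := approx_fseq mu; have f01 := @fstar_ge0_01 _ _ _ mu.
apply: (space_eq_interp hE hb hp0 hp01 halpha hbeta) => //.
- apply: lec_trans (interp_le_holm mu hE hb hp0 hp01 halpha hbeta theta) _.
  apply: (@lec_trans _ _ (discN theta (omega p0 s fs))).
    apply: (holm_disc_le hE hb hp0 hp01).
    + exact: smallI_rhow_le.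
    + exact: smallJ_rhow_le.
    + exact: grandS_rhow_le.
  have := disc_weight_le hN hw apx fs0 f01.
  by rewrite wE.
- apply: (@lec_trans _ _ (discN theta (omega p0 s fs))).
    by have := tnorm_weight_le hN hw apx fs0 f01; rewrite wE.
  apply: le_holm_interp => //.
  exact: les_trans (omega_le s hp0' fs0) smallJ_le_holm.
Qed.

(** With weight b(rho_m) alone there is no geometric gain along tails, so I and J stay: J is the
    norm of the L space and I that of the L,L space. The grand term is below omega, hence below
    J. *)
Lemma interp_zero : space_eq (interp S0 S1 0 b E)
  (space_cap
    (spaceL mu p0 (fun u => ell u `^ (alpha / conj_exp p0) * ext1 b (rhof u))%R E
      (cst 1%R) (Leb p0%:E))
    (spaceLL mu p0 (fun u => ext1 b (rhof u)) E
      (fun u => ell u `^ (alpha / conj_exp p0 - 1))%R (Leb 1) (cst 1%R) (Leb p0%:E))).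
Proof.
have hw := adm_mul (adm_logw s) hbrho.
have A0 := nns_smallA hp0' fs0; have apx := approx_small mu hp0'.
have A01 := tnorm_ge0_01 (hLeb (hp0' : 1 <= p0%:E)) (fun t => `]0%R, t[%classic)
  (fun i : J => wstar mu p0 (cst 1%R) (sval i)).
have N1 := hLeb (lexx 1).
have apxI := approx_tail N1 (adm_logw (s - 1)) apx A0 A01 (smallA_dbl mu hp0').
have I01 := tnorm_ge0_01 N1 (fun t => `]0%R, t[%classic)
  (fun (i : J) t => (ell t `^ (s - 1))%:E *
    tnorm (Leb p0%:E) `]0%R, t[ (wstar mu p0 (cst 1%R) (sval i))).
have wJ : wseq (fun k => logw s k * ext1 b (rho k))%R (smallA p0 fs) =
    wseq (rw 0) (smallJ p0 s fs).
  by rewrite rhow0 /smallJ wseqM; congr wseq; apply/funext => k; rewrite mulrC.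
have wI : wseq brho (smallI p0 s fs) = wseq (rw 0) (smallI p0 s fs) by rewrite rhow0.
have J1 := disc_weight_le hN hw apx A0 A01; rewrite wJ in J1.
have J2 := tnorm_weight_le hN hw apx A0 A01; rewrite wJ in J2.
have I1 := disc_weight_le hN hbrho apxI I0 I01.
rewrite -/(smallI p0 s fs) wI in I1.
have I2 := tnorm_weight_le hN hbrho apxI I0 I01.
rewrite -/(smallI p0 s fs) wI in I2.
apply: space_eq_cap => [f|f|||]; try exact: tnorm_ge0.
- apply: lec_trans (interp_le_holm mu hE hb hp0 hp01 halpha hbeta 0) _.
  match goal with |- lec _ ?G => set M := G end.
  have hJ : lec (discN 0 (smallJ p0 s fs)) M.
    exact: lec_maxl J1.
  have hI : lec (discN 0 (smallI p0 s fs)) M.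
    exact: lec_maxr I1.
  apply: (holm_disc_le hE hb hp0 hp01) => //.
  apply: lec_trans hJ.
  apply: lec_trans (grandS_rhow_le mu hE hb hp0 hp01 halpha hbeta ltr01) _.
  by apply: (lec_disc_rhow p0 p1 alpha beta hE hb) => //; exact: omega_le.
- apply: (lec_trans J2); apply: le_holm_interp => //; exact: smallJ_le_holm.
- apply: (lec_trans I2); apply: le_holm_interp => //; exact: smallI_le_holm.
Qed.

(** Now heads have no geometric gain. After cancelling rho, [grandS] is the norm of the R,R space
    and its last entry, l^{-tau} times [grandD], that of the R space. I and J are below omega, which
    this last entry dominates. *)
Lemma interp_one : space_eq (interp S0 S1 1 b E)
  (space_cap
    (spaceR mu p1 (fun u => ell u `^ (- (beta / p1)) * ext1 b (rhof u))%R E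
      (cst 1%R) (Leb p1%:E))
    (spaceRR mu p1 (fun u => ext1 b (rhof u)) E
      (fun u => ell u `^ (- (beta / p1)))%R (Leb +oo) (cst 1%R) (Leb p1%:E))).
Proof.
have hw := adm_mul (adm_logw (- tau)) hbrho.
have D0 := nns_grandD hp0' hp01 fs0; have apx := approx_grand mu hp1'.
have G0 := nns_grandS tau hp0' hp01 fs0.
have wD0 : nns (wseq (logw (- tau)) (grandD p1 fs)).
  by apply: nns_wseq_pos => // k; exact: logw_gt0.
have rwD0 : nns (wseq rho (wseq (logw (- tau)) (grandD p1 fs))) by exact: nns_wseq_pos.
have or0 := nns_omegar p1 tau fs0.
have D01 := tnorm_ge0_01 (hLeb (hp1' : 1 <= p1%:E)) (fun t => `]t, 1%R[%classic)
  (fun i : J => wstar mu p1 (cst 1%R) (sval i)).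
have N1 := hLeb (leey 1).
have apxS := approx_head N1 (adm_logw (- tau)) apx D0 D01.
have S01 := tnorm_ge0_01 N1 (fun t => `]t, 1%R[%classic)
  (fun (i : J) t => (ell t `^ (- tau))%:E *
    tnorm (Leb p1%:E) `]t, 1%R[ (wstar mu p1 (cst 1%R) (sval i))).
have wD : wseq (fun k => logw (- tau) k * ext1 b (rho k))%R (grandD p1 fs) =
    wseq (rw 1) (wseq rho (wseq (logw (- tau)) (grandD p1 fs))).
  by rewrite holm_rho1 wseqM; congr wseq; apply/funext => k; rewrite mulrC.
have D1 := disc_weight_le hN hw apx D0 D01; rewrite wD in D1.
have D2 := tnorm_weight_le hN hw apx D0 D01; rewrite wD in D2.
have G1 := disc_weight_le hN hbrho apxS G0 S01.
rewrite -/(grandS p1 tau fs) -holm_rho1 in G1.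
have G2 := tnorm_weight_le hN hbrho apxS G0 S01.
rewrite -/(grandS p1 tau fs) -holm_rho1 in G2.
apply: space_eq_cap => [f|f|||]; try exact: tnorm_ge0.
- apply: lec_trans (interp_le_holm mu hE hb hp0 hp01 halpha hbeta 1) _.
  match goal with |- lec _ ?G => set M := G end.
  have hD : lec (discN 1 (wseq rho (wseq (logw (- tau)) (grandD p1 fs)))) M.
    exact: lec_maxl D1.
  have hG : lec (discN 1 (wseq rho (grandS p1 tau fs))) M.
    exact: lec_maxr G1.
  have hom : lec (discN 1 (omega p0 s fs)) M.
    apply: lec_trans hD; rewrite (omega_wseq mu p0 p1 alpha beta).
    apply: (lec_disc_rhow p0 p1 alpha beta hE hb) => //; first exact: nns_wseq_pos.
    by apply: les_wseq => //; exact: (omegar_le tau hp0' hp01 fs0).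
  apply: (holm_disc_le hE hb hp0 hp01) => //; apply: lec_trans hom.
  + exact: smallI_rhow_le.
  + exact: smallJ_rhow_le.
- apply: (lec_trans D2); apply: le_holm_interp => //; apply: les_trans grandS_le_holm.
  by apply: les_wseq => //; exact: (grandD_le tau hp0' hp01 fs0).
- by apply: (lec_trans G2); apply: le_holm_interp => //; exact: grandS_le_holm.
Qed.

End interpolation_spaces.

Theorem corollary5p10 (R : realType) (d : measure_display)
    (T : measurableType d) (mu : probability T R)
    (E : (R -> \bar R) -> \bar R) (b : R -> R) (p0 p1 alpha beta : R)
    (hE : ri_norm E) (hb : SV01 b) (hp0 : 1 < p0) (hp01 : p0 < p1)
    (halpha : 0 < alpha) (hbeta : 0 < beta) :
  let rho := fun u : R => u `^ (p0^-1 - p1^-1) *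
    ell u `^ (alpha / conj_exp p0 + beta / p1) in
  let brho := fun u : R => ext1 b (rho u) in
  [/\ (forall theta p : R, 0 < theta < 1 ->
        p^-1 = (1 - theta) / p0 + theta / p1 ->
        space_eq
          (interp (smallL mu p0 alpha) (grandL mu p1 beta) theta b E)
          (ultraL mu p
            (fun u => ell u `^ (alpha * (1 - theta) / conj_exp p0
                                - beta * theta / p1) * brho u) E)),
      space_eq
        (interp (smallL mu p0 alpha) (grandL mu p1 beta) 0 b E)
        (space_cap
          (spaceL mu p0 (fun u => ell u `^ (alpha / conj_exp p0) * brho u) E
            (cst 1) (Leb p0%:E))
          (spaceLL mu p0 brho E
            (fun u => ell u `^ (alpha / conj_exp p0 - 1)) (Leb 1%:E)
            (cst 1) (Leb p0%:E)))
    & ((tnorm E `]0%R, 1%R[ (EFin \o b) < +oo)%E ->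
      space_eq
        (interp (smallL mu p0 alpha) (grandL mu p1 beta) 1 b E)
        (space_cap
          (spaceR mu p1 (fun u => ell u `^ (- (beta / p1)) * brho u) E
            (cst 1) (Leb p1%:E))
          (spaceRR mu p1 brho E
            (fun u => ell u `^ (- (beta / p1))) (Leb +oo%E)
            (cst 1) (Leb p1%:E))))].
Proof.
move=> rhof brho; split=> [theta p| |_].
- exact: interp_mid.
- exact: interp_zero.
- exact: interp_one.
Qed.
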